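(* Let $0<\alpha\le\frac12$, let $f\in\mathcal{A}_\alpha\setminus\{0\}$ and let $M>0$. There exists a sequence of functions $\{g_n\}_{n=1}^\infty\subset A(\mathbb{D})$ such that: (1) for all $n\in\mathbb{N}$, $f_n:=fg_n\in\mathcal{A}_\alpha$, and $\lim_{n\to\infty}\|f_n-f\|_{\mathcal{A}_\alpha}=0$; (2) for every $n$ there is a constant $C_n$ with $|g_n(\xi)|\le C_n\, d(\xi,E_f)^{M}$ for all $\xi\in\mathbb{T}$, where $E_f:=\{\xi\in\mathbb{T}: f(\xi)=0\}$.
   Context: $\mathbb{D}$ is the open unit disk in $\mathbb{C}$, $\mathbb{T}$ its boundary, $A(\mathbb{D})$ the disc algebra (functions analytic on $\mathbb D$ and continuous on $\overline{\mathbb D}$), and $dA(z)=\frac1\pi r\,dr\,dt$ normalized area measure on $\mathbb{D}$. The Dirichlet space $\mathcal{D}$ is the set of analytic $f$ on $\mathbb{D}$ with $D(f):=\int_{\mathbb{D}}|f'(z)|^2\,dA(z)<\infty$. For $0<\alpha\le 1$, $\mathrm{lip}_\alpha$ is the algebra of functions $f$ analytic on $\mathbb{D}$ and continuous on $\overline{\mathbb{D}}$ with $|f(z)-f(w)|=o(|z-w|^\alpha)$ as $|z-w|\to0$ ($z,w\in\overline{\mathbb D}$); equivalently $|f'(z)|=o((1-|z|)^{\alpha-1})$ as $|z|\to1^-$. Its norm is $\|f\|_\alpha:=\|f\|_\infty+\sup\{(1-|z|)^{1-\alpha}|f'(z)|: z\in\mathbb{D}\}$, where $\|f\|_\infty=\sup_{z\in\mathbb{D}}|f(z)|$.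 For $0<\alpha\le\frac12$, $\mathcal{A}_\alpha:=\mathcal{D}\cap\mathrm{lip}_\alpha$, a commutative Banach algebra with the norm $\|f\|_{\mathcal{A}_\alpha}:=\|f\|_\alpha+D^{1/2}(f)$. For $E\subset\mathbb{T}$, $d(\xi,E)$ is the distance from $\xi\in\mathbb{T}$ to $E$, with the convention $d(\xi,\emptyset)=1$. *)

(* Defs.v *)
From HB Require Import structures.
From mathcomp Require Import all_boot all_order all_algebra.
From mathcomp Require Import all_classical all_reals all_analysis.
From mathcomp.real_closed Require Export complex.

Set Implicit Arguments.
Unset Strict Implicit.
Unset Printing Implicit Defensive.

Import Order.TTheory GRing.Theory Num.Theory.
Import numFieldNormedType.Exports.
Import ComplexField.Normc.

Local Open Scope classical_set_scope.
Local Open Scope ring_scope.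

(* The complex numbers, as a normed space over themselves: [derivable f z 1] and
   ['D_1 f z] are then complex differentiability at z and the complex derivative.
   The norm [`|z|] is R[i]-valued; the real modulus is [normc z : R].
   Functions on the (closed) disc are total functions, and every notion below
   looks only at their values on the closed disc. *)
Notation Cplx R := (R[i]^o).

Section Defs.
Variable R : realType.
Local Notation C := (Cplx R).
Implicit Types (f : C -> C) (alpha : R).

Definition disc : set C := [set z | normc z < 1].
Definition closed_disc : set C := [set z | normc z <= 1].
Definition unit_circle : set C := [set z | normc z = 1].

Definition analytic_on_disc : set (C -> C) :=
  [set f | forall z, disc z -> derivable f z 1].

Definition disc_algebra : set (C -> C) :=
  [set f | analytic_on_disc f /\ {within closed_disc, continuous f}].

Definition polar (r t : R) : C := Complex (r * cos t) (r * sin t).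

(* D(f), the integral of |f'|^2 over the disc against dA = (1/pi) r dr dt. *)
Definition dirichlet_integral f : \bar R :=
  ((pi^-1)%R%:E * \int[(@lebesgue_measure R \x @lebesgue_measure R)%E]_(p in
      (`[0%R, 1%R[%classic `*` `[0%R, (2 * pi)%R]%classic))
      (normc ('D_1 f (polar p.1 p.2)) ^+ 2 * p.1)%R%:E)%E.

Definition dirichlet_space : set (C -> C) :=
  [set f | analytic_on_disc f /\ (dirichlet_integral f < +oo)%E].

Definition lip_space alpha : set (C -> C) :=
  [set f | disc_algebra f /\
    forall eps : R, 0 < eps -> exists2 delta : R, 0 < delta &
      forall z w, closed_disc z -> closed_disc w -> normc (z - w) < delta ->
        normc (f z - f w) <= eps * normc (z - w) `^ alpha].

Definition sup_norm f : \bar R := ereal_sup [set (normc (f z))%:E | z in disc].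

Definition lip_norm alpha f : \bar R :=
  (sup_norm f +
   ereal_sup [set ((1 - normc z) `^ (1 - alpha) * normc ('D_1 f z))%:E
             | z in disc])%E.

Definition A_space alpha : set (C -> C) := dirichlet_space `&` lip_space alpha.

Definition A_norm alpha f : \bar R :=
  (lip_norm alpha f + sqrte (dirichlet_integral f))%E.

Definition zero_set f : set C := [set xi | unit_circle xi /\ f xi = 0].

Definition dist_to (E : set C) (xi : C) : R :=
  if E == set0 then 1 else inf [set normc (xi - zeta) | zeta in E].

End Defs.

(* Main.v *)
(** Write [k = M / alpha], [delta = 1 - |z|] and let [omega z] be the Poisson mean
    of [|f zeta - f z|] over the circle.  The multiplier [g_n = exp G_n] is the
    outer function with boundary modulus [min (1, e^n |f|)^k]; on the circle this is
    at most [e^(nk) |f|^k], hence [O(d(., E_f)^M)] because [f] is Hoelder of order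
    [alpha].

    The key estimate is [|f G_n'| <= 4 k omega / delta], uniformly in [n].  Since the
    kernel of [G_n'] has mean zero and modulus at most [2 / delta] times the Poisson
    kernel, it reduces to bounding the Poisson mean of [|ln|f| - ln|f z||] by
    [2 omega z / |f z|].  That follows from subharmonicity of [ln|f|]: for [v] of
    nonnegative Poisson mean, the mean of [|v|] is at most twice the mean of [v^+], and
    [(ln|f zeta| - ln|f z|)^+ <= |f zeta - f z| / |f z|].

    Consequently [|(f g_n)'| <= |f'| + 4 k omega / delta] for every [n].  The right-hand
    side is [o(delta^(alpha - 1))], which by the Hardy-Littlewood lemma extends [f g_n]
    to the closed disc inside lip_alpha, and it is square integrable over the disc: by
    Cauchy-Schwarz [(omega / delta)^2] is a weighted integral of [|f zeta - f z|^2],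
    which Hardy's inequality along radii and a translation estimate along circles
    control by the Dirichlet integral.  As [g_n -> 1] and [f g_n G_n' -> 0] locally
    uniformly, both parts of the norm of [f g_n - f] tend to zero by domination. *)
Require Import Defs.
From HB Require Import structures.
From mathcomp Require Import all_boot all_order all_algebra.
From mathcomp Require Import all_classical all_reals all_analysis.
From mathcomp Require Import measurable_realfun ring lra.
Set Implicit Arguments.
Unset Strict Implicit.
Unset Printing Implicit Defensive.
Import Order.TTheory GRing.Theory Num.Theory.
Import numFieldNormedType.Exports.
Import ComplexField.Normc.
Local Open Scope classical_set_scope.
Local Open Scope ring_scope.

(** * Complex calculus *)

(** The condition [alpha <= 1/2] enters through the weight |zeta - z|^(-3/2): the factor |zeta -
    z|^alpha gained from the smoothness of [f] is traded for |zeta - z|^(1/2), and the Poisson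
    kernel then leaves a weight whose circle mean is O(delta^(-1/2)). The multipliers oscillate
    where [f] vanishes, so every derivative estimate concerns the product [f g_n], in which [f]
    cancels the factor 1/|f z| of the mean oscillation of ln|f|. ln|f| is unbounded below on the
    circle; it is reached through the continuous truncations ln max (|f|, e^-j), and one interior
    point with [f z != 0] bounds all their means. The square integrability of [omega / delta] is a
    Schur test. The angle is written pi (1 - q), and a displacement by that angle is estimated by a
    detour through the circle of radius q, so that depth and angle become one variable and Hardy's
    inequality serves both. Energies are integrated up to a radius rho < 1, where all integrands are
    continuous, with bounds independent of rho. *)

Section Complex.
Context {R : realType}.
Local Notation C := (Cplx R).
Local Notation Re := (@complex.Re R).
Local Notation Im := (@complex.Im R).
Implicit Types (z w : C) (x y t : R).

Definition rc (x : R) : C := Complex x 0.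
Definition cis (t : R) : C := Complex (cos t) (sin t).
Definition cexp (w : C) : C := rc (expR (Re w)) * cis (Im w).

Lemma complex_eq (z w : C) : Re z = Re w -> Im z = Im w -> z = w.
Proof. by case: z w => a b [c d] /= -> ->. Qed.

Lemma cReD z w : Re (z + w) = Re z + Re w. Proof. by case: z w => ? ? []. Qed.
Lemma cImD z w : Im (z + w) = Im z + Im w. Proof. by case: z w => ? ? []. Qed.
Lemma cReN z : Re (- z) = - Re z. Proof. by case: z. Qed.
Lemma cImN z : Im (- z) = - Im z. Proof. by case: z. Qed.
Lemma cReM z w : Re (z * w) = Re z * Re w - Im z * Im w.
Proof. by case: z w => ? ? []. Qed.
Lemma cImM z w : Im (z * w) = Re z * Im w + Im z * Re w.
Proof. by case: z w => ? ? []. Qed.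
Definition ReImE := (cReD, cImD, cReN, cImN, cReM, cImM).

Lemma rcD x y : rc (x + y) = rc x + rc y.
Proof. by apply: complex_eq; rewrite !ReImE /= ?addr0. Qed.
Lemma rcM x y : rc (x * y) = rc x * rc y.
Proof. by apply: complex_eq; rewrite !ReImE /= !(mulr0, mul0r, subr0, addr0). Qed.
Lemma rcN x : rc (- x) = - rc x.
Proof. by apply: complex_eq; rewrite !ReImE /= ?oppr0. Qed.

Lemma normcE z : normc z = Num.sqrt (Re z ^+ 2 + Im z ^+ 2).
Proof. by case: z. Qed.

Lemma normc_ge0 z : 0 <= normc z.
Proof. by rewrite normcE sqrtr_ge0. Qed.

Lemma normc_sqr z : normc z ^+ 2 = Re z ^+ 2 + Im z ^+ 2.
Proof. by rewrite normcE sqr_sqrtr // addr_ge0 // sqr_ge0. Qed.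

Lemma normc_mul z w : normc (z * w) = normc z * normc w.
Proof. exact: (@normcM R z w). Qed.

Lemma normc_add z w : normc (z + w) <= normc z + normc w.
Proof. exact: (@le_normcD R z w). Qed.

Lemma normc_opp z : normc (- z) = normc z.
Proof. exact: (@normcN R z). Qed.

Lemma normc_sub z w : normc (z - w) <= normc z + normc w.
Proof. by rewrite (le_trans (normc_add _ _)) // normc_opp. Qed.

Lemma normc_distC z w : normc (z - w) = normc (w - z).
Proof. by rewrite -normc_opp opprB. Qed.

Lemma normc_tri z w v : normc (z - v) <= normc (z - w) + normc (w - v).
Proof.
have -> : z - v = (z - w) + (w - v) by rewrite addrA subrK.
exact: normc_add.
Qed.

Lemma normc_sub_ge z w : normc z - normc w <= normc (z - w).
Proof. by rewrite lerBlDr (le_trans _ (normc_add _ _)) // subrK. Qed.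

Lemma normc_rc x : normc (rc x) = `|x|.
Proof. by rewrite normcE /= expr0n /= addr0 sqrtr_sqr. Qed.

Lemma normcr0 : normc (0 : C) = 0.
Proof. exact: normc0. Qed.

Lemma normcr1 : normc (1 : C) = 1.
Proof. exact: normc1. Qed.

Lemma normc_eq0 z : (normc z == 0) = (z == 0).
Proof.
by apply/eqP/eqP => [/eq0_normc //|->]; rewrite normcr0.
Qed.

Lemma normc_gt0 z : (0 < normc z) = (z != 0).
Proof. by rewrite lt_def normc_ge0 andbT normc_eq0. Qed.

Lemma normc_inv z : normc (z^-1) = (normc z)^-1.
Proof. exact: (@normcV R z). Qed.

Lemma normc_div z w : normc (z / w) = normc z / normc w.
Proof. by rewrite normc_mul normc_inv. Qed.

Lemma normc_exp z n : normc (z ^+ n) = normc z ^+ n.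
Proof. by elim: n => [|n IH]; rewrite ?normcr1 // !exprS normc_mul IH. Qed.

Lemma Re_le_normc z : `|Re z| <= normc z.
Proof.
rewrite -(@ler_pXn2r _ 2) ?nnegrE ?normc_ge0 // normc_sqr real_normK ?num_real //.
by rewrite lerDl sqr_ge0.
Qed.

Lemma Im_le_normc z : `|Im z| <= normc z.
Proof.
rewrite -(@ler_pXn2r _ 2) ?nnegrE ?normc_ge0 // normc_sqr real_normK ?num_real //.
by rewrite lerDr sqr_ge0.
Qed.

Lemma normc_le_ReIm z : normc z <= `|Re z| + `|Im z|.
Proof.
rewrite -(@ler_pXn2r _ 2) ?nnegrE ?normc_ge0 ?addr_ge0 // normc_sqr.
by rewrite sqrrD !real_normK ?num_real // -addrA lerD2l lerDr mulrn_wge0 //.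
Qed.

Lemma normc_cis t : normc (cis t) = 1.
Proof. by rewrite normcE /= cos2Dsin2 sqrtr1. Qed.

Lemma cis_neq0 t : cis t != 0.
Proof. by rewrite -normc_eq0 normc_cis oner_eq0. Qed.

Lemma cisD t s : cis (t + s) = cis t * cis s.
Proof. by apply: complex_eq; rewrite !ReImE /= ?cosD // sinD addrC. Qed.

Lemma cis0 : cis 0 = 1.
Proof. by apply: complex_eq; rewrite /= ?cos0 ?sin0. Qed.

Lemma cisN t : cis (- t) = (cis t)^-1.
Proof.
apply: (mulfI (cis_neq0 t)).
by rewrite -cisD subrr cis0 mulfV // cis_neq0.
Qed.

Lemma cisD2pi t : cis (t + 2 * pi) = cis t.
Proof. by rewrite /cis mulr_natl cosD2pi sinD2pi. Qed.

Lemma polarE r t : polar r t = rc r * cis t.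
Proof. by apply: complex_eq; rewrite !ReImE /= ?mul0r ?subr0 ?addr0. Qed.

Lemma normc_polar r t : 0 <= r -> normc (polar r t) = r.
Proof. by move=> r0; rewrite polarE normc_mul normc_cis normc_rc mulr1 ger0_norm. Qed.

Lemma cexpD z w : cexp (z + w) = cexp z * cexp w.
Proof.
rewrite /cexp cReD cImD expRD cisD rcM; ring.
Qed.

Lemma cexp0 : cexp 0 = 1.
Proof.
rewrite /cexp /= expR0 cis0 mulr1; exact: complex_eq.
Qed.

Lemma normc_cexp w : normc (cexp w) = expR (Re w).
Proof. by rewrite normc_mul normc_rc normc_cis mulr1 ger0_norm ?expR_ge0. Qed.

Lemma unit_circle_cis z : unit_circle z -> exists2 t, 0 <= t <= 2 * pi & z = cis t.
Proof.
rewrite /unit_circle /= => z1.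
have [zR zI] : `|Re z| <= 1 /\ `|Im z| <= 1.
  by rewrite -z1 Re_le_normc Im_le_normc.
have /andP[R1 R2] : -1 <= Re z <= 1 by rewrite -ler_norml.
have cK : cos (acos (Re z)) = Re z by rewrite acosK // in_itv /= R1.
have sE : sin (acos (Re z)) = `|Im z|.
  rewrite sin_acos ?R1 //.
  have : normc z ^+ 2 = 1 by rewrite z1 expr1n.
  by rewrite normc_sqr => <-; rewrite addrAC subrr add0r sqrtr_sqr.
have a0 : 0 <= acos (Re z) by apply: acos_ge0; rewrite R1.
have api : acos (Re z) <= pi by apply: acos_lepi; rewrite R1.
have := pi_ge0 R => p0.
have [I0|I0] := leP 0 (Im z).
  exists (acos (Re z)); first by rewrite a0 /=; lra.
  by apply: complex_eq; rewrite /= ?cK // sE ger0_norm.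
(* On the lower half circle [acos] gives the angle of the conjugate point. *)
exists (2 * pi - acos (Re z)); first by lra.
rewrite addrC cisD2pi; apply: complex_eq; rewrite /= ?cosN ?sinN ?cK // sE ltr0_norm ?opprK //.
Qed.

(* The topology of [R[i]^o] is given by [R[i]]-valued balls; this is the
   translation to real radii. *)
Lemma nbhs_normcP z (P : set C) :
  nbhs z P <-> exists2 d : R, 0 < d & forall w, normc (w - z) < d -> P w.
Proof.
split.
  move=> /nbhs_normP [e /= e0 H].
  have [a a0 b0] : exists2 a, 0 < a & e = rc a.
    case: e e0 {H} => a b; rewrite ltcE /= => /andP[/eqP -> a0].
    by exists a.
  exists a => // w wz; apply: H; rewrite /= b0 distrC.
  by rewrite normc_def /= ltcR -normcE.
move=> [d d0 H]; apply/nbhs_ballP; exists (rc d); first by rewrite /= ltcR.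
by move=> w; rewrite -ball_normE /= distrC normc_def /= ltcR -normcE; exact: H.
Qed.
End Complex.

(** * Complex differentiability and the exponential *)

Section ComplexDerivative.
Context {R : realType}.
Local Notation C := (Cplx R).
Local Notation Re := (@complex.Re R).
Local Notation Im := (@complex.Im R).
Implicit Types (z w : C) (f g : C -> C).

Definition ccont f z :=
  forall eps : R, 0 < eps -> \forall w \near z, normc (f w - f z) <= eps.

(** A first-order expansion with real error bounds and no division; [cdiffP] shows it equivalent to
    [is_derive z 1 f L]. All derivatives below are combined in this form. *)
Definition cdiff f z (L : C) := forall eps : R, 0 < eps ->
  \forall w \near z, normc (f w - f z - L * (w - z)) <= eps * normc (w - z).

Lemma near_normc z (d : R) : 0 < d -> \forall w \near z, normc (w - z) < d.
Proof. by move=> d0; apply/nbhs_normcP; exists d. Qed.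

Lemma ccontP f z : ccont f z <-> f w @[w --> z] --> f z.
Proof.
split=> [H P /nbhs_normcP[d d0 dP]|H e e0]; last first.
  have /nbhs_normcP P := near_normc (f z) e0.
  have {}P := H _ (near_normc (f z) e0).
  by near=> w; apply: ltW; near: w.
have d2 : 0 < d / 2 by rewrite divr_gt0.
change (\forall w \near z, P (f w)); near=> w; apply: dP.
have : normc (f w - f z) <= d / 2 by near: w; exact: H.
by lra.
Unshelve. all: end_near. Qed.

Lemma ccont_near f z (P : set C) : ccont f z -> (\forall v \near f z, P v) ->
  \forall w \near z, P (f w).
Proof. by move/ccontP => H /H. Qed.

Lemma cdiff_bound f z L : cdiff f z L ->
  \forall w \near z, normc (f w - f z) <= (normc L + 1) * normc (w - z).
Proof.
move=> H; near=> w.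
have : normc (f w - f z - L * (w - z)) <= 1 * normc (w - z).
  by near: w; exact: H.
have := normc_add (f w - f z - L * (w - z)) (L * (w - z)).
rewrite subrK normc_mul; lra.
Unshelve. all: end_near. Qed.

Lemma cdiff_cont f z L : cdiff f z L -> ccont f z.
Proof.
move=> /cdiff_bound H e e0.
have K0 : 0 < normc L + 1 by have := normc_ge0 L; lra.
near=> w.
have h1 : normc (f w - f z) <= (normc L + 1) * normc (w - z) by near: w.
have h2 : normc (w - z) < e / (normc L + 1).
  by near: w; apply: near_normc; rewrite divr_gt0.
rewrite (le_trans h1) //.
by move: h2; rewrite ltr_pdivlMr // mulrC => /ltW.
Unshelve. all: end_near. Qed.

Lemma cdiffP f z L : is_derive z 1 f L <-> cdiff f z L.
Proof.
have key (h D : C) : h != 0 ->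
    normc (D - h^-1 *: ((f \o shift z) (h *: (1 : C)) - f z)) =
    normc (f (h + z) - f z - D * h) / normc h.
  move=> h0; rewrite -normc_div -normc_opp; congr (normc _).
  by rewrite /shift /= /GRing.scale /= mulr1; field.
have main D : h^-1 *: ((f \o shift z) (h *: (1 : C)) - f z) @[h --> (0 : C)^'] --> D
    <-> cdiff f z D.
  split=> [/cvgrPdist_le H e e0|H].
    have e0' : 0 < rc e by rewrite ltcR.
    have /nbhs_normcP[d d0 {}H] := H _ e0'.
    apply/nbhs_normcP; exists d => // w wz.
    have [->|/eqP wNz] := pselect (w = z).
      by rewrite !subrr mulr0 subrr normcr0 mulr0.
    have := H (w - z); rewrite subr0 subr_eq0 => /(_ wz wNz).
    rewrite normc_def lecR -normcE key ?subr_eq0 // subrK.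
    by rewrite ler_pdivrMr // normc_gt0 subr_eq0.
  apply/cvgrPdist_le => -[e b]; rewrite ltcE /= => /andP[/eqP -> e0].
  have /nbhs_normcP[d d0 {}H] := H _ e0.
  apply/nbhs_normcP; exists d => // h; rewrite subr0 => hd h0.
  rewrite normc_def lecR -normcE key // ler_pdivrMr ?normc_gt0 //.
  by have := H (h + z); rewrite addrK => /(_ hd).
split=> [[df <-]|/main H]; first by apply/main; exact: df.
constructor; first by apply/cvg_ex; exists L.
by apply/cvg_lim => //; exact: norm_hausdorff.
Qed.

Lemma cdiff_derive f z L : cdiff f z L -> 'D_1 f z = L.
Proof. by move=> /cdiffP[]. Qed.

Lemma cdiff_derivable f z L : cdiff f z L -> derivable f z 1.
Proof. by move=> /cdiffP[]. Qed.

Lemma derivable_cdiff f z : derivable f z 1 -> cdiff f z ('D_1 f z).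
Proof. by move=> d; apply/cdiffP; constructor. Qed.

Lemma cdiff_ext f g z L : (\forall w \near z, f w = g w) -> cdiff f z L -> cdiff g z L.
Proof.
move=> E H e e0; have Ez : f z = g z by exact: (nbhs_singleton E).
near=> w; have <- : f w = g w by near: w.
by rewrite -Ez; near: w; exact: H.
Unshelve. all: end_near. Qed.

Lemma cdiff_cst (c : C) z : cdiff (fun=> c) z 0.
Proof.
move=> e e0; near=> w.
by rewrite subrr mul0r subrr normcr0 mulr_ge0 ?normc_ge0 // ltW.
Unshelve. all: end_near. Qed.

Lemma cdiff_id z : cdiff id z 1.
Proof.
move=> e e0; near=> w.
by rewrite mul1r subrr normcr0 mulr_ge0 ?normc_ge0 // ltW.
Unshelve. all: end_near. Qed.

Lemma cdiffD f g z L M : cdiff f z L -> cdiff g z M ->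
  cdiff (fun w => f w + g w) z (L + M).
Proof.
move=> Hf Hg e e0; have e2 : 0 < e / 2 by rewrite divr_gt0.
near=> w.
have h1 : normc (f w - f z - L * (w - z)) <= e / 2 * normc (w - z).
  by near: w; exact: Hf.
have h2 : normc (g w - g z - M * (w - z)) <= e / 2 * normc (w - z).
  by near: w; exact: Hg.
have -> : f w + g w - (f z + g z) - (L + M) * (w - z) =
  (f w - f z - L * (w - z)) + (g w - g z - M * (w - z)) by ring.
by rewrite (le_trans (normc_add _ _)) //; lra.
Unshelve. all: end_near. Qed.

Lemma cdiffM f g z L M : cdiff f z L -> cdiff g z M ->
  cdiff (fun w => f w * g w) z (L * g z + f z * M).
Proof.
move=> Hf Hg e e0.
pose K := normc (g z) + 1 + normc L + normc (f z).
have K0 : 0 < K.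
  by rewrite /K; have := normc_ge0 (g z); have := normc_ge0 L;
    have := normc_ge0 (f z); lra.
have e1 : 0 < e / K by rewrite divr_gt0.
near=> w.
have h1 : normc (f w - f z - L * (w - z)) <= e / K * normc (w - z).
  by near: w; exact: Hf.
have h2 : normc (g w - g z - M * (w - z)) <= e / K * normc (w - z).
  by near: w; exact: Hg.
have h3 : normc (g w - g z) <= 1.
  by near: w; apply: (cdiff_cont Hg).
have h4 : normc (g w - g z) <= e / K.
  by near: w; apply: (cdiff_cont Hg).
have h5 : normc (g w) <= normc (g z) + 1.
  by have := normc_add (g w - g z) (g z); rewrite subrK; lra.
have -> : f w * g w - f z * g z - (L * g z + f z * M) * (w - z) =
  (f w - f z - L * (w - z)) * g w + L * (w - z) * (g w - g z)
  + f z * (g w - g z - M * (w - z)) by ring.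
apply: (le_trans (normc_add _ _)).
apply: (@le_trans _ _ (e / K * normc (w - z) * (normc (g z) + 1) +
   normc L * normc (w - z) * (e / K) + normc (f z) * (e / K * normc (w - z)))).
  rewrite lerD //.
    rewrite (le_trans (normc_add _ _)) // lerD // !normc_mul.
      by rewrite ler_pM ?normc_ge0.
    by rewrite ler_pM ?mulr_ge0 ?normc_ge0.
  by rewrite normc_mul ler_wpM2l ?normc_ge0.
rewrite le_eqVlt; apply/orP; left; apply/eqP.
have KN : K != 0 by rewrite gt_eqF.
transitivity (e / K * K * normc (w - z)); last by rewrite divfK.
by rewrite /K; ring.
Unshelve. all: end_near. Qed.

Lemma cdiffZ (c : C) f z L : cdiff f z L -> cdiff (fun w => c * f w) z (c * L).
Proof.
by move=> H; have := cdiffM (cdiff_cst c z) H; rewrite mul0r add0r.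
Qed.

Lemma cdiffN f z L : cdiff f z L -> cdiff (fun w => - f w) z (- L).
Proof.
move=> H; have := cdiffZ (-1) H; rewrite mulN1r.
by apply: cdiff_ext; near=> w; rewrite mulN1r.
Unshelve. all: end_near. Qed.

Lemma cdiffB f g z L M : cdiff f z L -> cdiff g z M ->
  cdiff (fun w => f w - g w) z (L - M).
Proof. by move=> Hf Hg; exact: cdiffD Hf (cdiffN Hg). Qed.

Lemma cdiff_comp f g z L M : cdiff f z L -> cdiff g (f z) M ->
  cdiff (fun w => g (f w)) z (M * L).
Proof.
move=> Hf Hg e e0.
pose K := normc L + 1 + normc M.
have K0 : 0 < K by rewrite /K; have := normc_ge0 L; have := normc_ge0 M; lra.
have e1 : 0 < e / K by rewrite divr_gt0.
near=> w.
have h1 : normc (f w - f z - L * (w - z)) <= e / K * normc (w - z).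
  by near: w; exact: Hf.
have h2 : normc (g (f w) - g (f z) - M * (f w - f z)) <= e / K * normc (f w - f z).
  by near: w; apply: (ccont_near (P := fun v => normc (g v - g (f z) - M * (v - f z)) <= e / K * normc (v - f z)) (cdiff_cont Hf)); exact: Hg.
have h3 : normc (f w - f z) <= (normc L + 1) * normc (w - z).
  by near: w; exact: cdiff_bound.
have -> : g (f w) - g (f z) - M * L * (w - z) =
  (g (f w) - g (f z) - M * (f w - f z)) + M * (f w - f z - L * (w - z)) by ring.
rewrite (le_trans (normc_add _ _)) // normc_mul.
have KN : K != 0 by rewrite gt_eqF.
apply: (@le_trans _ _ (e / K * ((normc L + 1) * normc (w - z)) +
   normc M * (e / K * normc (w - z)))).
  by rewrite lerD // ?(le_trans h2) // ler_wpM2l ?normc_ge0 // ltW.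
rewrite le_eqVlt; apply/orP; left; apply/eqP.
transitivity (e / K * K * normc (w - z)); last by rewrite divfK.
by rewrite /K; ring.
Unshelve. all: end_near. Qed.

Lemma cdiff_inv z : z != 0 -> cdiff (fun w => w^-1) z (- z ^- 2).
Proof.
move=> z0 e e0; have nz : 0 < normc z by rewrite normc_gt0.
near=> w.
have h1 : normc (w - z) < normc z / 2 by near: w; apply: near_normc; rewrite divr_gt0.
have h2 : normc (w - z) < e * (normc z ^+ 3 / 2).
  by near: w; apply: near_normc; rewrite mulr_gt0 // divr_gt0 // exprn_gt0.
have nw : normc z / 2 <= normc w.
  by have := normc_sub_ge z w; rewrite normc_distC; lra.
have w0 : w != 0 by rewrite -normc_gt0; lra.
(* The remainder is known exactly and quadratic, so it suffices to keep [w] away from 0. *)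
have -> : w^-1 - z^-1 - - z ^- 2 * (w - z) = (w - z) * (w - z) / (w * z ^+ 2).
  by field; rewrite ?w0 ?z0.
rewrite !normc_mul normc_inv normc_mul normc_exp -mulrA mulrC ler_wpM2r ?normc_ge0 //.
rewrite ler_pdivrMr; last by rewrite mulr_gt0 ?exprn_gt0 // normc_gt0.
apply: (le_trans (ltW h2)); rewrite ler_wpM2l ?(ltW e0) //.
rewrite exprS -mulrA mulrC -mulrA [X in _ <= X]mulrC ler_wpM2l ?exprn_ge0 ?normc_ge0 //.
by rewrite mulrC.
Unshelve. all: end_near. Qed.

Lemma is_derive_near (f : R -> R) (x L : R) : is_derive x 1 f L ->
  forall eps : R, 0 < eps -> \forall y \near x, `|f y - f x - L * (y - x)| <= eps * `|y - x|.
Proof.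
move=> [df <-] e e0.
have /cvgrPdist_le/(_ _ e0) :
  h^-1 *: ((f \o shift x) (h *: (1 : R)) - f x) @[h --> (0 : R)^'] --> 'D_1 f x := df.
move=> /nbhs_ballP[d /= d0 H]; apply/nbhs_ballP; exists d => // y.
rewrite -ball_normE /= distrC => yx.
have [->|/eqP yNx] := pselect (y = x); first by rewrite !subrr mulr0 subrr normr0 mulr0.
have yx0 : y - x != 0 by rewrite subr_eq0.
have := H (y - x); rewrite -ball_normE /= sub0r normrN => /(_ yx yx0).
rewrite /shift /= /GRing.scale /= mulr1 subrK => {}H.
rewrite -ler_pdivrMr ?normr_gt0 // -normf_div (le_trans _ H) //.
rewrite -[X in _ <= X]normrN le_eqVlt; apply/orP; left; apply/eqP; congr (`|_|).
by field.
Qed.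

(** Follows from the first-order expansions of the real exp, cos and sin at 0. Six error terms of
    size (e/16)|w| arise, well within e |w|. The functional equation carries the result to every
    point in [cdiff_exp]. *)
Lemma cdiff_exp0 : cdiff cexp 0 1.
Proof.
move=> e e0.
have e4 : 0 < e / 16 by rewrite divr_gt0.
have e1 : 0 < Num.min 1 (e / 16) by rewrite lt_min e4 ltr01.
have [d d0 H] : exists2 d : R, 0 < d & forall x, `|x| < d ->
  [/\ `|expR x - 1 - x| <= e / 16 * `|x|, `|cos x - 1| <= e / 16 * `|x|,
      `|sin x - x| <= e / 16 * `|x|, `|expR x - 1| <= e / 16 & expR x <= 2].
  suff : \forall x \near (0 : R), [/\ `|expR x - 1 - x| <= e / 16 * `|x|, `|cos x - 1| <= e / 16 * `|x|,
      `|sin x - x| <= e / 16 * `|x|, `|expR x - 1| <= e / 16 & expR x <= 2].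
    move=> /nbhs_ballP[d /= d0 H]; exists d => // x xd; apply: H.
    by rewrite /ball /= sub0r normrN.
  near=> x.
  have E : `|expR x - 1| <= Num.min 1 (e / 16).
    near: x; have := @continuous_expR R 0; rewrite /continuous_at expR0.
    move=> /cvgr_dist_le /(_ _ e1); apply: filterS => x.
    by rewrite distrC.
  split.
  - near: x; have /is_derive_near/(_ _ e4) := @is_derive_expR R 0.
    by apply: filterS => x; rewrite expR0 subr0 mul1r.
  - near: x; have /is_derive_near/(_ _ e4) := @is_derive_cos R 0.
    by apply: filterS => x; rewrite cos0 sin0 oppr0 !addr0 mul0r subr0.
  
  - near: x; have /is_derive_near/(_ _ e4) := @is_derive_sin R 0.
    by apply: filterS => x; rewrite cos0 sin0 mul1r !subr0.
  - by move: E; rewrite le_min => /andP[].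
  - move: E; rewrite le_min => /andP[E _].
    by have := ler_norm (expR x - 1); lra.
apply/nbhs_normcP; exists d => // w; rewrite !subr0 cexp0 mul1r.
have [xw yw] := (Re_le_normc w, Im_le_normc w).
move=> h; set x := Re w in xw; set y := Im w in yw.
have [|H1 _ _ H4 H5] := H x; first exact: le_lt_trans xw h.
have [|_ H2 H3 _ _] := H y; first exact: le_lt_trans yw h.
rewrite (le_trans (normc_le_ReIm _)) // !ReImE /=.
rewrite -/x -/y; set N := normc w in xw yw h *.
have N0 : 0 <= N by exact: normc_ge0.
have -> : expR x * cos y - 0 * sin y - 1 - x = (expR x - 1 - x) + expR x * (cos y - 1) by ring.
have -> : expR x * sin y + 0 * cos y - 0 - y = expR x * (sin y - y) + (expR x - 1) * y by ring.
have X0 := expR_ge0 x.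
have A1 : `|expR x - 1 - x + expR x * (cos y - 1)| <= e / 16 * N + 2 * (e / 16 * N).
  rewrite (le_trans (ler_normD _ _)) // lerD //.
    by rewrite (le_trans H1) // ler_wpM2l // ltW.
  rewrite normrM ger0_norm // ler_pM // (le_trans H2) // ler_wpM2l // ltW //.
have A2 : `|expR x * (sin y - y) + (expR x - 1) * y| <= 2 * (e / 16 * N) + e / 16 * N.
  rewrite (le_trans (ler_normD _ _)) // lerD //.
    by rewrite normrM ger0_norm // ler_pM // (le_trans H3) // ler_wpM2l // ltW.
  by rewrite normrM ler_pM.
have eN : 0 <= e * N by rewrite mulr_ge0 // ltW.
by rewrite (le_trans (lerD A1 A2)) //; lra.
Unshelve. all: end_near. Qed.

Lemma cdiff_exp z : cdiff cexp z (cexp z).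
Proof.
have H : cdiff (fun w => cexp z * cexp (w - z)) z (cexp z * (1 * (1 - 0))).
  apply: cdiffZ; apply: cdiff_comp; first exact: cdiffB (cdiff_id z) (cdiff_cst z z).
  by rewrite subrr; exact: cdiff_exp0.
have := H; rewrite subr0 !mulr1; apply: cdiff_ext.
by near=> w; rewrite -cexpD addrC subrK.
Unshelve. all: end_near. Qed.
End ComplexDerivative.

(** * Integrals of real and complex functions over segments *)

Section ComplexIntegral.
Context {R : realType}.
Local Notation C := (Cplx R).
Local Notation Re := (@complex.Re R).
Local Notation Im := (@complex.Im R).
Local Notation mu := (@lebesgue_measure R).
Implicit Types (a b c d x y t : R) (f g : R -> R) (F G : R -> C).

Definition ig a b f := mu.-integrable `[a, b] (EFin \o f).
Definition rint a b f : R := \int[mu]_(x in `[a, b]) f x.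

Lemma ig_cont a b f : {within `[a, b], continuous f} -> ig a b f.
Proof.
by move=> h; apply: continuous_compact_integrable => //; exact: segment_compact.
Qed.

Lemma igS a b a' b' f : a <= a' -> b' <= b -> ig a b f -> ig a' b' f.
Proof.
move=> aa bb; apply: integrableS => //.
by apply: subset_itvScc; rewrite bnd_simp.
Qed.

Lemma integral_rint a b f : ig a b f ->
  (\int[mu]_(x in `[a, b]) (f x)%:E)%E = (rint a b f)%:E.
Proof. by move=> hf; rewrite /rint /Rintegral fineK //; exact: (integrable_fin_num _ hf). Qed.

Lemma igD a b f g : ig a b f -> ig a b g -> ig a b (fun x => f x + g x).
Proof. by move=> hf hg; exact: (@integrableD _ _ _ mu _ _ _ _ hf hg). Qed.

Lemma igZ a b k f : ig a b f -> ig a b (fun x => k * f x).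
Proof. by move=> hf; exact: (@integrableZl _ _ _ mu _ _ k _ hf). Qed.

Lemma igN a b f : ig a b f -> ig a b (fun x => - f x).
Proof.
move=> /(igZ (-1)); rewrite /ig; congr (_.-integrable _ _).
by apply/funext => x /=; rewrite mulN1r.
Qed.

Lemma igB a b f g : ig a b f -> ig a b g -> ig a b (fun x => f x - g x).
Proof. by move=> hf /igN; exact: igD. Qed.

Lemma ig_abs a b f : ig a b f -> ig a b (fun x => `|f x|).
Proof. by move=> hf; exact: (@integrable_norm _ _ _ mu _ f hf). Qed.

Lemma ig_cst a b k : ig a b (fun=> k).
Proof. by apply: ig_cont; apply: continuous_subspaceT => x; exact: cvg_cst. Qed.

Lemma rintD a b f g : ig a b f -> ig a b g ->
  rint a b (fun x => f x + g x) = rint a b f + rint a b g.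
Proof. by move=> hf hg; exact: (@RintegralD _ _ _ mu). Qed.

Lemma rintZ a b k f : ig a b f -> rint a b (fun x => k * f x) = k * rint a b f.
Proof. by move=> hf; exact: (@RintegralZl _ _ _ mu). Qed.

Lemma rintN a b f : ig a b f -> rint a b (fun x => - f x) = - rint a b f.
Proof.
move=> hf; rewrite -mulN1r -rintZ //; congr (rint _ _ _).
by apply/funext => x; rewrite mulN1r.
Qed.

Lemma rintB a b f g : ig a b f -> ig a b g ->
  rint a b (fun x => f x - g x) = rint a b f - rint a b g.
Proof. by move=> hf hg; rewrite rintD ?rintN //; exact: igN. Qed.

Lemma rint_cst a b k : a <= b -> rint a b (fun=> k) = k * (b - a).
Proof.
move=> ab; rewrite /rint Rintegral_cst //; congr (_ * _).
apply: etrans; first exact: (congr1 fine (lebesgue_measure_itv `[a, b])).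
rewrite /= lte_fin; case: ltP => // ba.
by rewrite (@le_anti _ _ a b) ?ab // subrr.
Qed.

Lemma rint_le a b f g : ig a b f -> ig a b g ->
  (forall x, a <= x <= b -> f x <= g x) -> rint a b f <= rint a b g.
Proof.
move=> hf hg H; apply: (@le_Rintegral _ _ _ mu) => // x /=.
Qed.

Lemma rint_eq a b f g : (forall x, a <= x <= b -> f x = g x) -> rint a b f = rint a b g.
Proof.
move=> H; apply: eq_Rintegral => x; rewrite inE /= in_itv /=; exact: H.
Qed.

Lemma ig_eq a b f g : (forall x, a <= x <= b -> f x = g x) -> ig a b f -> ig a b g.
Proof.
move=> H; apply: eq_integrable => // x; rewrite inE /= in_itv /= => /H ->; done.
Qed.

Lemma rint_ge0 a b f : (forall x, a <= x <= b -> 0 <= f x) -> 0 <= rint a b f.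
Proof.
by move=> H; apply: Rintegral_ge0 => x /=; rewrite in_itv /=; exact: H.
Qed.

Lemma rint_abs_le a b f : ig a b f -> `|rint a b f| <= rint a b (fun x => `|f x|).
Proof. by move=> hf; exact: (@le_normr_Rintegral _ _ _ mu). Qed.

Lemma rint_split a c b f : a <= c -> c <= b -> ig a b f ->
  rint a b f = rint a c f + rint c b f.
Proof.
move=> ac cb hf.
have := @Rintegral_itvB R f (BLeft a) (BRight b) c hf.
rewrite !bnd_simp => /(_ ac cb) /eqP.
rewrite subr_eq addrC /rint => /eqP ->; congr (_ + _).
apply: Rintegral_itv_obnd_cbnd.
by apply: integrableS hf => //; apply: subset_itv; rewrite bnd_simp.
Qed.

(** The derivative is two-sided at the end points as well, which yields the continuity of [F] there;
    all primitives used below exist beyond the segment. *)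
Lemma rint_FTC a b f (F : R -> R) : a <= b -> {within `[a, b], continuous f} ->
  (forall x, a <= x <= b -> is_derive x 1 F (f x)) -> rint a b f = F b - F a.
Proof.
rewrite le_eqVlt => /predU1P[-> _ _|ab cf dF].
  by rewrite subrr /rint set_itv1 Rintegral_set1.
rewrite /rint /Rintegral (@continuous_FTC2 _ _ F) //.
- have cF x : a <= x <= b -> F t @[t --> x] --> F x.
    move=> /dF[dfx _]; apply: differentiable_continuous.
    exact/derivable1_diffP.
  split.
  + by move=> x; rewrite in_itv /= => /andP[/ltW ax /ltW xb]; case: (dF x); rewrite ?ax.
  + by apply: cvg_at_right_filter; apply: cF; rewrite lexx ltW.
  + by apply: cvg_at_left_filter; apply: cF; rewrite lexx ltW.
- move=> x; rewrite in_itv /= => /andP[/ltW ax /ltW xb].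
  by rewrite derive1E; case: (dF x); rewrite ?ax.
Qed.

Lemma rder_cst (k x : R) : is_derive x 1 (fun=> k) (0 : R).
Proof. exact: is_derive_cst. Qed.

Lemma rder_id (x : R) : is_derive x 1 (fun y : R => y) (1 : R).
Proof. exact: is_derive_id. Qed.

Lemma rderD (f g : R -> R) (x k l : R) : is_derive x 1 f k -> is_derive x 1 g l ->
  is_derive x 1 (fun y => f y + g y) (k + l).
Proof. by move=> hf hg; exact: is_deriveD. Qed.

Lemma rderM (f g : R -> R) (x k l : R) : is_derive x 1 f k -> is_derive x 1 g l ->
  is_derive x 1 (fun y => f y * g y) (k * g x + f x * l).
Proof.
move=> hf hg; apply: is_derive_eq (is_deriveM hf hg) _.
by rewrite /GRing.scale /= addrC (mulrC (g x)).
Qed.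

Lemma rderN (f : R -> R) (x k : R) : is_derive x 1 f k ->
  is_derive x 1 (fun y => - f y) (- k).
Proof. by move=> hf; exact: is_deriveN. Qed.

Lemma rderB (f g : R -> R) (x k l : R) : is_derive x 1 f k -> is_derive x 1 g l ->
  is_derive x 1 (fun y => f y - g y) (k - l).
Proof. by move=> hf /rderN; exact: rderD. Qed.

Lemma rder_comp (f g : R -> R) (x k l : R) : is_derive (g x) 1 f k -> is_derive x 1 g l ->
  is_derive x 1 (fun y => f (g y)) (k * l).
Proof. by move=> hf hg; exact: is_derive1_comp. Qed.

Definition cig a b F := ig a b (Re \o F) /\ ig a b (Im \o F).
Definition cint a b F : C := Complex (rint a b (Re \o F)) (rint a b (Im \o F)).

Lemma cigD a b F G : cig a b F -> cig a b G -> cig a b (fun x => F x + G x).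
Proof.
move=> [f1 f2] [g1 g2]; split.
  by apply: (ig_eq _ (igD f1 g1)) => x _ /=; rewrite cReD.
by apply: (ig_eq _ (igD f2 g2)) => x _ /=; rewrite cImD.
Qed.

Lemma cintD a b F G : cig a b F -> cig a b G ->
  cint a b (fun x => F x + G x) = cint a b F + cint a b G.
Proof.
move=> [f1 f2] [g1 g2]; apply: complex_eq; rewrite !ReImE /= -rintD //;
 by apply: rint_eq => x _ /=; rewrite ReImE.
Qed.

Lemma cigZ a b (k : C) F : cig a b F -> cig a b (fun x => k * F x).
Proof.
move=> [f1 f2]; split.
  by apply: (ig_eq _ (igB (igZ (Re k) f1) (igZ (Im k) f2))) => x _ /=; rewrite cReM.
by apply: (ig_eq _ (igD (igZ (Re k) f2) (igZ (Im k) f1))) => x _ /=; rewrite cImM.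
Qed.

Lemma cintZ a b (k : C) F : cig a b F -> cint a b (fun x => k * F x) = k * cint a b F.
Proof.
move=> [f1 f2]; apply: complex_eq; rewrite !ReImE /=.
  rewrite -!rintZ // -rintB; try exact: igZ.
  by apply: rint_eq => x _ /=; rewrite cReM.
rewrite -!rintZ // -rintD; try exact: igZ.
by apply: rint_eq => x _ /=; rewrite cImM.
Qed.

Lemma cigN a b F : cig a b F -> cig a b (fun x => - F x).
Proof.
by move=> [f1 f2]; split; [apply: (ig_eq _ (igN f1))|apply: (ig_eq _ (igN f2))] => x _ /=;
  rewrite ReImE.
Qed.

Lemma cigB a b F G : cig a b F -> cig a b G -> cig a b (fun x => F x - G x).
Proof. by move=> hF /cigN; exact: cigD. Qed.

Lemma cintN a b F : cig a b F -> cint a b (fun x => - F x) = - cint a b F.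
Proof.
move=> [f1 f2]; apply: complex_eq; rewrite !ReImE /= -rintN //;
 by apply: rint_eq => x _ /=; rewrite ReImE.
Qed.

Lemma cintB a b F G : cig a b F -> cig a b G ->
  cint a b (fun x => F x - G x) = cint a b F - cint a b G.
Proof. by move=> hF hG; rewrite cintD ?cintN //; exact: cigN. Qed.

Lemma cint_eq a b F G : (forall x, a <= x <= b -> F x = G x) -> cint a b F = cint a b G.
Proof. by move=> H; apply: complex_eq; apply: rint_eq => x /H /= ->. Qed.

Lemma cig_eq a b F G : (forall x, a <= x <= b -> F x = G x) -> cig a b F -> cig a b G.
Proof. by move=> H [h1 h2]; split; [apply: ig_eq h1|apply: ig_eq h2] => x /H /= ->. Qed.

Lemma cint_split a c b F : a <= c -> c <= b -> cig a b F ->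
  cint a b F = cint a c F + cint c b F.
Proof.
by move=> ac cb [f1 f2]; apply: complex_eq; rewrite !ReImE /=; exact: rint_split.
Qed.

(* Rotating the integral to the positive axis turns its modulus into the integral
   of a real part. *)
Lemma cint_norm_le a b F g : cig a b F -> ig a b g ->
  (forall x, a <= x <= b -> normc (F x) <= g x) -> normc (cint a b F) <= rint a b g.
Proof.
move=> cF hg H.
have [I0|I0] := eqVneq (cint a b F) 0.
  rewrite I0 normcr0; apply: rint_ge0 => x /H; exact: le_trans (normc_ge0 _).
pose u := rc (normc (cint a b F)) / cint a b F.
have nu : normc u = 1.
  by rewrite normc_div normc_rc ger0_norm ?normc_ge0 // divff // normc_eq0.
have -> : normc (cint a b F) = Re (cint a b (fun x => u * F x)).
  by rewrite cintZ // divfK.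
apply: rint_le => //; first by case: (cigZ u cF).
move=> x xab; rewrite /= (le_trans (ler_norm _)) // (le_trans (Re_le_normc _)) //.
by rewrite normc_mul nu mul1r; exact: H.
Qed.

Lemma cint_norm_bound a b F k : a <= b -> cig a b F ->
  (forall x, a <= x <= b -> normc (F x) <= k) -> normc (cint a b F) <= k * (b - a).
Proof.
move=> ab cF H; rewrite -rint_cst //; apply: cint_norm_le => //; exact: ig_cst.
Qed.

Definition rcont F x := forall eps : R, 0 < eps ->
  \forall y \near x, normc (F y - F x) <= eps.

Lemma rcont_Re F x : rcont F x -> Re (F y) @[y --> x] --> Re (F x).
Proof.
move=> H; apply/cvgrPdist_le => e e0; have := H e e0; apply: filterS => y.
by apply: le_trans; rewrite -cReN -cReD (le_trans (Re_le_normc _)) // normc_distC.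
Qed.

Lemma rcont_Im F x : rcont F x -> Im (F y) @[y --> x] --> Im (F x).
Proof.
move=> H; apply/cvgrPdist_le => e e0; have := H e e0; apply: filterS => y.
by apply: le_trans; rewrite -cImN -cImD (le_trans (Im_le_normc _)) // normc_distC.
Qed.

Lemma rcont_normc F x : rcont F x -> normc (F y) @[y --> x] --> normc (F x).
Proof.
move=> H; apply/cvgrPdist_le => e e0; have := H e e0; apply: filterS => y.
apply: le_trans; rewrite ler_norml lerBrDl (normc_distC (F y)).
have := normc_sub_ge (F x) (F y); have := normc_sub_ge (F y) (F x).
by rewrite normc_distC; lra.
Qed.

Lemma cts_within (f : R -> R) a b : (forall x, a <= x <= b -> f y @[y --> x] --> f x) ->
  {within `[a, b], continuous f}.
Proof.
move=> H; apply: continuous_in_subspaceT => x; rewrite inE /= in_itv /=; exact: H.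
Qed.

Lemma cig_cont a b F : (forall x, a <= x <= b -> rcont F x) -> cig a b F.
Proof.
move=> H; split; apply: ig_cont; apply: cts_within => x /H.
  exact: rcont_Re.
exact: rcont_Im.
Qed.

Lemma rcont_comp (H : C -> C) F x : rcont F x -> ccont H (F x) ->
  rcont (fun y => H (F y)) x.
Proof.
move=> hF hH e e0; have /nbhs_normcP[d d0 {}hH] := hH e e0.
have d2 : 0 < d / 2 by rewrite divr_gt0.
have := hF _ d2; apply: filterS => y hy; apply: hH.
by apply: (le_lt_trans hy); lra.
Qed.

Lemma rcont_pair F x : Re (F y) @[y --> x] --> Re (F x) ->
  Im (F y) @[y --> x] --> Im (F x) -> rcont F x.
Proof.
move=> /cvgrPdist_le h1 /cvgrPdist_le h2 e e0.
have e2 : 0 < e / 2 by rewrite divr_gt0.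
near=> y.
have H1 : `|Re (F x) - Re (F y)| <= e / 2 by near: y; exact: h1.
have H2 : `|Im (F x) - Im (F y)| <= e / 2 by near: y; exact: h2.
rewrite normc_distC (le_trans (normc_le_ReIm _)) // !ReImE; lra.
Unshelve. all: end_near. Qed.

Lemma rcont_cis x : rcont cis x.
Proof. by apply: rcont_pair => /=; [exact: continuous_cos|exact: continuous_sin]. Qed.

Lemma rcont_rc x : rcont rc x.
Proof. by apply: rcont_pair => /=; [exact: cvg_id|exact: cvg_cst]. Qed.

Lemma rcont_cst (k : C) x : rcont (fun=> k) x.
Proof. by apply: rcont_pair; exact: cvg_cst. Qed.

Lemma rcontD F G x : rcont F x -> rcont G x -> rcont (fun y => F y + G y) x.
Proof.
move=> hF hG; apply: rcont_pair.
  under eq_fun do rewrite cReD; rewrite cReD.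
  by apply: cvgD; exact: rcont_Re.
under eq_fun do rewrite cImD; rewrite cImD.
by apply: cvgD; exact: rcont_Im.
Qed.

Lemma rcontM F G x : rcont F x -> rcont G x -> rcont (fun y => F y * G y) x.
Proof.
move=> hF hG; have [f1 f2] := (rcont_Re hF, rcont_Im hF).
have [g1 g2] := (rcont_Re hG, rcont_Im hG).
apply: rcont_pair.
  under eq_fun do rewrite cReM; rewrite cReM.
  by apply: cvgB; apply: cvgM.
under eq_fun do rewrite cImM; rewrite cImM.
by apply: cvgD; apply: cvgM.
Qed.

Lemma rcontN F x : rcont F x -> rcont (fun y => - F y) x.
Proof.
move=> hF; apply: rcont_pair.
  under eq_fun do rewrite cReN; rewrite cReN.
  by apply: cvgN; exact: rcont_Re.
under eq_fun do rewrite cImN; rewrite cImN.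
by apply: cvgN; exact: rcont_Im.
Qed.

Lemma rcontB F G x : rcont F x -> rcont G x -> rcont (fun y => F y - G y) x.
Proof. by move=> hF /rcontN; exact: rcontD. Qed.

(** Serves Goursat's theorem, where affine functions must have zero rectangle integral, and the
    integration of constants in the mean value property. *)
Lemma cint_affine a b (p q : C) : a <= b ->
  cint a b (fun x => p + q * rc x) = p * rc (b - a) + q * rc ((b ^+ 2 - a ^+ 2) / 2).
Proof.
move=> ab.
have I1 (k l : R) : rint a b (fun x => k + l * x) = k * (b - a) + l * ((b ^+ 2 - a ^+ 2) / 2).
  have dF x : a <= x <= b -> is_derive x 1 (fun x : R => k * x + l * (x * x / 2)) (k + l * x).
    move=> _; have d2 := rderM (rderM (rder_id x) (rder_id x)) (rder_cst (2^-1) x).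
    apply: is_derive_eq (rderD (rderM (rder_cst k x) (rder_id x)) (rderM (rder_cst l x) d2)) _.
    by field.
  have cF : {within `[a, b], continuous (fun x => k + l * x)}.
    apply: cts_within => x _; apply: cvgD; first exact: cvg_cst.
    by apply: cvgM; [exact: cvg_cst|exact: cvg_id].
  by rewrite (rint_FTC ab cF dF); field.
apply: complex_eq; rewrite !ReImE /= !(mulr0, subr0, add0r).
  by rewrite -I1; apply: rint_eq => x _ /=; rewrite !ReImE /= mulr0 subr0.
by rewrite -I1; apply: rint_eq => x _ /=; rewrite !ReImE /= mulr0 add0r.
Qed.

End ComplexIntegral.

(** * Goursat's theorem and the mean value property *)

Section Goursat.
Context {R : realType}.
Local Notation C := (Cplx R).
Local Notation Re := (@complex.Re R).
Local Notation Im := (@complex.Im R).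
Implicit Types (a b c d x y : R) (F : C -> C) (z w : C).

Definition in_rect a b c d z := [/\ a <= Re z, Re z <= b, c <= Im z & Im z <= d].

(** The counterclockwise contour integral of F dz; the factor i is dz = i dy on the vertical
    sides. *)
Definition rect_int F a b c d : C :=
  (cint a b (fun x => F (Complex x c)) - cint a b (fun x => F (Complex x d)))
  + Complex 0 1 *
  (cint c d (fun y => F (Complex b y)) - cint c d (fun y => F (Complex a y))).

Lemma rcont_horizontal c x : rcont (fun x => Complex x c : C) x.
Proof. by apply: rcont_pair => /=; [exact: cvg_id|exact: cvg_cst]. Qed.

Lemma rcont_vertical a y : rcont (fun y => Complex a y : C) y.
Proof. by apply: rcont_pair => /=; [exact: cvg_cst|exact: cvg_id]. Qed.

Lemma cig_horizontal F a b c d y :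
  (forall z, in_rect a b c d z -> ccont F z) -> c <= y <= d ->
  cig a b (fun x => F (Complex x y)).
Proof.
move=> H /andP[cy yd]; apply: cig_cont => x /andP[ax xb].
apply: (rcont_comp (F := fun x => Complex x y)); first exact: rcont_horizontal.
exact: H.
Qed.

Lemma cig_vertical F a b c d x :
  (forall z, in_rect a b c d z -> ccont F z) -> a <= x <= b ->
  cig c d (fun y => F (Complex x y)).
Proof.
move=> H /andP[ax xb]; apply: cig_cont => y /andP[cy yd].
apply: (rcont_comp (F := fun y => Complex x y)); first exact: rcont_vertical.
exact: H.
Qed.

Lemma ccontB F H z : ccont F z -> ccont H z -> ccont (fun w => F w - H w) z.
Proof. by move=> /ccontP hf /ccontP hg; apply/ccontP; exact: (cvgB hf hg). Qed.

Lemma rect_int_splitx F a m b c d : a <= m -> m <= b -> c <= d ->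
  (forall z, in_rect a b c d z -> ccont F z) ->
  rect_int F a b c d = rect_int F a m c d + rect_int F m b c d.
Proof.
move=> am mb cd H; rewrite /rect_int.
rewrite (cint_split (F := fun x => F (Complex x c)) am mb); last first.
  by apply: (cig_horizontal H); rewrite lexx.
rewrite (cint_split (F := fun x => F (Complex x d)) am mb); last first.
  by apply: (cig_horizontal H); rewrite lexx cd.
ring.
Qed.

Lemma rect_int_splity F a b c m d : a <= b -> c <= m -> m <= d ->
  (forall z, in_rect a b c d z -> ccont F z) ->
  rect_int F a b c d = rect_int F a b c m + rect_int F a b m d.
Proof.
move=> ab cm md H; rewrite /rect_int.
rewrite (cint_split (F := fun y => F (Complex a y)) cm md); last first.
  by apply: (cig_vertical H); rewrite lexx.
rewrite (cint_split (F := fun y => F (Complex b y)) cm md); last first.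
  by apply: (cig_vertical H); rewrite lexx ab.
ring.
Qed.

Lemma rect_int_affine a b c d (p q : C) : a <= b -> c <= d ->
  rect_int (fun z => p + q * z) a b c d = 0.
Proof.
move=> ab cd; rewrite /rect_int.
have E1 y : cint a b (fun x => p + q * Complex x y) =
    (p + q * Complex 0 y) * rc (b - a) + q * rc ((b ^+ 2 - a ^+ 2) / 2).
  rewrite -cint_affine //; apply: cint_eq => x _.
  by rewrite -addrA -mulrDr; congr (p + q * _); apply: complex_eq; rewrite !ReImE /= ?addr0 ?add0r.
have E2 x : cint c d (fun y => p + q * Complex x y) =
    (p + q * rc x) * rc (d - c) + (q * Complex 0 1) * rc ((d ^+ 2 - c ^+ 2) / 2).
  rewrite -cint_affine //; apply: cint_eq => y _.
  rewrite -addrA -mulrA -mulrDr; congr (p + q * _); apply: complex_eq;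
  by rewrite !ReImE /= ?(mulr0, mul0r, mul1r, subr0, addr0, add0r).
rewrite !E1 !E2.
case: p q {E1 E2} => p1 p2 [q1 q2].
by apply: complex_eq; rewrite !ReImE /=; field.
Qed.

Lemma rect_int_bound F a b c d k : a <= b -> c <= d ->
  (forall z, in_rect a b c d z -> ccont F z) ->
  (forall z, in_rect a b c d z -> normc (F z) <= k) ->
  normc (rect_int F a b c d) <= 2 * k * ((b - a) + (d - c)).
Proof.
move=> ab cd H B.
have B1 y : c <= y <= d -> normc (cint a b (fun x => F (Complex x y))) <= k * (b - a).
  move=> yP; apply: cint_norm_bound => //; first exact: (cig_horizontal H).
  by move=> x /andP[? ?]; apply: B; case/andP: yP.
have B2 x : a <= x <= b -> normc (cint c d (fun y => F (Complex x y))) <= k * (d - c).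
  move=> xP; apply: cint_norm_bound => //; first exact: (cig_vertical H).
  by move=> y /andP[? ?]; apply: B; case/andP: xP.
have := B1 c; rewrite lexx cd => /(_ isT) h1.
have := B1 d; rewrite lexx cd => /(_ isT) h2.
have := B2 a; rewrite lexx ab => /(_ isT) h3.
have := B2 b; rewrite lexx ab => /(_ isT) h4.
rewrite /rect_int (le_trans (normc_add _ _)) // normc_mul.
have -> : normc (Complex 0 1 : C) = 1 by rewrite normcE /= expr0n /= add0r expr1n sqrtr1.
rewrite mul1r.
have g1 := normc_sub (cint a b (fun x => F (Complex x c))) (cint a b (fun x => F (Complex x d))).
have g2 := normc_sub (cint c d (fun x => F (Complex b x))) (cint c d (fun x => F (Complex a x))).
by rewrite (le_trans (lerD g1 g2)) //; lra.
Qed.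

Lemma rect_int_sub_affine F a b c d (p q : C) : a <= b -> c <= d ->
  (forall z, in_rect a b c d z -> ccont F z) ->
  rect_int (fun z => F z - (p + q * z)) a b c d = rect_int F a b c d.
Proof.
move=> ab cd H.
have caff z : ccont (fun z => p + q * z) z.
  by apply: cdiff_cont; apply: cdiffD; [exact: cdiff_cst|exact: cdiffZ (cdiff_id z)].
rewrite -[RHS]subr0 -(rect_int_affine p q ab cd) /rect_int.
have cc : c <= c <= d by rewrite lexx.
have dd : c <= d <= d by rewrite lexx cd.
have aa : a <= a <= b by rewrite lexx.
have bb : a <= b <= b by rewrite lexx ab.
have K z : in_rect a b c d z -> ccont (fun z => p + q * z) z by move=> _; exact: caff.
rewrite !(@cintB R _ _ (fun x => F _) (fun x => p + q * _)); last first.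
all: try solve [exact: (cig_horizontal H)|exact: (cig_vertical H)|exact: (cig_horizontal K)|exact: (cig_vertical K)].
ring.
Qed.

Lemma quarter_rect F a b c d : a <= b -> c <= d ->
  (forall z, in_rect a b c d z -> ccont F z) ->
  exists Q : (R * R) * (R * R), [/\
    [/\ a <= Q.1.1, Q.1.1 <= Q.1.2 & Q.1.2 <= b],
    [/\ c <= Q.2.1, Q.2.1 <= Q.2.2 & Q.2.2 <= d],
    Q.1.2 - Q.1.1 = (b - a) / 2, Q.2.2 - Q.2.1 = (d - c) / 2 &
    normc (rect_int F a b c d) <= 4 * normc (rect_int F Q.1.1 Q.1.2 Q.2.1 Q.2.2)].
Proof.
move=> ab cd H; pose m := (a + b) / 2; pose n := (c + d) / 2.
have [am mb] : a <= m /\ m <= b by rewrite /m; split; lra.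
have [cn nd] : c <= n /\ n <= d by rewrite /n; split; lra.
have [ma bm] : m - a = (b - a) / 2 /\ b - m = (b - a) / 2 by rewrite /m; split; field.
have [nc dn] : n - c = (d - c) / 2 /\ d - n = (d - c) / 2 by rewrite /n; split; field.
have H1 z : in_rect a m c d z -> ccont F z by move=> [*]; apply: H; split; lra.
have H2 z : in_rect m b c d z -> ccont F z by move=> [*]; apply: H; split; lra.
have E : rect_int F a b c d = (rect_int F a m c n + rect_int F a m n d) +
    (rect_int F m b c n + rect_int F m b n d).
  by rewrite (rect_int_splitx am mb cd H) (rect_int_splity am cn nd H1)
    (rect_int_splity mb cn nd H2).
have T : normc (rect_int F a b c d) <= normc (rect_int F a m c n) + normc (rect_int F a m n d) +
    (normc (rect_int F m b c n) + normc (rect_int F m b n d)).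
  by rewrite E (le_trans (normc_add _ _)) // lerD // normc_add.
have [h1|h1] := leP (normc (rect_int F a b c d)) (4 * normc (rect_int F a m c n)).
  by exists ((a, m), (c, n)).
have [h2|h2] := leP (normc (rect_int F a b c d)) (4 * normc (rect_int F a m n d)).
  by exists ((a, m), (n, d)).
have [h3|h3] := leP (normc (rect_int F a b c d)) (4 * normc (rect_int F m b c n)).
  by exists ((m, b), (c, n)).
(* If the first three quarters each carry less than a fourth of the total, the triangle inequality
   leaves the rest to the last one. *)
exists ((m, b), (n, d)); split; [by split|by split|by []|by []|].
change (normc (rect_int F a b c d) <= 4 * normc (rect_int F m b n d)).
clear -T h1 h2 h3; move: T h1 h2 h3.
by do 5?[move: (normc (rect_int F _ _ _ _)) => ?]; lra.
Qed.

Lemma nested_intervals (u v : nat -> R) : (forall n, u n <= u n.+1) ->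
  (forall n, v n.+1 <= v n) -> (forall n, u n <= v n) ->
  exists p, forall n, u n <= p <= v n.
Proof.
move=> hu hv huv.
have mu n m : (n <= m)%N -> u n <= u m.
  by move=> /subnK <-; elim: (m - n)%N => // k IH; rewrite addSn (le_trans IH).
have mv n m : (n <= m)%N -> v m <= v n.
  by move=> /subnK <-; elim: (m - n)%N => // k IH; rewrite addSn (le_trans _ IH).
have uv n m : u n <= v m.
  rewrite (le_trans (mu _ _ (leq_maxl n m))) // (le_trans (huv _)) //.
  by apply: mv; exact: leq_maxr.
exists (sup (range u)) => n; apply/andP; split.
  apply: ub_le_sup; last by exists n.
  by exists (v 0) => _ [m _ <-].
by apply: ge_sup; [exists (u 0), 0%N|move=> _ [m _ <-]].
Qed.

(** Repeated bisection keeps, at step n, at least 4^-n of the integral on a rectangle of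
    half-perimeter l / 2^n. Near the common point [z0], subtracting the affine part of [F] leaves
    the integral unchanged and an integrand that is o(|z - z0|), so the kept integral is also
    o(4^-n). *)
Lemma goursat F a b c d : a <= b -> c <= d ->
  (forall z, in_rect a b c d z -> exists L, cdiff F z L) -> rect_int F a b c d = 0.
Proof.
move=> ab cd dF.
have cF z : in_rect a b c d z -> ccont F z by move=> /dF[L]; exact: cdiff_cont.
pose T := ((R * R) * (R * R))%type.
pose good (Q : T) := [/\ a <= Q.1.1, Q.1.1 <= Q.1.2, Q.1.2 <= b & 
   [/\ c <= Q.2.1, Q.2.1 <= Q.2.2 & Q.2.2 <= d]].
pose next (Q Q' : T) := [/\
    [/\ Q.1.1 <= Q'.1.1, Q'.1.1 <= Q'.1.2 & Q'.1.2 <= Q.1.2],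
    [/\ Q.2.1 <= Q'.2.1, Q'.2.1 <= Q'.2.2 & Q'.2.2 <= Q.2.2],
    Q'.1.2 - Q'.1.1 = (Q.1.2 - Q.1.1) / 2, Q'.2.2 - Q'.2.1 = (Q.2.2 - Q.2.1) / 2 &
    normc (rect_int F Q.1.1 Q.1.2 Q.2.1 Q.2.2) <=
      4 * normc (rect_int F Q'.1.1 Q'.1.2 Q'.2.1 Q'.2.2)].
have [s sP] : exists s : T -> T, forall Q, good Q -> next Q (s Q).
  (* The choice function must be total; rectangles outside the original one may be sent anywhere. *)
  suff /choice[s sP] : forall Q, exists Q', good Q -> next Q Q' by exists s.
  move=> Q.
  have [g|ng] := pselect (good Q); last by exists Q.
  case: (g) => g1 g2 g3 [g4 g5 g6].
  have [|Q' Q'P] := @quarter_rect F Q.1.1 Q.1.2 Q.2.1 Q.2.2 g2 g5; last by exists Q'.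
  by move=> z [*]; apply: cF; split; lra.
pose Q n : T := iter n s ((a, b), (c, d)).
have gQ n : good (Q n).
  elim: n => [|n IH]; first by split => //=; split => //=; lra.
  have [[h1 h2 h3] [h4 h5 h6] _ _ _] := sP _ IH; case: IH => i1 i2 i3 [i4 i5 i6].
  by split => //=; [lra|lra|split; lra].
have nQ n : next (Q n) (Q n.+1) by apply: sP.
have [p pP] : exists p, forall n, (Q n).1.1 <= p <= (Q n).1.2.
  by apply: nested_intervals => n; have [[? ? ?] _ _ _ _] := nQ n; [| |have [] := gQ n].
have [q qP] : exists q, forall n, (Q n).2.1 <= q <= (Q n).2.2.
  by apply: nested_intervals => n; have [_ [? ? ?] _ _ _] := nQ n; [| |have [_ _ _ []] := gQ n].
pose l := (b - a) + (d - c).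
have l0 : 0 <= l by rewrite /l; lra.
have lQ n : ((Q n).1.2 - (Q n).1.1) + ((Q n).2.2 - (Q n).2.1) = l / 2 ^+ n.
  elim: n => [|n IH]; first by rewrite expr0 divr1.
  have [_ _ -> -> _] := nQ n.
  by rewrite -mulrDl IH exprSr invfM mulrA.
have WQ n : normc (rect_int F a b c d) <=
    4 ^+ n * normc (rect_int F (Q n).1.1 (Q n).1.2 (Q n).2.1 (Q n).2.2).
  elim: n => [|n IH]; first by rewrite expr0 mul1r.
  have [_ _ _ _ h] := nQ n; rewrite (le_trans IH) // exprSr -mulrA ler_wpM2l //.
have [L /= dL] : exists L, cdiff F (Complex p q) L.
  by apply: dF; have /andP[? ?] := pP 0; have /andP[? ?] := qP 0; split.
suff W0 : normc (rect_int F a b c d) <= 0.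
  by apply/eqP; rewrite -normc_eq0 eq_le W0 normc_ge0.
apply/ler_addgt0Pr => e e0; rewrite add0r.
have K0 : 0 < 2 * (l + 1) * (l + 1) by rewrite !mulr_gt0 //; lra.
have e1 : 0 < e / (2 * (l + 1) * (l + 1)) by rewrite divr_gt0.
have /nbhs_normcP[del d0 {}dL] := dL _ e1.
set e' := e / _ in e1 dL.
have [n nd] : exists n, l / 2 ^+ n < del.
  have [m hm] : exists m : nat, l / del < m%:R.
    by exists (Num.truncn (l / del)).+1; rewrite truncnS_gt.
  exists m; rewrite ltr_pdivrMr ?exprn_gt0 // -ltr_pdivrMl // mulrC (lt_le_trans hm) //.
  by rewrite -natrX ler_nat ltnW // ltn_expl.
have [g1 g2 g3 [g4 g5 g6]] := gQ n.
have hcF z : in_rect (Q n).1.1 (Q n).1.2 (Q n).2.1 (Q n).2.2 z -> ccont F z.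
  by move=> [*]; apply: cF; split; lra.
set z0 : C := Complex p q in dL.
rewrite (le_trans (WQ n)) //.
rewrite -(rect_int_sub_affine (F z0 - L * z0) L g2 g5 hcF).
have small z : in_rect (Q n).1.1 (Q n).1.2 (Q n).2.1 (Q n).2.2 z -> normc (z - z0) <= l / 2 ^+ n.
  move=> [z1 z2 z3 z4]; rewrite (le_trans (normc_le_ReIm _)) // !ReImE /= -lQ lerD //.
    by have /andP[? ?] := pP n; rewrite ler_norml; apply/andP; split; lra.
  by have /andP[? ?] := qP n; rewrite ler_norml; apply/andP; split; lra.
have B : normc (rect_int (fun z => F z - (F z0 - L * z0 + L * z))
    (Q n).1.1 (Q n).1.2 (Q n).2.1 (Q n).2.2) <= 2 * (e' * (l / 2 ^+ n)) * (l / 2 ^+ n).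
  rewrite -[X in _ <= _ * X](lQ n); apply: rect_int_bound => //.
  - move=> z /hcF cz; apply: ccontB => //.
    apply: cdiff_cont; apply: cdiffD; first exact: cdiff_cst.
    exact: (cdiffZ L (cdiff_id z)).
  - move=> z zR; have -> : F z - (F z0 - L * z0 + L * z) = F z - F z0 - L * (z - z0) by ring.
    rewrite (le_trans (dL _ _)) //; first by rewrite (le_lt_trans (small _ zR)).
    by apply: ler_wpM2l; [exact: ltW|exact: small].
rewrite (le_trans (ler_wpM2l _ B)) ?exprn_ge0 //.
have -> : 4 ^+ n * (2 * (e' * (l / 2 ^+ n)) * (l / 2 ^+ n)) = e' * (2 * l * l).
  have -> : (4 : R) = 2 * 2 by rewrite -natrM.
  by rewrite exprMn; field; rewrite expf_neq0.
rewrite /e' mulrAC ler_pdivrMr //; apply: ler_wpM2l; first exact: ltW.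
rewrite -!mulrA ler_pM2l // ler_pM //; lra.
Qed.

End Goursat.

(** * The mean value property and Cauchy's estimate *)

Section MeanValue.
Context {R : realType}.
Local Notation C := (Cplx R).
Local Notation Re := (@complex.Re R).
Local Notation Im := (@complex.Im R).
Local Notation pi2 := (2 * pi : R).
Implicit Types (f : C -> C) (z w c : C) (r t : R).

Lemma pi2_gt0 : 0 < pi2. Proof. by rewrite mulr_gt0 // pi_gt0. Qed.

Lemma rcont_polar r t : rcont (polar r) t.
Proof.
have := rcontM (rcont_cst (rc r) t) (rcont_cis t).
by congr (rcont _ _); apply/funext => x; rewrite polarE.
Qed.

Lemma rcont_circle f c r t : ccont f (c + polar r t) -> rcont (fun t => f (c + polar r t)) t.
Proof.
move=> h; apply: (rcont_comp (F := fun t => c + polar r t)) => //.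
by apply: rcontD; [exact: rcont_cst|exact: rcont_polar].
Qed.

Lemma cig_circle f c r a b : (forall t, ccont f (c + polar r t)) ->
  cig a b (fun t => f (c + polar r t)).
Proof. by move=> h; apply: cig_cont => t _; exact: rcont_circle. Qed.

(** The map w -> c + e^w carries the rectangle [ln r', ln r] x [0, 2 pi] onto the annulus between
    the two circles, so Goursat's theorem for rectangles is enough: the vertical sides become the
    circles. *)
Lemma circle_int_const f c (rho r r' : R) :
  (forall z, 0 < normc (z - c) < rho -> exists L, cdiff f z L) ->
  0 < r' -> r' <= r -> r < rho ->
  cint 0 pi2 (fun t => f (c + polar r t)) = cint 0 pi2 (fun t => f (c + polar r' t)).
Proof.
move=> df r'0 r'r rrho; have r0 : 0 < r by lra.
pose F w := f (c + cexp w).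
have lnr : ln r' <= ln r by rewrite ler_ln // posrE.
have FE x t : F (Complex x t) = f (c + polar (expR x) t) by rewrite /F polarE.
have G : rect_int F (ln r') (ln r) 0 pi2 = 0.
  apply: goursat => //; first exact: ltW pi2_gt0.
  move=> z [z1 z2 _ _].
  have [|L dL] := df (c + cexp z).
    rewrite addrC addKr normc_cexp expR_gt0 /= (le_lt_trans _ rrho) //.
    by rewrite -[r]lnK ?posrE // ler_expR.
  exists (L * (0 + cexp z)); apply: (@cdiff_comp _ (fun w => c + cexp w)) => //.
  by apply: cdiffD; [exact: cdiff_cst|exact: cdiff_exp].
move: G; rewrite /rect_int.
(* The two horizontal sides have the same image and cancel. *)
have -> : cint (ln r') (ln r) (fun x => F (Complex x pi2)) =
          cint (ln r') (ln r) (fun x => F (Complex x 0)).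
  by apply: cint_eq => x _; rewrite !FE !polarE -[pi2]add0r cisD2pi.
rewrite subrr add0r => /eqP; rewrite mulf_eq0 => /orP[/eqP/(congr1 Im)/eqP|].
  by rewrite /= oner_eq0.
rewrite subr_eq0 => /eqP E.
transitivity (cint 0 pi2 (fun y => F (Complex (ln r) y))).
  by apply: cint_eq => t _; rewrite FE lnK.
by rewrite E; apply: cint_eq => t _; rewrite FE lnK.
Qed.

(** The circle is shrunk to [c], so continuity suffices at [c] itself. This lets the property apply
    to difference quotients continued at their removable singularity. *)
Lemma mean_value f c (rho r : R) :
  (forall z, 0 < normc (z - c) < rho -> exists L, cdiff f z L) -> ccont f c ->
  0 < r < rho -> cint 0 pi2 (fun t => f (c + polar r t)) = rc pi2 * f c.
Proof.
move=> df cf /andP[r0 rrho]; apply/eqP; rewrite -subr_eq0 -normc_eq0.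
rewrite eq_le normc_ge0 andbT; apply/ler_addgt0Pr => e e0; rewrite add0r.
have e1 : 0 < e / pi2 by rewrite divr_gt0 // pi2_gt0.
have /nbhs_normcP[d d0 dP] := cf _ e1.
pose r' := Num.min r (d / 2).
have r'0 : 0 < r' by rewrite lt_min r0 divr_gt0.
have r'r : r' <= r by rewrite ge_min lexx.
have r'd : r' < d by rewrite gt_min; apply/orP; right; lra.
rewrite (circle_int_const df r'0 r'r rrho).
have cc : cig 0 pi2 (fun=> f c) by apply: cig_cont => t _; exact: rcont_cst.
have cp t : ccont f (c + polar r' t).
  have [|L] := df (c + polar r' t); last exact: cdiff_cont.
  by rewrite addrC addKr normc_polar ?ltW // r'0 (le_lt_trans r'r).
have -> : rc pi2 * f c = cint 0 pi2 (fun=> f c).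
  have := cint_affine (f c) 0 (ltW pi2_gt0).
  rewrite mul0r addr0 subr0 (mulrC (f c)) => <-; apply: cint_eq => t _.
  by rewrite mul0r addr0.
rewrite -cintB //; last exact: cig_circle.
have -> : e = e / pi2 * (pi2 - 0) by rewrite subr0 divfK // gt_eqF // pi2_gt0.
apply: cint_norm_bound; first exact: ltW pi2_gt0.
  by apply: cigB => //; exact: cig_circle.
move=> t _; apply: dP.
by rewrite addrC addKr normc_polar // ltW.
Qed.

Lemma mean_value_bound f c (rho r k : R) :
  (forall z, 0 < normc (z - c) < rho -> exists L, cdiff f z L) -> ccont f c ->
  0 < r < rho -> (forall z, normc (z - c) = r -> normc (f z) <= k) ->
  normc (f c) <= k.
Proof.
move=> df cf rr H; have /andP[r0 rrho] := rr.
have cp t : ccont f (c + polar r t).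
  have [|L] := df (c + polar r t); last exact: cdiff_cont.
  by rewrite addrC addKr normc_polar ?ltW // r0.
have := @cint_norm_bound R 0 pi2 (fun t => f (c + polar r t)) k (ltW pi2_gt0).
rewrite (mean_value df cf rr) normc_mul normc_rc subr0 ger0_norm; last exact: ltW pi2_gt0.
rewrite (mulrC k) ler_pM2l ?pi2_gt0 //; apply; first exact: cig_circle.
by move=> t _; apply: H; rewrite addrC addKr normc_polar // ltW.
Qed.

(* Mean value property of the difference quotient [(f w - f z) / (w - z)],
   continued by [L] at [z]. *)
Lemma cauchy_estimate f z L (rho r k : R) :
  (forall w, normc (w - z) < rho -> exists L', cdiff f w L') -> cdiff f z L ->
  0 < r < rho -> (forall w, normc (w - z) = r -> normc (f w - f z) <= k) ->
  normc L <= k / r.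
Proof.
move=> df dL rr H; have /andP[r0 rrho] := rr.
pose q w : C := if w == z then L else (f w - f z) / (w - z).
have qz : q z = L by rewrite /q eqxx.
rewrite -qz; apply: (@mean_value_bound q z rho r) => //.
- move=> w /andP[w0 wrho]; have [L' dL'] := df _ wrho.
  have wz : w - z != 0 by rewrite -normc_gt0.
  have D := cdiffM (cdiffB dL' (cdiff_cst (f z) w))
    (cdiff_comp (cdiffB (cdiff_id w) (cdiff_cst z w)) (cdiff_inv wz)).
  eexists; apply: cdiff_ext D; near=> v.
  rewrite /q; case: eqP => // vz; exfalso.
  have : normc (v - w) < normc (w - z) by near: v; exact: near_normc.
  by rewrite vz normc_distC ltxx.
- move=> e e0; rewrite qz; have := dL e e0; apply: filterS => w h.
  rewrite /q; case: eqP => [_|/eqP wz]; first by rewrite subrr normcr0 ltW.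
  have -> : (f w - f z) / (w - z) - L = (f w - f z - L * (w - z)) / (w - z).
    by field; rewrite subr_eq0.
  by rewrite normc_div ler_pdivrMr // normc_gt0 subr_eq0.
- move=> w wr; rewrite /q; case: eqP => [wz|_].
    by move: wr r0; rewrite wz subrr normcr0 => <-; rewrite ltxx.
  by rewrite normc_div wr ler_pM2r ?invr_gt0 // H.
Unshelve. all: end_near. Qed.

Definition cconj z : C := Complex (Re z) (- Im z).

Lemma cconjM z w : cconj (z * w) = cconj z * cconj w.
Proof. by apply: complex_eq; rewrite /cconj !ReImE /=; ring. Qed.

Lemma cconjD z w : cconj (z + w) = cconj z + cconj w.
Proof. by apply: complex_eq; rewrite /cconj !ReImE /= ?opprD. Qed.

Lemma cconjN z : cconj (- z) = - cconj z.
Proof. by apply: complex_eq; rewrite /cconj !ReImE. Qed.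

Lemma cconjK z : cconj (cconj z) = z.
Proof. by apply: complex_eq; rewrite /cconj /= ?opprK. Qed.

Lemma normc_conj z : normc (cconj z) = normc z.
Proof. by rewrite !normcE /= sqrrN. Qed.

Lemma cconj_eq0 z : (cconj z == 0) = (z == 0).
Proof. by rewrite -!normc_eq0 normc_conj. Qed.

Lemma cconjV z : cconj (z^-1) = (cconj z)^-1.
Proof.
have [->|z0] := eqVneq z 0.
  rewrite invr0; have -> : cconj 0 = 0 by apply/eqP; rewrite cconj_eq0.
  by rewrite invr0.
have cz : cconj z != 0 by rewrite cconj_eq0.
apply: (mulfI cz); rewrite -cconjM !divff //.
by apply: complex_eq; rewrite /= ?oppr0.
Qed.

Lemma cconj_cis t : cconj (cis t) = (cis t)^-1.
Proof. by rewrite -cisN; apply: complex_eq; rewrite /= ?cosN ?sinN. Qed.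

Lemma cint_conj a b (F : R -> C) : cig a b F ->
  cint a b (fun t => cconj (F t)) = cconj (cint a b F).
Proof.
move=> [h1 h2]; apply: complex_eq; first by apply: rint_eq.
by rewrite /= -rintN //; apply: rint_eq.
Qed.

End MeanValue.

(** * Poisson and Herglotz integrals *)

Section Herglotz.
Context {R : realType}.
Local Notation C := (Cplx R).
Local Notation Re := (@complex.Re R).
Local Notation Im := (@complex.Im R).
Local Notation pi2 := (2 * pi : R).
Implicit Types (z w : C) (t k : R) (phi : R -> R).

Lemma igM (a b : R) (h g : R -> R) k : (forall x, a <= x <= b -> h y @[y --> x] --> h x) ->
  (forall x, a <= x <= b -> `|h x| <= k) -> ig a b g -> ig a b (fun x => h x * g x).
Proof.
move=> ch bh hg; apply: (integrableMr _ _ _ hg) => //.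
  apply: measurable_realfun.subspace_continuous_measurable_fun => //.
  exact: cts_within.
exists k; split; first exact: num_real.
by move=> M kM x /=; rewrite in_itv /= => /bh/le_trans -> //; exact: ltW.
Qed.

Lemma cigM (a b : R) (F : R -> C) g k : (forall x, a <= x <= b -> rcont F x) ->
  (forall x, a <= x <= b -> normc (F x) <= k) -> ig a b g ->
  cig a b (fun x => F x * rc (g x)).
Proof.
move=> cF bF hg; split.
- have H : ig a b (fun x => Re (F x) * g x).
    apply: (igM (k := k)) => // x /[dup] /cF/rcont_Re // _ /bF.
    exact: le_trans (Re_le_normc _).
  by apply: (ig_eq _ H) => x _ /=; rewrite cReM /= mulr0 subr0.
- have H : ig a b (fun x => Im (F x) * g x).
    apply: (igM (k := k)) => // x /[dup] /cF/rcont_Im // _ /bF.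
    exact: le_trans (Im_le_normc _).
  by apply: (ig_eq _ H) => x _ /=; rewrite cImM /= mulr0 add0r.
Qed.

Definition avg (g : R -> R) : R := pi2^-1 * rint 0 pi2 g.
Definition iga (g : R -> R) := ig 0 pi2 g.

Lemma pi2V_gt0 : 0 < pi2^-1. Proof. by rewrite invr_gt0 pi2_gt0. Qed.

Lemma avg_le g h : iga g -> iga h -> (forall t, g t <= h t) -> avg g <= avg h.
Proof. by move=> ig ih H; rewrite ler_wpM2l ?(ltW pi2V_gt0) // rint_le. Qed.

Lemma avg_ge0 g : (forall t, 0 <= g t) -> 0 <= avg g.
Proof. by move=> H; rewrite mulr_ge0 ?(ltW pi2V_gt0) // rint_ge0. Qed.

Lemma avgD g h : iga g -> iga h -> avg (fun t => g t + h t) = avg g + avg h.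
Proof. by move=> ig ih; rewrite /avg rintD // mulrDr. Qed.

Lemma avgB g h : iga g -> iga h -> avg (fun t => g t - h t) = avg g - avg h.
Proof. by move=> ig ih; rewrite /avg rintB // mulrBr. Qed.

Lemma avgZ k g : iga g -> avg (fun t => k * g t) = k * avg g.
Proof. by move=> ig; rewrite /avg rintZ // mulrCA. Qed.

Lemma avg_cst k : avg (fun=> k) = k.
Proof. by rewrite /avg rint_cst ?(ltW pi2_gt0) // subr0 mulrC mulfK // gt_eqF // pi2_gt0. Qed.

Lemma avg_ext g h : (forall t, g t = h t) -> avg g = avg h.
Proof. by move=> H; congr (_ * _); apply: rint_eq. Qed.

Lemma iga_ext g h : (forall t, g t = h t) -> iga g -> iga h.
Proof. by move=> H; apply: ig_eq. Qed.

(** The Herglotz kernel, whose real part is the Poisson kernel ([Re_hker]); [hker'] is its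
    derivative in z. *)
Definition hker z t : C := (cis t + z) / (cis t - z).
Definition hker' z t : C := 2 * cis t / (cis t - z) ^+ 2.
Definition poisson z t : R := (1 - normc z ^+ 2) / normc (cis t - z) ^+ 2.

Lemma dist_cis_ge z t : 1 - normc z <= normc (cis t - z).
Proof. by have := normc_sub_ge (cis t) z; rewrite normc_cis. Qed.

Lemma dist_cis_gt0 z t : normc z < 1 -> 0 < normc (cis t - z).
Proof. by have := dist_cis_ge z t; lra. Qed.

Lemma dist_cis_neq0 z t : normc z < 1 -> cis t - z != 0.
Proof. by move=> z1; rewrite -normc_gt0 dist_cis_gt0. Qed.

Lemma Re_hker z t : Re (hker z t) = poisson z t.
Proof.
rewrite /hker /poisson; have [E|E] := eqVneq (cis t - z) 0.
  (* At z = cis t both sides are 0, the inverse of 0 being 0. *)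
  by rewrite E invr0 mulr0 normcr0 expr0n /= invr0 mulr0.
rewrite !normc_sqr -[1](cos2Dsin2 t).
move: E; rewrite -normc_eq0 -sqrf_eq0 normc_sqr.
case: z => a b; rewrite /= => E.
by field; exact: E.
Qed.

Lemma one_sub_sqr z : normc z < 1 -> 1 - normc z <= 1 - normc z ^+ 2.
Proof. by move=> z1; have := normc_ge0 z; nra. Qed.

Lemma poisson_gt0 z t : normc z < 1 -> 0 < poisson z t.
Proof.
move=> z1; rewrite divr_gt0 ?exprn_gt0 ?dist_cis_gt0 //.
by have := one_sub_sqr z1; lra.
Qed.

Lemma poisson_le z t : normc z < 1 ->
  poisson z t <= 2 * (1 - normc z) / normc (cis t - z) ^+ 2.
Proof.
move=> z1; rewrite ler_wpM2r ?invr_ge0 ?exprn_ge0 ?normc_ge0 //.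
by have := normc_ge0 z; nra.
Qed.

Lemma hker_le z t : normc z < 1 -> normc (hker z t) <= 2 / (1 - normc z).
Proof.
move=> z1; rewrite normc_div ler_pM ?normc_ge0 ?invr_ge0 ?normc_ge0 //.
  by rewrite (le_trans (normc_add _ _)) // normc_cis; lra.
by rewrite lef_pV2 ?posrE ?dist_cis_gt0 ?dist_cis_ge //; lra.
Qed.

Lemma normc_hker' z t : normc (hker' z t) = 2 / normc (cis t - z) ^+ 2.
Proof.
rewrite normc_div normc_exp normc_mul normc_cis mulr1; congr (_ / _).
have -> : (2 : C) = rc 2 by apply: complex_eq; rewrite !ReImE /= ?addr0.
by rewrite normc_rc ger0_norm.
Qed.

Lemma hker'_poisson z t : normc z < 1 ->
  normc (hker' z t) <= 2 / (1 - normc z) * poisson z t.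
Proof.
move=> z1; rewrite normc_hker' /poisson mulrA ler_wpM2r ?invr_ge0 ?exprn_ge0 ?normc_ge0 //.
rewrite mulrAC ler_pdivlMr; last by lra.
by rewrite ler_wpM2l //; exact: one_sub_sqr.
Qed.

Lemma hker'_le z t : normc z < 1 -> normc (hker' z t) <= 2 / (1 - normc z) ^+ 2.
Proof.
move=> z1; have d0 : 0 < 1 - normc z by lra.
rewrite normc_hker' ler_wpM2l // lef_pV2 ?posrE ?exprn_gt0 ?dist_cis_gt0 //.
by rewrite ler_pXn2r ?nnegrE ?normc_ge0 ?dist_cis_ge // ltW.
Qed.

Lemma rcontV (F : R -> C) x : F x != 0 -> rcont F x -> rcont (fun y => (F y)^-1) x.
Proof.
move=> F0 cF; apply: (@rcont_comp _ (fun w => w^-1)) => //.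
exact: cdiff_cont (cdiff_inv F0).
Qed.

Lemma rcont_hker z t : normc z < 1 -> rcont (hker z) t.
Proof.
move=> z1; apply: rcontM; first by apply: rcontD; [exact: rcont_cis|exact: rcont_cst].
apply: rcontV; first exact: dist_cis_neq0.
by apply: rcontB; [exact: rcont_cis|exact: rcont_cst].
Qed.

Lemma rcont_hker' z t : normc z < 1 -> rcont (hker' z) t.
Proof.
move=> z1; apply: rcontM; first by apply: rcontM; [exact: rcont_cst|exact: rcont_cis].
have c : rcont (fun t => cis t - z) t.
  by apply: rcontB; [exact: rcont_cis|exact: rcont_cst].
apply: rcontV; first by rewrite expf_neq0 // dist_cis_neq0.
exact: rcontM.
Qed.

Lemma poisson_continuous z t : normc z < 1 -> poisson z s @[s --> t] --> poisson z t.
Proof.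
by move=> z1; under eq_fun do rewrite -Re_hker; rewrite -Re_hker; apply: rcont_Re (rcont_hker _ _).
Qed.

Lemma poisson_le_cst z t : normc z < 1 -> poisson z t <= 2 / (1 - normc z).
Proof.
move=> z1; rewrite -Re_hker (le_trans (ler_norm _)) // (le_trans (Re_le_normc _)) //.
exact: hker_le.
Qed.

Lemma iga_poisson z phi : normc z < 1 -> iga phi -> iga (fun t => poisson z t * phi t).
Proof.
move=> z1; apply: (igM (k := 2 / (1 - normc z))) => t _; first exact: poisson_continuous.
by rewrite ger0_norm ?poisson_le_cst // ltW // poisson_gt0.
Qed.

Lemma conj_sub z t : cconj (cis t - z) = (cis t)^-1 * (1 - cconj z * cis t).
Proof. by rewrite cconjD cconjN cconj_cis; field; exact: cis_neq0. Qed.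

(** The radius 2 / (1 + |z|) exceeds 1 and, for z != 0, lies below 1 / |z|: functions with a pole at
    1 / conj z are thus differentiable past the unit circle, as the mean value property on it
    requires. *)
Lemma one_sub_neq0 z w : normc z < 1 -> normc w < 2 / (1 + normc z) -> 1 - cconj z * w != 0.
Proof.
move=> z1 wP; have z0 := normc_ge0 z; rewrite subr_eq0; apply/eqP => E.
have : normc (cconj z * w) = 1 by rewrite -E normcr1.
rewrite normc_mul normc_conj.
move: wP; rewrite ltr_pdivlMr; last by lra.
by have := normc_ge0 w; nra.
Qed.

Lemma mean_circle f z : normc z < 1 ->
  (forall w, normc w < 2 / (1 + normc z) -> exists L, cdiff f w L) ->
  cint 0 pi2 (fun t => f (cis t)) = rc pi2 * f 0.
Proof.
move=> z1 H; have z0 := normc_ge0 z.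
rewrite -(@mean_value R f 0 (2 / (1 + normc z)) 1).
- by apply: cint_eq => t _; rewrite add0r polarE mul1r.
- by move=> w; rewrite subr0 => /andP[_ /H].
- have [|L] := H 0; last exact: cdiff_cont.
  by rewrite normcr0 divr_gt0 //; lra.
- by rewrite ltr01 /= ltr_pdivlMr; lra.
Qed.

(** On the circle conj (cis t) = 1 / cis t, so the conjugate of the kernel is a function
    differentiable on a larger disc, evaluated at cis t; its mean is its value 1 at 0. *)
Lemma cint_hker z : normc z < 1 -> cint 0 pi2 (hker z) = rc pi2.
Proof.
move=> z1.
pose f w : C := (1 + cconj z * w) * (1 - cconj z * w)^-1.
have E t : hker z t = cconj (f (cis t)).
  rewrite -[LHS]cconjK; congr cconj; rewrite /hker cconjM cconjV conj_sub cconjD cconj_cis /f.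
  have c0 := cis_neq0 t; have := @one_sub_neq0 z (cis t) z1.
  rewrite normc_cis ltr_pdivlMr; last by have := normc_ge0 z; lra.
  by rewrite mul1r => h; field; rewrite c0 h //; lra.
have Df w : normc w < 2 / (1 + normc z) -> exists L, cdiff f w L.
  move=> wP; have D1 := cdiffZ (cconj z) (cdiff_id w).
  eexists; apply: cdiffM; first exact: cdiffD (cdiff_cst 1 w) D1.
  apply: (cdiff_comp (cdiffB (cdiff_cst 1 w) D1)); apply: cdiff_inv.
  exact: one_sub_neq0.
have cf : cig 0 pi2 (fun t => f (cis t)).
  apply: (@cig_eq _ _ _ (fun t => cconj (hker z t))); first by move=> t _; rewrite E cconjK.
  have [h1 h2] : cig 0 pi2 (hker z) by apply: cig_cont => t _; exact: rcont_hker.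
  by split; [apply: ig_eq h1|apply: ig_eq (igN h2)].
rewrite (cint_eq (G := fun t => cconj (f (cis t)))) //.
rewrite cint_conj // (mean_circle z1 Df) /f mulr0 addr0 subr0 invr1 mulr1.
by apply: complex_eq; rewrite /= !(mulr0, mulr1, mul0r, subr0, addr0, oppr0).
Qed.

(** Conjugation as in [cint_hker]; here the resulting function has a factor w and vanishes at 0. *)
Lemma cint_hker' z : normc z < 1 -> cint 0 pi2 (hker' z) = 0.
Proof.
move=> z1.
pose f w : C := 2 * w * ((1 - cconj z * w) * (1 - cconj z * w))^-1.
have E t : hker' z t = cconj (f (cis t)).
  rewrite -[LHS]cconjK; congr cconj; rewrite /hker' expr2 cconjM cconjV !cconjM conj_sub cconj_cis /f.
  have -> : cconj (2 : C) = 2 by apply: complex_eq; rewrite /= ?addr0 ?oppr0.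
  have c0 := cis_neq0 t; have := @one_sub_neq0 z (cis t) z1.
  rewrite normc_cis ltr_pdivlMr; last by have := normc_ge0 z; lra.
  by rewrite mul1r => h; field; rewrite c0 h //; lra.
have Df w : normc w < 2 / (1 + normc z) -> exists L, cdiff f w L.
  move=> wP; have D1 := cdiffB (cdiff_cst 1 w) (cdiffZ (cconj z) (cdiff_id w)).
  have D2 := cdiffM D1 D1.
  eexists; apply: cdiffM; first exact: cdiffZ (cdiff_id w).
  apply: (cdiff_comp D2); apply: cdiff_inv.
  by rewrite mulf_neq0 // one_sub_neq0.
have cf : cig 0 pi2 (fun t => f (cis t)).
  apply: (@cig_eq _ _ _ (fun t => cconj (hker' z t))); first by move=> t _; rewrite E cconjK.
  have [h1 h2] : cig 0 pi2 (hker' z) by apply: cig_cont => t _; exact: rcont_hker'.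
  by split; [apply: ig_eq h1|apply: ig_eq (igN h2)].
rewrite (cint_eq (G := fun t => cconj (f (cis t)))) //.
rewrite cint_conj // (mean_circle z1 Df) /f mulr0 mul0r mulr0.
by apply: complex_eq; rewrite /= ?oppr0.
Qed.

Lemma avg_poisson z : normc z < 1 -> avg (poisson z) = 1.
Proof.
move=> z1; have /(congr1 Re) /= E := cint_hker z1.
rewrite /avg; have -> : rint 0 pi2 (poisson z) = pi2.
  by apply: etrans E; apply: rint_eq => t _ /=; rewrite Re_hker.
by rewrite mulVf // gt_eqF // pi2_gt0.
Qed.

Lemma avg_poissonZ z k : normc z < 1 -> avg (fun t => poisson z t * k) = k.
Proof.
move=> z1; rewrite (avg_ext (h := fun t => k * poisson z t)); last by move=> t; rewrite mulrC.
rewrite avgZ ?avg_poisson ?mulr1 //.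
by apply: ig_cont; apply: cts_within => t _; exact: poisson_continuous.
Qed.

Definition herglotz phi z : C :=
  rc pi2^-1 * cint 0 pi2 (fun t => hker z t * rc (phi t)).
Definition herglotz' phi z : C :=
  rc pi2^-1 * cint 0 pi2 (fun t => hker' z t * rc (phi t)).

Lemma cig_hker z phi : normc z < 1 -> iga phi -> cig 0 pi2 (fun t => hker z t * rc (phi t)).
Proof.
move=> z1; apply: (cigM (k := 2 / (1 - normc z))) => t _; first exact: rcont_hker.
exact: hker_le.
Qed.

Lemma cig_hker' z phi : normc z < 1 -> iga phi -> cig 0 pi2 (fun t => hker' z t * rc (phi t)).
Proof.
move=> z1; apply: (cigM (k := 2 / (1 - normc z) ^+ 2)) => t _; first exact: rcont_hker'.
exact: hker'_le.
Qed.

Lemma Re_herglotz phi z : Re (herglotz phi z) = avg (fun t => poisson z t * phi t).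
Proof.
rewrite /herglotz cReM /= mul0r subr0; congr (_ * _); apply: rint_eq => t _ /=.
by rewrite cReM /= mulr0 subr0 Re_hker.
Qed.

Lemma normc_avg_le (F : R -> C) g : cig 0 pi2 F -> iga g -> (forall t, normc (F t) <= g t) ->
  normc (rc pi2^-1 * cint 0 pi2 F) <= avg g.
Proof.
move=> cF hg H; rewrite normc_mul normc_rc ger0_norm ?(ltW pi2V_gt0) //.
by rewrite ler_wpM2l ?(ltW pi2V_gt0) // cint_norm_le.
Qed.

Lemma herglotz_le phi z : normc z < 1 -> iga phi ->
  normc (herglotz phi z) <= 2 / (1 - normc z) * avg (fun t => `|phi t|).
Proof.
move=> z1 hp; rewrite -avgZ; last exact: ig_abs.
apply: normc_avg_le; first exact: cig_hker.
  by apply: igZ; exact: ig_abs.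
by move=> t; rewrite normc_mul normc_rc ler_wpM2r // hker_le.
Qed.

Lemma herglotz'_le phi z : normc z < 1 -> iga phi ->
  normc (herglotz' phi z) <= 2 / (1 - normc z) ^+ 2 * avg (fun t => `|phi t|).
Proof.
move=> z1 hp; rewrite -avgZ; last exact: ig_abs.
apply: normc_avg_le; first exact: cig_hker'.
  by apply: igZ; exact: ig_abs.
by move=> t; rewrite normc_mul normc_rc ler_wpM2r // hker'_le.
Qed.

(* The kernel [hker'] has mean zero, so a constant may be subtracted from [phi]. *)
Lemma herglotz'_poisson phi z k : normc z < 1 -> iga phi ->
  normc (herglotz' phi z) <=
  2 / (1 - normc z) * avg (fun t => poisson z t * `|phi t - k|).
Proof.
move=> z1 hp; have hk : iga (fun=> k) by exact: ig_cst.
have hpk := igB hp hk.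
have -> : herglotz' phi z = rc pi2^-1 * cint 0 pi2 (fun t => hker' z t * rc (phi t - k)).
  rewrite /herglotz'; congr (_ * _).
  rewrite [RHS](cint_eq (G := fun t => hker' z t * rc (phi t) - rc k * hker' z t)); last first.
    by move=> t _; rewrite rcD rcN; ring.
  have ch : cig 0 pi2 (hker' z) by apply: cig_cont => t _; exact: rcont_hker'.
  rewrite cintB ?cintZ ?cint_hker' ?mulr0 ?subr0 //; first exact: cig_hker'.
  exact: cigZ.
rewrite -avgZ; last by apply: iga_poisson => //; exact: ig_abs.
apply: normc_avg_le; first exact: cig_hker'.
  by apply: igZ; apply: iga_poisson => //; exact: ig_abs.
move=> t; rewrite normc_mul normc_rc mulrA ler_wpM2r //.
exact: hker'_poisson.
Qed.

(** Differentiation under the integral sign for a merely integrable [phi]: the second-order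
    remainder of the kernel is explicit, and within half the distance to the circle it is at most (4
    / d^3) |w - z|^2 uniformly in t. *)
Lemma cdiff_herglotz phi z : normc z < 1 -> iga phi ->
  cdiff (herglotz phi) z (herglotz' phi z).
Proof.
move=> z1 hp e e0; pose d : R := 1 - normc z; have d0 : 0 < d by rewrite /d; lra.
pose A := avg (fun t => `|phi t|).
have A0 : 0 <= A by apply: avg_ge0.
have K0 : 0 < 4 / d ^+ 3 * (A + 1).
  by rewrite mulr_gt0 ?divr_gt0 ?exprn_gt0 //; lra.
near=> w.
have wz : normc (w - z) < d / 2 by near: w; apply: near_normc; rewrite divr_gt0.
have we : normc (w - z) < e / (4 / d ^+ 3 * (A + 1)).
  by near: w; apply: near_normc; rewrite divr_gt0.
have w1 : normc w < 1.
  by have := normc_sub_ge w z; move: wz; rewrite /d; have := normc_ge0 z; lra.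
have E : herglotz phi w - herglotz phi z - herglotz' phi z * (w - z) =
    rc pi2^-1 * cint 0 pi2 (fun t => (hker w t - hker z t - hker' z t * (w - z)) * rc (phi t)).
  rewrite [in RHS](cint_eq (G := fun t => (hker w t * rc (phi t) - hker z t * rc (phi t))
      - (w - z) * (hker' z t * rc (phi t)))); last by move=> t _; ring.
  have c1 := cig_hker w1 hp; have c2 := cig_hker z1 hp; have c3 := cig_hker' z1 hp.
  rewrite (cintB (F := fun t => hker w t * rc (phi t) - hker z t * rc (phi t))).
  - by rewrite (cintB c1 c2) cintZ // /herglotz /herglotz'; ring.
  - exact: cigB.
  - exact: cigZ.
have B t : normc (hker w t - hker z t - hker' z t * (w - z)) <= 4 / d ^+ 3 * normc (w - z) ^+ 2.
  have n1 := dist_cis_neq0 t w1; have n2 := dist_cis_neq0 t z1.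
  have -> : hker w t - hker z t - hker' z t * (w - z) =
     (2 * cis t) * (w - z) ^+ 2 / ((cis t - w) * (cis t - z) ^+ 2).
    by rewrite /hker /hker'; field; rewrite n1 n2.
  rewrite normc_div (normc_mul (2 * cis t)) (normc_mul 2) (normc_mul (cis t - w)) !normc_exp normc_cis mulr1 mulrAC.
  have -> : normc (2 : C) = 2.
    have -> : (2 : C) = rc 2 by apply: complex_eq; rewrite !ReImE /= ?addr0.
    by rewrite normc_rc ger0_norm.
  rewrite ler_wpM2r ?exprn_ge0 ?normc_ge0 //.
  have -> : 4 / d ^+ 3 = 2 / (d / 2 * d ^+ 2) by field; rewrite gt_eqF.
  rewrite ler_wpM2l // lef_pV2 ?posrE ?mulr_gt0 ?exprn_gt0 ?dist_cis_gt0 ?divr_gt0 //.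
  apply: ler_pM; rewrite ?divr_ge0 ?exprn_ge0 ?(ltW d0) //.
    have := dist_cis_ge w t; have := normc_sub_ge w z; move: wz; rewrite /d; lra.
  by rewrite ler_pXn2r ?nnegrE ?normc_ge0 ?(ltW d0) // dist_cis_ge.
rewrite E.
apply: (@le_trans _ _ (4 / d ^+ 3 * normc (w - z) ^+ 2 * A)).
  rewrite -avgZ; last exact: ig_abs.
  apply: normc_avg_le.
  - apply: (cigM (k := 4 / d ^+ 3 * normc (w - z) ^+ 2)) => // t _.
    apply: rcontB; first by apply: rcontB; exact: rcont_hker.
    by apply: rcontM; [exact: rcont_hker'|exact: rcont_cst].
  - by apply: igZ; exact: ig_abs.
  - by move=> t; rewrite normc_mul normc_rc ler_wpM2r.
move: we; rewrite ltr_pdivlMr // => we.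
have -> : 4 / d ^+ 3 * normc (w - z) ^+ 2 * A = (normc (w - z) * (4 / d ^+ 3 * A)) * normc (w - z).
  by rewrite expr2; ring.
rewrite ler_wpM2r ?normc_ge0 // (le_trans _ (ltW we)) //.
rewrite ler_wpM2l ?normc_ge0 // ler_wpM2l ?divr_ge0 ?exprn_ge0 ?(ltW d0) //; lra.
Unshelve. all: end_near. Qed.

End Herglotz.

(** * Periodic integrals *)

Section PeriodicIntegrals.
Context {R : realType}.
Local Notation C := (Cplx R).
Local Notation pi2 := (2 * pi : R).
Implicit Types (g : R -> R) (z w : C) (t x y r q a b d : R).

Definition rcts g := forall x : R, g y @[y --> x] --> g x.

Lemma rcts_within a b g : rcts g -> {within `[a, b], continuous g}.
Proof. by move=> cg; apply: cts_within => x _; exact: cg. Qed.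

Lemma primitive g (lo hi : R) : rcts g ->
  exists A : R -> R, forall x, lo <= x <= hi -> is_derive x 1 A (g x).
Proof.
(* Starting one unit to the left, and stopping one to the right, makes every point of [lo, hi]
   interior. *)
move=> cg; exists (fun x => rint (lo - 1) x g) => x /andP[lox xhi].
have xu : x < hi + 1 by lra.
have lx : lo - 1 < x by lra.
have hi_g : lebesgue_measure.-integrable `[lo - 1, hi + 1] (EFin \o g).
  by apply: ig_cont; exact: rcts_within.
have [d1 d2] := continuous_FTC1_closed xu hi_g lx (cg x).
constructor; first exact: d1.
by rewrite -derive1E; exact: d2.
Qed.

Lemma is_derive0_const (A : R -> R) a b : a <= b ->
  (forall x, a <= x <= b -> is_derive x 1 A (0 : R)) -> A a = A b.
Proof.
move=> ab dA; have c0 : {within `[a, b], continuous (fun=> 0 : R)}.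
  by apply: cts_within => x _; exact: cvg_cst.
have := rint_FTC ab c0 dA; rewrite rint_cst // mul0r => /esym/eqP.
by rewrite subr_eq0 => /eqP.
Qed.

Lemma pi_lt4 : (pi : R) < 4.
Proof. by have := @pihalf_lt2 R; lra. Qed.

Definition primitive_on (A g : R -> R) a b :=
  forall x, a <= x <= b -> is_derive x 1 A (g x).

Lemma rintE (A g : R -> R) a b : a <= b -> {within `[a, b], continuous g} ->
  primitive_on A g a b -> rint a b g = A b - A a.
Proof. exact: rint_FTC. Qed.

Definition per g := forall t, g (t + pi2) = g t.

(** Changes of variables are made on a primitive over a long interval: A (x + 2 pi) - A x has zero
    derivative, hence is constant. As 2 pi < 8, the margin 16 holds both x and x + 2 pi whenever |x|
    <= L + 4. *)
Lemma per_primitive g (L : R) : rcts g -> per g -> 0 <= L -> exists A : R -> R,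
  (forall x, - (L + 16) <= x <= L + 16 -> is_derive x 1 A (g x)) /\
  (forall x, - L - 4 <= x <= L + 4 -> A (x + pi2) - A x = rint 0 pi2 g).
Proof.
move=> cg pg L0; have [A dA] := primitive (- (L + 16)) (L + 16) cg.
exists A; split => // x xP.
have p4 := pi_lt4; have p0 := pi_gt0 R.
have -> : rint 0 pi2 g = A (0 + pi2) - A 0.
  rewrite add0r; apply: rint_FTC; first exact: ltW pi2_gt0.
    exact: rcts_within.
  by move=> y /andP[y0 y2]; apply: dA; lra.
have dB y : - L - 4 <= y <= L + 4 -> is_derive y 1 (fun y => A (y + pi2) - A y) (0 : R).
  move=> yP; have d1 : is_derive (y + pi2) 1 A (g (y + pi2)) by apply: dA; lra.
  have d2 : is_derive y 1 A (g y) by apply: dA; lra.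
  have d3 := rderD (rder_id y) (rder_cst pi2 y).
  apply: is_derive_eq (rderB (rder_comp (g := fun y => y + pi2) d1 d3) d2) _.
  by rewrite pg; ring.
have [x0|x0] := leP 0 x.
  symmetry; apply: (@is_derive0_const (fun y => A (y + pi2) - A y)) => // y yP; apply: dB.
  lra.
apply: (@is_derive0_const (fun y => A (y + pi2) - A y)) => //; first exact: ltW.
by move=> y yP; apply: dB; lra.
Qed.

Lemma rint_shift g x : rcts g -> per g -> `|x| <= 4 ->
  rint 0 pi2 (fun t => g (t + x)) = rint 0 pi2 g.
Proof.
move=> cg pg x4; have [A [dA pA]] := per_primitive cg pg (ler0n _ 0).
have p4 := pi_lt4; have p0 := pi_gt0 R.
move: x4; rewrite ler_norml => x4.
rewrite -(pA x); last by lra.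
rewrite (addrC x) (@rintE (fun t => A (t + x))); first by rewrite add0r.
- exact: ltW pi2_gt0.
- apply: rcts_within => t; apply: (@cvg_comp _ _ _ (fun t => t + x) g); last exact: cg.
  by apply: cvgD; [exact: cvg_id|exact: cvg_cst].
- move=> t /andP[t0 t2]; have d1 : is_derive (t + x) 1 A (g (t + x)) by apply: dA; lra.
  apply: is_derive_eq (rder_comp (g := fun t => t + x) d1 (rderD (rder_id t) (rder_cst x t))) _.
  by ring.
Qed.

(** The circle is described symmetrically about the angle t, with q = 1 at t itself. Thus 1 - q
    measures the angular distance as 1 - r measures the radial one. *)
Lemma rint_symm g t : rcts g -> per g -> 0 <= t <= pi2 ->
  rint 0 pi2 g = pi * rint 0 1 (fun q => g (t + pi * (1 - q)) + g (t - pi * (1 - q))).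
Proof.
move=> cg pg tP; have t0 : 0 <= t by lra.
have [A [dA pA]] := per_primitive cg pg t0.
have p4 := pi_lt4; have p0 := pi_gt0 R.
have c1 : rcts (fun q => g (t + pi * (1 - q))).
  move=> q; apply: (@cvg_comp _ _ _ (fun q => t + pi * (1 - q)) g); last exact: cg.
  apply: cvgD; first exact: cvg_cst; apply: cvgM; first exact: cvg_cst.
  by apply: cvgB; [exact: cvg_cst|exact: cvg_id].
have c2 : rcts (fun q => g (t - pi * (1 - q))).
  move=> q; apply: (@cvg_comp _ _ _ (fun q => t - pi * (1 - q)) g); last exact: cg.
  apply: cvgB; first exact: cvg_cst; apply: cvgM; first exact: cvg_cst.
  by apply: cvgB; [exact: cvg_cst|exact: cvg_id].
have c12 : rcts (fun q => g (t + pi * (1 - q)) + g (t - pi * (1 - q))).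
  by move=> q; apply: cvgD; [exact: c1|exact: c2].
rewrite -rintZ; last by apply: ig_cont; exact: rcts_within.
rewrite [RHS](@rintE (fun q => A (t - pi * (1 - q)) - A (t + pi * (1 - q)))) //.
- rewrite !subrr mulr0 !subr0 mulr1 !addr0 subrr sub0r opprB -(pA (t - pi)); last by lra.
  by congr (A _ - _); ring.
- apply: rcts_within => q; apply: cvgM; first exact: cvg_cst; exact: c12.
- move=> q /andP[q0 q1].
  have h1 : 0 <= pi * (1 - q) <= pi by apply/andP; split; nra.
  have d1 : is_derive (t - pi * (1 - q)) 1 A (g (t - pi * (1 - q))) by apply: dA; lra.
  have d2 : is_derive (t + pi * (1 - q)) 1 A (g (t + pi * (1 - q))) by apply: dA; lra.
  have e1 := rderM (rder_cst pi q) (rderB (rder_cst 1 q) (rder_id q)).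
  have e2 := rderD (rder_cst t q) e1.
  have e3 := rderB (rder_cst t q) e1.
  apply: is_derive_eq (rderB (rder_comp (g := fun q => t - pi * (1 - q)) d1 e3) (rder_comp (g := fun q => t + pi * (1 - q)) d2 e2)) _.
  by ring.
Qed.

(** While cos y >= 1/2, sin is the integral of a function that is at least 1/2; afterwards cos^2 <
    1/4 forces sin y > 1/2, whereas y / 4 < 1/2. *)
Lemma sin_ge_lin y : 0 <= y <= pi / 2 -> y / 4 <= sin y.
Proof.
move=> /andP[y0 yp]; have p2 := @pihalf_lt2 R; have pp := pi_gt0 R.
have s0 : 0 <= sin y by apply: sin_ge0_pi; apply/andP; split; lra.
have [c2|c2] := leP (2^-1) (cos y).
  suff : y / 2 <= sin y by lra.
  have -> : sin y = rint 0 y cos.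
    rewrite (@rintE (@sin R)) ?sin0 ?subr0 //.
      by apply: rcts_within => x; exact: continuous_cos.
    by move=> x _; exact: is_derive_sin.
  have -> : y / 2 = rint 0 y (fun=> 2^-1) by rewrite rint_cst // subr0 mulrC.
  apply: rint_le; [exact: ig_cst|by apply: ig_cont; apply: rcts_within => x; exact: continuous_cos|].
  move=> x /andP[x0 xy]; rewrite (le_trans c2) //.
  have yI : y \in `[0, pi] by rewrite in_itv /=; apply/andP; split; lra.
  have xI : x \in `[0, pi] by rewrite in_itv /=; apply/andP; split; lra.
  rewrite leNgt; apply/negP; rewrite (ltr_cos yI xI); lra.
have cy0 : 0 <= cos y by apply: cos_ge0_pihalf; apply/andP; split; lra.
by have := cos2Dsin2 y; nra.
Qed.

Lemma normc_cis_sub1_ge0 y : 0 <= y <= pi -> y / 4 <= normc (cis y - 1).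
Proof.
move=> /andP[y0 yp]; have sP : y / 2 / 4 <= sin (y / 2).
  by apply: sin_ge_lin; apply/andP; split; lra.
rewrite -(@ler_pXn2r _ 2) ?nnegrE ?normc_ge0 //; last by lra.
rewrite normc_sqr !ReImE /= subr0.
have E1 : cos y = 1 - 2 * sin (y / 2) ^+ 2.
  have := cos_mulr2n (y / 2); have -> : (y / 2) *+ 2 = y by rewrite -mulr_natr divfK.
  by move=> ->; rewrite cos2sin2 -mulr_natr; ring.
have := cos2Dsin2 y; have := sqr_ge0 (sin (y / 2)).
have : (y / 8) ^+ 2 <= sin (y / 2) ^+ 2 by rewrite ler_pXn2r ?nnegrE //; lra.
by rewrite E1; nra.
Qed.

Lemma normc_cis_sub1 x : `|x| <= pi -> `|x| / 4 <= normc (cis x - 1).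
Proof.
move=> xp; have -> : normc (cis x - 1) = normc (cis `|x| - 1).
  rewrite !normcE !ReImE /= cos_norm; congr (Num.sqrt (_ + _)).
  have [x0|x0] := leP 0 x; first by rewrite ger0_norm.
  by rewrite ltr0_norm // sinN !subr0 sqrrN.
by apply: normc_cis_sub1_ge0; rewrite normr_ge0.
Qed.

(* Both the radial and the angular distance bound [|cis x - r|] from below. *)
Lemma dist_cis_real x r : 0 <= r <= 1 -> `|x| <= pi -> `|x| / 8 <= normc (cis x - rc r).
Proof.
move=> /andP[r0 r1] /normc_cis_sub1 h.
have h1 := normc_tri (cis x) (rc r) 1.
have h2 := dist_cis_ge (rc r) x.
have h3 : normc (rc r - 1) = 1 - r.
  rewrite normc_distC (_ : 1 - rc r = rc (1 - r)); last by rewrite rcD rcN.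
  by rewrite normc_rc ger0_norm //; lra.
by move: h2; rewrite normc_rc ger0_norm //; lra.
Qed.

(** The constant is 9 = 1 + 8: the distance dominates 1 - r, and 8 times the distance dominates |x|.
    Rotation by t reduces to a point on the positive axis. *)
Lemma dist_cis_polar t x r : 0 <= r <= 1 -> `|x| <= pi ->
  (1 - r) + `|x| <= 9 * normc (cis (t + x) - polar r t).
Proof.
move=> rP xp; have /andP[r0 r1] := rP.
have h1 := dist_cis_real rP xp; have h2 := dist_cis_ge (rc r) x.
have -> : cis (t + x) - polar r t = cis t * (cis x - rc r).
  by rewrite polarE cisD; ring.
rewrite normc_mul normc_cis mul1r.
by move: h2; rewrite normc_rc ger0_norm //; lra.
Qed.

(** a^(-3/2), and below it a^(-5/2). Written with a square root, they keep derivatives and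
    primitives within reach of field identities. *)
Definition w32 (a : R) : R := (a * Num.sqrt a)^-1.
Definition w52 (a : R) : R := (a ^+ 2 * Num.sqrt a)^-1.

Lemma w32_gt0 a : 0 < a -> 0 < w32 a.
Proof. by move=> a0; rewrite invr_gt0 mulr_gt0 // sqrtr_gt0. Qed.

Lemma w52_gt0 a : 0 < a -> 0 < w52 a.
Proof. by move=> a0; rewrite invr_gt0 mulr_gt0 ?exprn_gt0 // sqrtr_gt0. Qed.

Lemma w32_anti a b : 0 < a -> a <= b -> w32 b <= w32 a.
Proof.
move=> a0 ab; have b0 : 0 < b by lra.
rewrite lef_pV2 ?posrE ?mulr_gt0 ?sqrtr_gt0 //.
by apply: ler_pM; rewrite ?sqrtr_ge0 ?(ltW a0) ?ler_sqrt ?(ltW b0).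
Qed.

Lemma w52_anti a b : 0 < a -> a <= b -> w52 b <= w52 a.
Proof.
move=> a0 ab; have b0 : 0 < b by lra.
rewrite lef_pV2 ?posrE ?mulr_gt0 ?exprn_gt0 ?sqrtr_gt0 //.
apply: ler_pM; rewrite ?sqrtr_ge0 ?exprn_ge0 ?(ltW a0) // ?ler_sqrt ?(ltW b0) //.
by rewrite ler_pXn2r ?nnegrE ?(ltW a0) ?(ltW b0).
Qed.

Lemma w52E a : 0 < a -> w52 a = w32 a / a.
Proof.
move=> a0; have s0 : Num.sqrt a != 0 by rewrite gt_eqF // sqrtr_gt0.
by rewrite /w52 /w32; field; rewrite s0 gt_eqF.
Qed.

(** 27 = 9^(3/2), and 243 = 9^(5/2) in [w52_scale]; the 9 is that of [dist_cis_polar]. *)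
Lemma w32_scale a : 0 < a -> w32 (a / 9) = 27 * w32 a.
Proof.
move=> a0; rewrite /w32 sqrtrM ?(ltW a0) // sqrtrV //.
have -> : (9 : R) = 3 ^+ 2 by rewrite -natrX.
rewrite sqrtr_sqr ger0_norm //; have s0 : Num.sqrt a != 0 by rewrite gt_eqF // sqrtr_gt0.
by field; rewrite s0 gt_eqF.
Qed.

Lemma w52_scale a : 0 < a -> w52 (a / 9) = 243 * w52 a.
Proof.
move=> a0; rewrite !w52E ?divr_gt0 // w32_scale //.
by field; rewrite gt_eqF.
Qed.

Lemma rcts_sqrt_at (f : R -> R) x : f y @[y --> x] --> f x ->
  Num.sqrt (f y) @[y --> x] --> Num.sqrt (f x).
Proof. by move=> cf; exact: (cvg_comp _ _ cf (@sqrt_continuous R (f x))). Qed.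

Lemma rder_w32 a x : 0 < a + x ->
  is_derive x 1 (fun x => - 2 * (Num.sqrt (a + x))^-1) (w32 (a + x)).
Proof.
move=> ax; have s0 : Num.sqrt (a + x) != 0 by rewrite gt_eqF // sqrtr_gt0.
have d1 := rder_comp (is_derive1_sqrt ax) (rderD (rder_cst a x) (rder_id x)).
have d2 := rderM (rder_cst (-2) x) (@is_deriveV R (fun x => Num.sqrt (a + x)) x _ 1 s0 d1).
apply: is_derive_eq d2 _.
rewrite /GRing.scale /= /w32.
have -> : a + x = Num.sqrt (a + x) ^+ 2 by rewrite sqr_sqrtr // ltW.
rewrite sqrtr_sqr ger0_norm ?sqrtr_ge0 //.
by field.
Qed.

Lemma cts_w32 (f : R -> R) x : 0 < f x -> f y @[y --> x] --> f x ->
  w32 (f y) @[y --> x] --> w32 (f x).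
Proof.
move=> fx cf; apply: cvgV; first by rewrite mulf_neq0 // gt_eqF // sqrtr_gt0.
by apply: cvgM => //; exact: rcts_sqrt_at.
Qed.

Lemma cts_w52 (f : R -> R) x : 0 < f x -> f y @[y --> x] --> f x ->
  w52 (f y) @[y --> x] --> w52 (f x).
Proof.
move=> fx cf; apply: cvgV; first by rewrite mulf_neq0 ?expf_neq0 // gt_eqF // ?sqrtr_gt0.
by apply: cvgM; [exact: (@cvg_comp _ _ _ f (fun u => u ^+ 2) _ _ _ cf (@exprn_continuous _ 2 _))|exact: rcts_sqrt_at].
Qed.

Lemma cvg_one_sub x : 1 - y @[y --> x] --> (1 - x : R).
Proof. by apply: cvgB; [exact: cvg_cst|exact: cvg_id]. Qed.

Lemma cts_w32_within d : 0 < d -> {within `[0, 1], continuous (fun q => w32 (d + (1 - q)))}.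
Proof.
move=> d0; apply: cts_within => q qP; apply: (@cts_w32 (fun q => d + (1 - q))); first lra.
by apply: cvgD; [exact: cvg_cst|exact: cvg_one_sub].
Qed.

Lemma rint_w32 d : 0 < d -> rint 0 1 (fun q => w32 (d + (1 - q))) <= 2 / Num.sqrt d.
Proof.
move=> d0.
have D : primitive_on (fun q => - (- 2 * (Num.sqrt (d + (1 - q)))^-1))
    (fun q => w32 (d + (1 - q))) 0 1.
  move=> q qP; have dq : 0 < d + (1 - q) by lra.
  have e := rderB (rder_cst 1 q) (rder_id q).
  apply: is_derive_eq (rderN (rder_comp (g := fun q => 1 - q) (rder_w32 dq) e)) _.
  by ring.
rewrite (rintE ler01 (cts_w32_within d0) D).
rewrite subrr addr0 subr0 mulNr opprK lerBlDr lerDl.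
by rewrite mulNr opprK mulr_ge0 // invr_ge0 sqrtr_ge0.
Qed.

Lemma polar_ex z : exists t, 0 <= t <= pi2 /\ z = polar (normc z) t.
Proof.
have [->|z0] := eqVneq z 0.
  exists 0; rewrite lexx (ltW pi2_gt0) normcr0 polarE; split => //.
  by apply: complex_eq; rewrite !ReImE /= !mul0r ?subr0 ?addr0.
have nz : normc z != 0 by rewrite normc_eq0.
have nz' : rc (normc z) != 0 by rewrite -normc_eq0 normc_rc normr_eq0.
have [|t tP tE] := @unit_circle_cis R (z / rc (normc z)).
  by rewrite /unit_circle /= normc_div normc_rc ger0_norm ?normc_ge0 // divff.
by exists t; split => //; rewrite polarE -tE mulrC divfK.
Qed.

Lemma normc_polar_lt1 r t : 0 <= r < 1 -> normc (polar r t) < 1.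
Proof. by move=> /andP[r0 r1]; rewrite normc_polar. Qed.

Lemma avg_symm g t : rcts g -> per g -> 0 <= t <= pi2 ->
  avg g = 2^-1 * rint 0 1 (fun q => g (t + pi * (1 - q)) + g (t - pi * (1 - q))).
Proof.
move=> cg pg tP; rewrite /avg (rint_symm cg pg tP) mulrA; congr (_ * _).
by rewrite invfM -mulrA mulVf ?mulr1 // lt0r_neq0 // pi_gt0.
Qed.

Lemma dist_cis_polar_sub t x r : 0 <= r <= 1 -> 0 <= x <= pi ->
  (1 - r) + x <= 9 * normc (cis (t + x) - polar r t) /\
  (1 - r) + x <= 9 * normc (cis (t - x) - polar r t).
Proof.
move=> rP /andP[x0 xp]; split.
  by have := @dist_cis_polar t x r rP; rewrite ger0_norm //; exact.
by have := @dist_cis_polar t (- x) r rP; rewrite normrN ger0_norm //; exact.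
Qed.

(** After comparing |cis s - z| with (1 - r) + (1 - q), the mean is an elementary integral. The
    constant is (1/2) 54 times the 2 of [rint_w32], where 54 counts 27 for each of the two symmetric
    points. *)
Lemma avg_w32 z : normc z < 1 ->
  avg (fun s => w32 (normc (cis s - z))) <= 54 / Num.sqrt (1 - normc z).
Proof.
move=> z1; have [t [tP zE]] := polar_ex z.
pose r := normc z; have r0 : 0 <= r := normc_ge0 z; have r1 : r < 1 := z1.
have rP : 0 <= r <= 1 by rewrite r0 ltW.
have d0 : 0 < 1 - r by lra.
pose g s := w32 (normc (cis s - z)).
have cg : rcts g.
  move=> s; apply: (@cts_w32 (fun s => normc (cis s - z))); first exact: dist_cis_gt0.
  apply: (@rcont_normc _ (fun s => cis s - z)).
  by apply: rcontB; [exact: rcont_cis|exact: rcont_cst].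
have pg : per g by move=> s; rewrite /g cisD2pi.
have bound s x : 0 < x -> x <= 9 * normc (cis s - z) -> g s <= 27 * w32 x.
  by move=> x0 xs; rewrite -w32_scale // w32_anti ?divr_gt0 // ler_pdivrMr // mulrC.
rewrite (avg_symm cg pg tP).
have h q : 0 <= q <= 1 ->
    g (t + pi * (1 - q)) + g (t - pi * (1 - q)) <= 54 * w32 ((1 - r) + (1 - q)).
  move=> qP; have p2 := pi_ge2 R.
  have xP : 0 <= pi * (1 - q) <= pi by apply/andP; split; nra.
  have [h1 h2] := dist_cis_polar_sub t rP xP; move: h1 h2; rewrite -zE => h1 h2.
  have s0 : 0 < (1 - r) + (1 - q) by lra.
  have le1 : (1 - r) + (1 - q) <= 1 - r + pi * (1 - q) by nra.
  have := bound _ _ s0 (le_trans le1 h1); have := bound _ _ s0 (le_trans le1 h2).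
  by lra.
have := rint_w32 d0.
have cw := cts_w32_within d0.
have : rint 0 1 (fun q => g (t + pi * (1 - q)) + g (t - pi * (1 - q))) <=
       rint 0 1 (fun q => 54 * w32 ((1 - r) + (1 - q))).
  apply: rint_le => //; last by apply: igZ; exact: ig_cont.
  apply: ig_cont; apply: rcts_within => q; apply: cvgD.
    apply: (@cvg_comp _ _ _ (fun q => t + pi * (1 - q)) g); last exact: cg.
    by apply: cvgD; [exact: cvg_cst|apply: cvgM; [exact: cvg_cst|exact: cvg_one_sub]].
  apply: (@cvg_comp _ _ _ (fun q => t - pi * (1 - q)) g); last exact: cg.
  by apply: cvgB; [exact: cvg_cst|apply: cvgM; [exact: cvg_cst|exact: cvg_one_sub]].
rewrite rintZ; last exact: ig_cont.
have -> : 54 / Num.sqrt (1 - r) = 27 * (2 / Num.sqrt (1 - r)) by ring.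
by lra.
Qed.

End PeriodicIntegrals.

(** * Mean oscillation of Lipschitz functions *)

Section LipFunctions.
Context {R : realType}.
Local Notation C := (Cplx R).
Implicit Types (z w : C) (t x r eps d K : R).
Variables (alpha : R) (f : C -> C).
Hypotheses (alpha_gt0 : 0 < alpha) (alpha_le : alpha <= 2^-1).
Hypothesis lipf : lip_space alpha f.

(* [p z = o((1 - |z|)^(alpha - 1))] as [|z| -> 1]; the constant [K] takes care of
   the compact part of the disc. *)
Definition little_o (p : C -> R) := forall eps : R, 0 < eps -> exists2 K : R, 0 <= K &
  forall z, normc z < 1 -> p z <= eps * (1 - normc z) `^ (alpha - 1) + K.

Lemma powR_alpha_inj x : 0 <= x -> (x `^ (alpha^-1)) `^ alpha = x.
Proof. by move=> x0; rewrite -powRrM mulVf ?gt_eqF // powRr1. Qed.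

Lemma powR_alphaK x : 0 <= x -> (x `^ alpha) `^ (alpha^-1) = x.
Proof. by move=> x0; rewrite -powRrM mulfV ?gt_eqF // powRr1. Qed.

Lemma le_powR x y r : 0 <= r -> 0 <= x -> x <= y -> x `^ r <= y `^ r.
Proof. by move=> r0 x0 xy; apply: ge0_ler_powR; rewrite ?nnegrE // (le_trans x0). Qed.

Lemma powR_subr x r : 0 < x -> x `^ (r - 1) = x `^ r / x.
Proof. by move=> x0; rewrite powRB ?(gt_eqF x0) ?implybT // powRr1 // ltW. Qed.

Lemma lip_cdiff z : normc z < 1 -> cdiff f z ('D_1 f z).
Proof. by move=> z1; case: lipf => [[an _] _]; apply: derivable_cdiff; exact: an. Qed.

Lemma lip_unif eps : 0 < eps -> exists2 d : R, 0 < d &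
  forall z w, normc z <= 1 -> normc w <= 1 -> normc (z - w) < d -> normc (f z - f w) <= eps.
Proof.
move=> e0; case: lipf => _ /(_ 1 ltr01)[d d0 H].
exists (Num.min d (eps `^ (alpha^-1))); first by rewrite lt_min d0 powR_gt0.
move=> z w z1 w1; rewrite lt_min => /andP[h1 h2].
rewrite (le_trans (H _ _ z1 w1 h1)) // mul1r -[leRHS]powR_alpha_inj ?(ltW e0) //.
by apply: le_powR; rewrite ?normc_ge0 ?(ltW alpha_gt0) ?(ltW h2).
Qed.

(** From 0 to z there are N radial steps, each shorter than d and each changing [f] by at most 1. *)
Lemma lip_bounded : exists2 B : R, 0 < B & forall z, normc z <= 1 -> normc (f z) <= B.
Proof.
have [d d0 H] := lip_unif ltr01.
pose N := (Num.truncn (d^-1)).+1.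
have Nd : d^-1 < N%:R by rewrite truncnS_gt.
have N0 : 0 < N%:R :> R by rewrite ltr0n.
exists (normc (f 0) + N%:R); first by have := normc_ge0 (f 0); lra.
move=> z z1.
have step j : (j <= N)%N -> normc (f (rc (j%:R / N%:R) * z)) <= normc (f 0) + j%:R.
  elim: j => [_|j IH jN].
    rewrite mul0r (_ : rc 0 * z = 0) ?addr0 //.
    by apply: complex_eq; rewrite !ReImE /= !mul0r ?subr0 ?addr0.
  have IH' := IH (ltnW jN).
  have nle k : (k <= N)%N -> normc (rc (k%:R / N%:R) * z) <= 1.
    move=> kN; rewrite normc_mul normc_rc ger0_norm ?divr_ge0 // mulr_ile1 ?normc_ge0 ?divr_ge0 //.
    by rewrite ler_pdivrMr // mul1r ler_nat.
  have hd : N%:R^-1 * normc z < d.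
    rewrite (le_lt_trans (y := N%:R^-1)) //; last by rewrite invf_plt ?posrE // invrK.
    by rewrite -[leRHS]mulr1 ler_wpM2l ?invr_ge0.
  have h : normc (f (rc (j.+1%:R / N%:R) * z) - f (rc (j%:R / N%:R) * z)) <= 1.
    apply: H; [exact: nle|exact: nle (ltnW jN)|].
    rewrite -mulrBl -rcN -rcD -mulrBl -natr1 [j%:R + 1]addrC addrK normc_mul normc_rc.
    by rewrite ger0_norm ?divr_ge0 // mul1r.
  move: h IH'; move: (f (rc (j.+1%:R / N%:R) * z)) (f (rc (j%:R / N%:R) * z)) => u v h IH'.
  have e : j.+1%:R = j%:R + 1 :> R by rewrite -natr1.
  by have := normc_add (u - v) v; rewrite subrK e; lra.
have := step N (leqnn N); rewrite divff ?gt_eqF //.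
by rewrite (_ : rc 1 * z = z) //; exact: mul1r.
Qed.

Lemma lip_holder : exists2 H : R, 0 < H &
  forall z w, normc z <= 1 -> normc w <= 1 -> normc (f z - f w) <= H * normc (z - w) `^ alpha.
Proof.
have [B B0 fB] := lip_bounded.
case: lipf => _ /(_ 1 ltr01)[d d0 H].
have da : 0 < d `^ alpha by rewrite powR_gt0.
have q0 : 0 <= 2 * B / d `^ alpha by rewrite divr_ge0 ?mulr_ge0 ?ltW.
exists (1 + 2 * B / d `^ alpha); first by lra.
move=> z w z1 w1; have p0 : 0 <= normc (z - w) `^ alpha by rewrite powR_ge0.
have [h|h] := ltP (normc (z - w)) d.
  rewrite (le_trans (H _ _ z1 w1 h)) // mul1r mulrDl mul1r lerDl mulr_ge0 //.
rewrite (le_trans (normc_sub _ _)) // (le_trans (lerD (fB _ z1) (fB _ w1))) //.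
have : d `^ alpha <= normc (z - w) `^ alpha by apply: le_powR => //; exact: ltW.
move=> h2; have : 2 * B / d `^ alpha * d `^ alpha <= 2 * B / d `^ alpha * normc (z - w) `^ alpha.
  by rewrite ler_wpM2l.
by rewrite divfK ?gt_eqF //; lra.
Qed.

Lemma lip_rcont t : rcont (fun t => f (cis t)) t.
Proof.
move=> e e0; have [d d0 H] := lip_unif e0.
have d2 : 0 < d / 2 by rewrite divr_gt0.
have := rcont_cis t d2; apply: filterS => s h; apply: H; rewrite ?normc_cis //.
lra.
Qed.

Lemma lip_dist_rcts (c : C) : rcts (fun t => normc (f (cis t) - c)).
Proof.
move=> t; apply: (@rcont_normc _ (fun t => f (cis t) - c)).
by apply: rcontB; [exact: lip_rcont|exact: rcont_cst].
Qed.

Lemma iga_rcts (g : R -> R) : rcts g -> iga g.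
Proof. by move=> cg; apply: ig_cont; exact: rcts_within. Qed.

Definition omega z : R := avg (fun t => poisson z t * normc (f (cis t) - f z)).

Lemma omega_ge0 z : normc z < 1 -> 0 <= omega z.
Proof.
by move=> z1; apply: avg_ge0 => t; rewrite mulr_ge0 ?normc_ge0 // ltW // poisson_gt0.
Qed.

(** Write n = |cis t - z| and delta = 1 - |z|. Where n < d, the integrand is at most a small
    multiple of delta n^(alpha - 2), and [alpha <= 1/2] with delta <= n gives n^alpha <=
    delta^(alpha - 1/2) n^(1/2): this leaves n^(-3/2), whose mean is known. Where n >= d, the
    Poisson kernel is O(delta) and [f] is bounded. *)
Lemma omega_bound eps : 0 < eps -> exists2 K : R, 0 <= K &
  forall z, normc z < 1 ->
    omega z <= eps * (1 - normc z) `^ alpha + K * (1 - normc z).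
Proof.
move=> e0; have [B B0 fB] := lip_bounded.
(* 108 = 2 * 54: the numerator of the Poisson kernel is at most 2 (1 - |z|), and 54 comes from
   [avg_w32]. *)
have e1 : 0 < eps / 108 by rewrite divr_gt0.
case: lipf => _ /(_ _ e1)[d d0 H].
exists (4 * B / d ^+ 2); first by rewrite divr_ge0 ?mulr_ge0 ?exprn_ge0 ?ltW.
move=> z z1; pose del : R := 1 - normc z; have del0 : 0 < del by rewrite /del; lra.
have da := powR_gt0 alpha del0; have sd : 0 < Num.sqrt del by rewrite sqrtr_gt0.
pose k1 : R := eps / 108 * (2 * (del `^ alpha * Num.sqrt del)).
pose k2 : R := 2 * B / d ^+ 2 * (2 * del).
have k10 : 0 <= k1 by rewrite !mulr_ge0 ?ltW.
have pt t : poisson z t * normc (f (cis t) - f z) <= k1 * w32 (normc (cis t - z)) + k2.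
  set n := normc (cis t - z); have n0 : 0 < n by exact: dist_cis_gt0.
  have dn : del <= n by exact: dist_cis_ge.
  have sn : 0 < Num.sqrt n by rewrite sqrtr_gt0.
  have p1 : poisson z t * n ^+ 2 <= 2 * del.
    rewrite /poisson divfK; last by rewrite expf_neq0 // gt_eqF.
    by rewrite /del; have := normc_ge0 z; nra.
  have P0 : 0 <= poisson z t by rewrite ltW // poisson_gt0.
  have w0 : 0 <= w32 n by rewrite ltW // w32_gt0.
  have [h|h] := ltP n d.
    have hH : normc (f (cis t) - f z) <= eps / 108 * n `^ alpha.
      by apply: H; [by change (normc (cis t) <= 1); rewrite normc_cis|exact: ltW|exact: h].
    have na : n `^ alpha <= del `^ alpha * Num.sqrt del * (n ^+ 2 * w32 n) / del.
      have -> : n ^+ 2 * w32 n = Num.sqrt n.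
        rewrite /w32 -{1 2}(sqr_sqrtr (ltW n0)); field; exact: lt0r_neq0.
      have E u : 0 < u -> u `^ alpha = Num.sqrt u / u `^ (2^-1 - alpha).
        move=> u0; rewrite -powR12_sqrt ?ltW // -powRB ?(gt_eqF u0) ?implybT //.
        by congr (_ `^ _); ring.
      have -> : del `^ alpha * Num.sqrt del * Num.sqrt n / del =
          Num.sqrt n / del `^ (2^-1 - alpha).
        rewrite (E del del0) -[X in _ / X = _](sqr_sqrtr (ltW del0)).
        by field; apply/andP; split; apply: lt0r_neq0 => //; exact: powR_gt0.
      rewrite (E n n0) ler_wpM2l ?sqrtr_ge0 // lef_pV2 ?posrE ?powR_gt0 //.
      by apply: le_powR => //; [rewrite subr_ge0|exact: ltW].
    have k20 : 0 <= k2 by rewrite !mulr_ge0 ?invr_ge0 ?exprn_ge0 ?ltW.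
    apply: (@le_trans _ _ (k1 * w32 n)); last by rewrite lerDl.
    apply: (@le_trans _ _ (poisson z t * (eps / 108 *
       (del `^ alpha * Num.sqrt del * (n ^+ 2 * w32 n) / del)))).
      rewrite ler_wpM2l // (le_trans hH) // ler_wpM2l //; exact: ltW.
    have -> : poisson z t * (eps / 108 * (del `^ alpha * Num.sqrt del * (n ^+ 2 * w32 n) / del))
      = (poisson z t * n ^+ 2) * (eps / 108 * (del `^ alpha * Num.sqrt del * w32 n / del)) by ring.
    have q0 : 0 <= eps / 108 * (del `^ alpha * Num.sqrt del * w32 n / del).
      by rewrite mulr_ge0 ?divr_ge0 ?mulr_ge0 ?ltW.
    rewrite (le_trans (ler_wpM2r q0 p1)) // le_eqVlt; apply/orP; left; apply/eqP.
    by rewrite /k1; field; exact: lt0r_neq0.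
  apply: (@le_trans _ _ k2); last by rewrite lerDr mulr_ge0.
  have f2 : normc (f (cis t) - f z) <= 2 * B.
    by rewrite (le_trans (normc_sub _ _)) // mulr2n mulrDl !mul1r lerD // fB // ?normc_cis // ltW.
  have P1 : poisson z t <= 2 * del / d ^+ 2.
    rewrite ler_pdivlMr ?exprn_gt0 // (le_trans _ p1) // ler_wpM2l //.
    by rewrite ler_pXn2r ?nnegrE ?(ltW d0) ?(ltW n0).
  rewrite (le_trans (ler_pM P0 (normc_ge0 _) P1 f2)) // /k2.
  by rewrite le_eqVlt; apply/orP; left; apply/eqP; field; exact: lt0r_neq0.
have cw : rcts (fun t => w32 (normc (cis t - z))).
  move=> t; apply: (@cts_w32 _ (fun t => normc (cis t - z))); first exact: dist_cis_gt0.
  apply: (@rcont_normc _ (fun t => cis t - z)).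
  by apply: rcontB; [exact: rcont_cis|exact: rcont_cst].
have ic : iga (fun=> k2) by exact: ig_cst.
have iw : iga (fun t => k1 * w32 (normc (cis t - z))) by apply: igZ; exact: iga_rcts.
have ip : iga (fun t => poisson z t * normc (f (cis t) - f z)).
  by apply: iga_poisson => //; apply: iga_rcts; exact: lip_dist_rcts.
rewrite /omega (le_trans (avg_le ip (igD iw ic) pt)) // avgD // avg_cst avgZ; last exact: iga_rcts.
have := avg_w32 z1; rewrite -/del => /(ler_wpM2l k10) A.
apply: (le_trans (lerD A (lexx k2))).
rewrite le_eqVlt; apply/orP; left; apply/eqP; rewrite /k1 /k2.
by field; rewrite !lt0r_neq0.
Qed.

Lemma omega_little_o : little_o (fun z => omega z / (1 - normc z)).
Proof.
move=> e e0; have [K K0 H] := omega_bound e0; exists K => // z z1.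
have d0 : 0 < 1 - normc z by lra.
rewrite ler_pdivrMr // (le_trans (H _ z1)) // mulrDl powR_subr //.
by rewrite mulrA divfK // gt_eqF.
Qed.

(** Cauchy's estimate on the circle of radius (1 - |z|) / 2 about z; dividing by that radius doubles
    the constant, whence e / 2. Points at distance at least 2 d from the circle are covered by the
    bound of [f]. *)
Lemma deriv_little_o : little_o (fun z => normc ('D_1 f z)).
Proof.
move=> e e0; have [B B0 fB] := lip_bounded.
have e1 : 0 < e / 2 by rewrite divr_gt0.
case: (lipf) => _ /(_ _ e1)[d d0 H].
exists (2 * B / d); first by rewrite divr_ge0 ?mulr_ge0 ?ltW.
move=> z z1; pose del : R := 1 - normc z; have del0 : 0 < del by rewrite /del; lra.
have del2 : 0 < del / 2 < del by apply/andP; split; lra.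
have inD w : normc (w - z) < del -> normc w < 1.
  by have := normc_sub_ge w z; rewrite /del; lra.
have CE k : (forall w, normc (w - z) = del / 2 -> normc (f w - f z) <= k) ->
    normc ('D_1 f z) <= k / (del / 2).
  apply: (@cauchy_estimate R f z ('D_1 f z) del) => //; last exact: lip_cdiff.
  by move=> w /inD w1; exists ('D_1 f w); exact: lip_cdiff.
have z1' := ltW z1.
have pa : 0 <= e * del `^ (alpha - 1) by rewrite mulr_ge0 ?powR_ge0 ?ltW.
have pb : 0 <= 2 * B / d by rewrite divr_ge0 ?mulr_ge0 ?ltW.
have [h|h] := ltP (del / 2) d.
  apply: (@le_trans _ _ (e * del `^ (alpha - 1))); last by rewrite lerDl.
  have -> : e * del `^ (alpha - 1) = e / 2 * del `^ alpha / (del / 2).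
    by rewrite powR_subr //; field; rewrite gt_eqF.
  apply: CE => w wE; have w1 : normc w < 1 by apply: inD; rewrite wE; lra.
  apply: (le_trans (H _ _ (ltW w1) z1' _)); first by rewrite wE.
  rewrite wE; apply: ler_wpM2l; first exact: ltW.
  by apply: le_powR; [exact: ltW|lra|lra].
apply: (@le_trans _ _ (2 * B / d)); last by rewrite lerDr.
apply: (@le_trans _ _ (2 * B / (del / 2))).
  apply: CE => w wE; have w1 : normc w < 1 by apply: inD; rewrite wE; lra.
  by rewrite (le_trans (normc_sub _ _)) // mulr2n mulrDl !mul1r lerD // fB // ltW.
apply: ler_wpM2l; first by rewrite mulr_ge0 // ltW.
by rewrite lef_pV2 ?posrE //; lra.
Qed.

(** Cauchy's estimate applied to the difference of [f] and its translate by w - z: that difference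
    is uniformly small, and its derivative at z is f' w - f' z. No second derivative is involved. *)
Lemma deriv_ccont_gen (f' : C -> C) z : (forall w, normc w < 1 -> cdiff f w (f' w)) ->
  normc z < 1 -> ccont f' z.
Proof.
move=> df z1 e e0; pose del : R := 1 - normc z; have del0 : 0 < del by rewrite /del; lra.
have e1 : 0 < e * del / 8 by rewrite divr_gt0 ?mulr_gt0.
have [d d0 H] := lip_unif e1.
near=> w.
have wd : normc (w - z) < d by near: w; exact: near_normc.
have wdel : normc (w - z) < del / 2 by near: w; apply: near_normc; rewrite divr_gt0.
pose F u := f (u + (w - z)) - f u.
have in1 u : normc (u - z) < del / 2 -> normc u < 1.
  by have := normc_sub_ge u z; rewrite /del in wdel *; have := normc_ge0 (w - z); lra.
have in2 u : normc (u - z) < del / 2 -> normc (u + (w - z)) < 1.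
  by have := normc_add u (w - z); have := normc_sub_ge u z; rewrite /del in wdel *; lra.
have dF u : normc (u - z) < del / 2 -> cdiff F u (f' (u + (w - z)) - f' u).
  move=> uz; apply: cdiffB; last exact: df _ (in1 _ uz).
  have := cdiff_comp (f := fun u => u + (w - z)) (cdiffD (cdiff_id u) (cdiff_cst (w - z) u)) (df _ (in2 _ uz)).
  by rewrite addr0 mulr1.
have zz : normc (z - z) < del / 2 by rewrite subrr normcr0 divr_gt0.
have -> : f' w - f' z = f' (z + (w - z)) - f' z by congr (f' _ - _); rewrite addrC subrK.
have -> : e = (e * del / 4) / (del / 4) by field; rewrite gt_eqF.
apply: (@cauchy_estimate R F z _ (del / 2)).
- by move=> u /dF; eexists; eassumption.
- exact: dF.
- by apply/andP; split; lra.
- move=> u uE; have ud : normc (u - z) < del / 2 by rewrite uE; lra.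
  have b v : normc (v - z) < del / 2 -> normc (F v) <= e * del / 8.
    move=> vd; apply: H; [exact: ltW (in2 _ vd)|exact: ltW (in1 _ vd)|].
    by rewrite addrC addKr.
  rewrite (le_trans (normc_sub _ _)) // (le_trans (lerD (b _ ud) (b _ zz))) //; lra.
Unshelve. all: end_near. Qed.

Lemma deriv_ccont z : normc z < 1 -> ccont (fun w => 'D_1 f w) z.
Proof. by apply: deriv_ccont_gen => w; exact: lip_cdiff. Qed.

(** Inverting the Hoelder bound, (|f xi| / H)^(1/alpha) is a lower bound of the distances to all
    zeros, hence of their infimum; no nearest zero is chosen. Without zeros the distance is 1 and
    the bound of [f] serves, which explains B + H. *)
Lemma zero_dist : exists2 H : R, 0 < H & forall xi, unit_circle xi ->
  normc (f xi) <= H * dist_to (zero_set f) xi `^ alpha.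
Proof.
have [B B0 fB] := lip_bounded; have [H H0 fH] := lip_holder.
exists (B + H); first by lra.
move=> xi xi1; rewrite /dist_to; case: eqP => [_|/eqP/set0P E].
  by rewrite powR1 mulr1 (le_trans (fB _ _)) ?xi1 //; lra.
set D := [set _ | _ in _].
have h0 : 0 <= normc (f xi) / H by rewrite divr_ge0 ?normc_ge0 ?ltW.
have : (normc (f xi) / H) `^ (alpha^-1) <= inf D.
  apply: lb_le_inf; first by case: E => z Ez; exists (normc (xi - z)); exists z.
  move=> _ [z [z1 fz] <-]; rewrite -[leRHS]powR_alphaK ?normc_ge0 //.
  apply: le_powR => //; first by rewrite invr_ge0 ltW.
  rewrite ler_pdivrMr // mulrC.
  by have := fH xi z; rewrite fz subr0 xi1 z1; apply.
move=> h; rewrite -ler_pdivrMl; last by lra.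
have : ((normc (f xi) / H) `^ alpha^-1) `^ alpha <= inf D `^ alpha.
  by apply: le_powR => //; rewrite ?powR_ge0 // ltW.
rewrite powR_alpha_inj //; apply: le_trans.
rewrite mulrC ler_wpM2l ?normc_ge0 // lef_pV2 ?posrE //; lra.
Qed.

End LipFunctions.

(** * The logarithm of the modulus on the circle *)

Section LogModulus.
Context {R : realType}.
Local Notation C := (Cplx R).
Local Notation pi2 := (2 * pi : R).
Local Notation mu := (@lebesgue_measure R).
Implicit Types (z w : C) (t x y r d e : R).

Lemma ln_sub_le x y : 0 < x -> 0 < y -> ln x - ln y <= (x - y) / y.
Proof.
move=> x0 y0; have xy : 0 < x / y by rewrite divr_gt0.
rewrite -ln_div ?posrE //.
have := @le_ln1Dx R (x / y - 1); have -> : 1 + (x / y - 1) = x / y by ring.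
move=> h.
have -> : (x - y) / y = x / y - 1 by rewrite mulrBl divff ?gt_eqF.
by apply: h; lra.
Qed.

(** Truncation at e > 0 makes the logarithm Lipschitz, so its composition with |f| is continuous on
    the circle even at zeros of [f]. *)
Definition logmax (e x : R) : R := ln (Num.max x e).

Lemma max_gt0 x e : 0 < e -> 0 < Num.max x e.
Proof. by move=> e0; rewrite lt_max e0 orbT. Qed.

Lemma logmax_sub e x y : 0 < e ->
  logmax e x - logmax e y <= `|x - y| / Num.max y e.
Proof.
move=> e0; rewrite (le_trans (ln_sub_le _ _)) ?max_gt0 //.
rewrite ler_wpM2r ?invr_ge0 ?(ltW (max_gt0 y e0)) //.
have := ler_norm (x - y); have := normr_ge0 (x - y).
by rewrite /Num.max; case: ltP => ?; case: ltP => ?; lra.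
Qed.

Lemma logmax_lip e x y : 0 < e -> `|logmax e x - logmax e y| <= `|x - y| / e.
Proof.
move=> e0; have h u v : logmax e u - logmax e v <= `|u - v| / e.
  rewrite (le_trans (logmax_sub _ _ e0)) // ler_wpM2l // lef_pV2 ?posrE ?max_gt0 //.
  by rewrite le_max lexx orbT.
by rewrite ler_norml; have := h x y; have := h y x; rewrite distrC; lra.
Qed.

(** The automorphism of the disc that takes 0 to z. *)
Definition mob z w : C := (z + w) / (1 + cconj z * w).

Lemma mob_den z w : normc z < 1 -> normc w < 1 -> 1 + cconj z * w != 0.
Proof.
move=> z1 w1; rewrite addr_eq0; apply/eqP => E.
have : normc (cconj z * w) = 1 by rewrite -normc_opp -E normcr1.
by rewrite normc_mul normc_conj; have := normc_ge0 z; have := normc_ge0 w; nra.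
Qed.

Lemma normc_mob z w : normc z < 1 -> normc w < 1 ->
  1 - normc (mob z w) ^+ 2 =
  (1 - normc z ^+ 2) * (1 - normc w ^+ 2) / normc (1 + cconj z * w) ^+ 2.
Proof.
move=> z1 w1; have := mob_den z1 w1; rewrite -normc_eq0 -sqrf_eq0 => D.
rewrite /mob normc_div expr_div_n -[X in X - _](divff D) -mulrBl; congr (_ / _).
by rewrite !normc_sqr; case: z w {z1 w1 D} => a b [c d]; rewrite /cconj !ReImE /=; ring.
Qed.

Lemma mob_lt1 z w : normc z < 1 -> normc w < 1 -> normc (mob z w) < 1.
Proof.
move=> z1 w1; have zz := one_sub_sqr z1; have ww := one_sub_sqr w1.
have : 0 < 1 - normc (mob z w) ^+ 2.
  rewrite normc_mob // divr_gt0 ?mulr_gt0 ?exprn_gt0 ?normc_gt0 ?mob_den //; lra.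
by have := normc_ge0 (mob z w); nra.
Qed.

(** Circles about 0 close to the unit circle are carried close to it, with a rate depending on z
    only. A bound valid near the circle therefore reaches z through the mean value property at 0. *)
Lemma mob_dist z w : normc z < 1 -> normc w < 1 ->
  1 - normc (mob z w) <= 2 * (1 - normc w) / (1 - normc z) ^+ 2.
Proof.
move=> z1 w1; have m1 := mob_lt1 z1 w1; have m0 := normc_ge0 (mob z w).
have z0 := normc_ge0 z; have w0 := normc_ge0 w.
apply: (@le_trans _ _ (1 - normc (mob z w) ^+ 2)); first by nra.
rewrite normc_mob //.
have d : 1 - normc z <= normc (1 + cconj z * w).
  have := normc_sub_ge 1 (- (cconj z * w)); rewrite opprK normcr1 normc_opp normc_mul normc_conj.
  by nra.
have d0 : 0 < 1 - normc z by lra.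
have A : 0 <= 1 - normc z ^+ 2 <= 1 by apply/andP; split; nra.
have B : 0 <= 1 - normc w ^+ 2 <= 2 * (1 - normc w) by apply/andP; split; nra.
have /andP[A0 A1] := A; have /andP[B0 B1] := B.
apply: ler_pM.
- exact: mulr_ge0.
- by rewrite invr_ge0 exprn_ge0 ?normc_ge0.
- by rewrite (le_trans _ B1) // -[leRHS]mul1r ler_wpM2r.
- rewrite lef_pV2 ?posrE ?exprn_gt0 //; last by apply: lt_le_trans d.
  by rewrite ler_pXn2r ?nnegrE ?normc_ge0 // ltW.
Qed.

Lemma mob0 z : mob z 0 = z.
Proof. by rewrite /mob mulr0 !addr0 divr1. Qed.

Lemma cdiff_mob z w : normc z < 1 -> normc w < 1 -> exists L, cdiff (mob z) w L.
Proof.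
move=> z1 w1; eexists; apply: cdiffM.
  exact: cdiffD (cdiff_cst z w) (cdiff_id w).
apply: (cdiff_comp (f := fun w => 1 + cconj z * w)).
  exact: cdiffD (cdiff_cst 1 w) (cdiffZ (cconj z) (cdiff_id w)).
exact: cdiff_inv (mob_den z1 w1).
Qed.

Lemma avg_dct (g_ : nat -> R -> R) (g h : R -> R) :
  (forall n, iga (g_ n)) -> iga g -> iga h ->
  {ae mu, forall t, `[0, pi2]%classic t -> g_ n t @[n --> \oo] --> g t} ->
  {ae mu, forall t, forall n, `[0, pi2]%classic t -> `|g_ n t| <= h t} ->
  avg (fun t => `|g_ n t - g t|) @[n --> \oo] --> 0.
Proof.
move=> ig ig0 ih cv dom.
have mg n := measurable_int _ (ig n).
have mg0 := measurable_int _ ig0.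
have cv' : {ae mu, forall t, `[0, pi2]%classic t -> (EFin \o g_ n) t @[n --> \oo] --> (EFin \o g) t}.
  apply: (@filterS _ _ (ae_filter_ringOfSetsType mu) _ _ _ cv) => t H Dt; apply: cvg_EFin; first exact: nearW.
  exact: H.
have dom' : {ae mu, forall t, forall n, `[0, pi2]%classic t -> (`|(EFin \o g_ n) t| <= (EFin \o h) t)%E}.
  by apply: (@filterS _ _ (ae_filter_ringOfSetsType mu) _ _ _ dom) => t H n Dt; rewrite /= lee_fin; exact: H.
have [_ H _] := dominated_convergence (mu := mu) (measurable_itv _) mg mg0 cv' ih dom'.
rewrite -(mulr0 pi2^-1); apply: cvgM; first exact: cvg_cst.
exact: (fine_cvg H).
Qed.

Variables (alpha : R) (f : C -> C).
Hypotheses (alpha_gt0 : 0 < alpha) (alpha_le : alpha <= 2^-1).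
Hypothesis lipf : lip_space alpha f.

Lemma omega_small d : 0 < d -> exists2 s : R, 0 < s &
  forall z, normc z < 1 -> 1 - normc z <= s -> omega f z <= d.
Proof.
move=> d0; have d2 : 0 < d / 2 by rewrite divr_gt0.
have [K K0 H] := omega_bound alpha_gt0 alpha_le lipf d2.
exists (d / 2 / (K + 1)); first by rewrite divr_gt0 //; lra.
move=> z z1 zs; have := H z z1; move: zs; rewrite ler_pdivlMr; last by lra.
have z0 := normc_ge0 z.
have : (1 - normc z) `^ alpha <= 1.
  have := @le_powR R (1 - normc z) 1 alpha; rewrite powR1; apply; [exact: ltW|lra|lra].
move: (_ `^ _) => p p1 zs; nra.
Qed.

Definition lnmax (e : R) t : R := logmax e (normc (f (cis t))).

Lemma normc_dist_le (a b : C) : `|normc a - normc b| <= normc (a - b).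
Proof.
rewrite ler_norml; have := normc_sub_ge a b; have := normc_sub_ge b a.
by rewrite (normc_distC b a); lra.
Qed.

Lemma rcts_lnmax e : 0 < e -> rcts (lnmax e).
Proof.
move=> e0 t; apply/cvgrPdist_le => d d0.
have de : 0 < d * e by rewrite mulr_gt0.
have := lip_rcont alpha_gt0 lipf t de; apply: filterS => s h.
rewrite (le_trans (logmax_lip _ _ e0)) // ler_pdivrMr // (le_trans _ h) //.
by rewrite normc_distC; exact: normc_dist_le.
Qed.

Lemma iga_lnmax e : 0 < e -> iga (lnmax e).
Proof. by move=> e0; apply: iga_rcts; exact: rcts_lnmax. Qed.

Lemma iga_osc z : normc z < 1 -> iga (fun t => poisson z t * normc (f (cis t) - f z)).
Proof.
by move=> z1; apply: iga_poisson => //; apply: iga_rcts; exact: lip_dist_rcts alpha_gt0 lipf _.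
Qed.

Lemma iga_poisson1 z : normc z < 1 -> iga (poisson z).
Proof. by move=> z1; apply: iga_rcts => t; exact: poisson_continuous. Qed.

(** Subharmonicity up to the error omega / e, from the Lipschitz bound alone. As omega tends to 0 at
    the circle, the error is harmless there, and [subharmonic] removes it inside. *)
Lemma avg_lnmax_ge e z : 0 < e -> normc z < 1 ->
  logmax e (normc (f z)) - omega f z / e <= avg (fun t => poisson z t * lnmax e t).
Proof.
move=> e0 z1; rewrite /omega.
have -> : logmax e (normc (f z)) = avg (fun t => poisson z t * logmax e (normc (f z))).
  by rewrite avg_poissonZ.
have i1 : iga (fun t => poisson z t * logmax e (normc (f z))).
  by apply: iga_poisson => //; exact: ig_cst.
have i2 := igZ e^-1 (iga_osc z1).
rewrite (mulrC _ e^-1) -avgZ ?iga_osc // -avgB //.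
apply: avg_le; [exact: igB|by apply: iga_poisson => //; exact: iga_lnmax|].
move=> t; have P0 := ltW (poisson_gt0 t z1).
rewrite mulrCA -mulrBr ler_wpM2l //.
have := logmax_lip (normc (f z)) (normc (f (cis t))) e0.
have : `|normc (f z) - normc (f (cis t))| / e <= e^-1 * normc (f (cis t) - f z).
  by rewrite mulrC ler_wpM2l ?invr_ge0 ?(ltW e0) // normc_distC normc_dist_le.
by rewrite ler_norml /lnmax; lra.
Qed.

(* [f * exp (- H)], with [H] the Herglotz integral of [lnmax e], has modulus at most
   [1 + o(1)] near the circle; composing it with a disc automorphism moves [z] to the
   centre, where the mean value property applies. *)
Lemma subharmonic e z : 0 < e -> normc z < 1 -> f z != 0 ->
  ln (normc (f z)) <= avg (fun t => poisson z t * lnmax e t).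
Proof.
move=> e0 z1 fz0; apply/ler_addgt0Pr => d d0.
pose H := herglotz (lnmax e).
pose q w := f w * cexp (- H w).
have qb w : normc w < 1 -> normc (q w) <= expR (omega f w / e).
  move=> w1; rewrite normc_mul normc_cexp cReN Re_herglotz.
  have [->|fw0] := eqVneq (f w) 0; first by rewrite normcr0 mul0r expR_ge0.
  rewrite -[normc (f w)]lnK ?posrE ?normc_gt0 // -expRD ler_expR.
  have := avg_lnmax_ge e0 w1; suff : ln (normc (f w)) <= logmax e (normc (f w)) by lra.
  by rewrite ler_ln ?posrE ?max_gt0 ?normc_gt0 // le_max lexx.
have [s s0 sP] := omega_small (mulr_gt0 d0 e0).
have z10 : 0 < (1 - normc z) ^+ 2 by rewrite exprn_gt0 // subr_gt0.
(* By [mob_dist], this radius brings the image of the circle within s of the unit circle, where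
   omega is at most d e; the 1/2 keeps r positive. *)
pose r := Num.max (2^-1) (1 - s * (1 - normc z) ^+ 2 / 2).
have r0 : 0 < r by rewrite lt_max invr_gt0 ltr0n.
have r1 : r < 1.
  by rewrite gt_max; apply/andP; split; [lra|have := mulr_gt0 s0 z10; lra].
have rs : 2 * (1 - r) / (1 - normc z) ^+ 2 <= s.
  rewrite ler_pdivrMr //; have : 1 - s * (1 - normc z) ^+ 2 / 2 <= r by rewrite le_max lexx orbT.
  lra.
have dq w : normc w < 1 -> exists L, cdiff (fun w => q (mob z w)) w L.
  move=> w1; have [L1 D1] := cdiff_mob z1 w1.
  have m1 := mob_lt1 z1 w1.
  have D2 := lip_cdiff lipf m1.
  have D3 := cdiff_herglotz m1 (iga_lnmax e0).
  eexists; apply: (cdiff_comp D1); rewrite /q; apply: (cdiffM D2).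
  exact: cdiff_comp (cdiffN D3) (cdiff_exp _).
have : normc (q (mob z 0)) <= expR d.
  apply: (@mean_value_bound R (fun w => q (mob z w)) 0 1 r).
  - by move=> w; rewrite subr0 => /andP[_ /dq].
  - by have [|L /cdiff_cont //] := dq 0; rewrite normcr0.
  - by rewrite r0.
  - move=> w; rewrite subr0 => wr; have w1 : normc w < 1 by rewrite wr.
    have m1 := mob_lt1 z1 w1; rewrite (le_trans (qb _ m1)) // ler_expR.
    rewrite ler_pdivrMr // sP // (le_trans (mob_dist z1 w1)) // wr //.
rewrite mob0 normc_mul normc_cexp cReN Re_herglotz -{1}[normc (f z)]lnK ?posrE ?normc_gt0 //.
by rewrite -expRD ler_expR; lra.
Qed.

Lemma avg_lnmax_ge_max e z : 0 < e -> normc z < 1 ->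
  logmax e (normc (f z)) <= avg (fun t => poisson z t * lnmax e t).
Proof.
move=> e0 z1; rewrite {1}/logmax /Num.max; case: ltP => h.
  rewrite -[leLHS](avg_poissonZ _ z1); apply: avg_le.
  - by apply: iga_poisson => //; exact: ig_cst.
  - by apply: iga_poisson => //; exact: iga_lnmax.
  - move=> t; rewrite ler_wpM2l ?(ltW (poisson_gt0 t z1)) //.
    by rewrite ler_ln ?posrE ?max_gt0 // le_max lexx orbT.
apply: subharmonic => //.
by rewrite -normc_gt0 (lt_le_trans e0).
Qed.

Lemma lnmax_osc e z : 0 < e -> normc z < 1 ->
  avg (fun t => poisson z t * `|lnmax e t - logmax e (normc (f z))|) <=
  2 * omega f z / Num.max (normc (f z)) e.
Proof.
move=> e0 z1; set M := Num.max _ _; have M0 : 0 < M by exact: max_gt0.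
set m := logmax _ _.
have i1 := iga_osc z1; have i2 := igZ (2 / M) i1.
have i3 : iga (fun t => poisson z t * lnmax e t) by apply: iga_poisson => //; exact: iga_lnmax.
have i4 : iga (fun t => poisson z t * m) by apply: iga_poisson => //; exact: ig_cst.
have -> : 2 * omega f z / M = 2 / M * omega f z by ring.
(* With v = lnmax - m this integrates |v| = 2 v^+ - v, using v^+ <= |f (cis t) - f z| / M. The
   subtracted bracket is the Poisson mean of v, nonnegative by [avg_lnmax_ge_max]. *)
apply: (@le_trans _ _ (2 / M * omega f z - (avg (fun t => poisson z t * lnmax e t) - m))).
  rewrite /omega -[X in _ - (_ - X)](avg_poissonZ m z1) -avgZ // -avgB // -avgB //; last exact: igB.
  apply: avg_le.
  - apply: iga_poisson => //; apply: ig_abs; apply: igB; [exact: iga_lnmax|exact: ig_cst].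
  - by apply: igB => //; exact: igB.
  - move=> t; have P0 := ltW (poisson_gt0 t z1).
    rewrite mulrCA -!mulrBr ler_wpM2l //.
    have := logmax_sub (normc (f (cis t))) (normc (f z)) e0; rewrite -/m -/M -/(lnmax e t) => h1.
    have h2 : `|normc (f (cis t)) - normc (f z)| / M <= normc (f (cis t) - f z) / M.
      by rewrite ler_wpM2r ?invr_ge0 ?(ltW M0) // normc_dist_le.
    have h3 : 0 <= normc (f (cis t) - f z) / M by rewrite divr_ge0 ?normc_ge0 ?(ltW M0).
    have -> : 2 / M * normc (f (cis t) - f z) = 2 * (normc (f (cis t) - f z) / M) by ring.
    by rewrite ler_norml; apply/andP; split; lra.
by have := avg_lnmax_ge_max e0 z1; rewrite -/m; lra.
Qed.

End LogModulus.

(** * Integrability of ln|f| on the circle and removal of the truncation *)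

Section LogIntegrable.
Context {R : realType}.
Local Notation C := (Cplx R).
Local Notation pi2 := (2 * pi : R).
Local Notation mu := (@lebesgue_measure R).
Implicit Types (z w : C) (t x y r d e : R).
Variables (alpha : R) (f : C -> C).
Hypotheses (alpha_gt0 : 0 < alpha) (alpha_le : alpha <= 2^-1).
Hypothesis lipf : lip_space alpha f.
Hypothesis fnz : exists2 z, closed_disc z & f z != 0.

Lemma ex_disc_neq0 : exists2 z, normc z < 1 & f z != 0.
Proof.
have [z z1 fz] := fnz; have {}z1 : normc z <= 1 := z1.
have [h|h] := ltP (normc z) 1; first by exists z.
have nf : 0 < normc (f z) / 2 by rewrite divr_gt0 ?normc_gt0.
have [d d0 H] := lip_unif alpha_gt0 lipf nf.
pose s : R := Num.min (2^-1) (d / 2).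
have s0 : 0 < s by rewrite lt_min invr_gt0 ltr0n divr_gt0.
have s1 : s <= 2^-1 by rewrite ge_min lexx.
have sd : s < d by rewrite gt_min; apply/orP; right; lra.
have wn : normc (rc (1 - s) * z) < 1.
  by rewrite normc_mul normc_rc ger0_norm; [nra|lra].
exists (rc (1 - s) * z) => //.
have dz : normc (z - rc (1 - s) * z) < d.
  rewrite (_ : z - rc (1 - s) * z = rc s * z); last first.
    by apply: complex_eq; rewrite !ReImE /=; ring.
  by rewrite normc_mul normc_rc ger0_norm ?(ltW s0) //; nra.
apply/eqP => E; have := H z (rc (1 - s) * z) z1 (ltW wn) dz.
by rewrite E subr0; rewrite -normc_gt0 in fz; lra.
Qed.

Definition lamj (j : nat) t : R := lnmax f (expR (- j%:R)) t.
(* As [ln 0 = 0], [lam] is meaningless at the zeros of [f]; they form a null set. *)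
Definition lam t : R := ln (normc (f (cis t))).

Lemma logmaxE (j : nat) x : 0 < x -> logmax (expR (- j%:R)) x = Num.max (ln x) (- j%:R).
Proof.
move=> x0; rewrite /logmax /Num.max.
have E : (x < expR (- j%:R)) = (ln x < - j%:R) by rewrite -[RHS]ltr_expR lnK ?posrE.
by rewrite E; case: ltP; rewrite ?expRK.
Qed.

Lemma logmax0 (j : nat) : logmax (expR (- j%:R)) 0 = - j%:R :> R.
Proof. by rewrite /logmax max_r ?expR_ge0 // expRK. Qed.

Lemma iga_lamj j : iga (lamj j).
Proof. by apply: (iga_lnmax alpha_gt0 lipf); exact: expR_gt0. Qed.

(** Subharmonicity at one point z with f z != 0 bounds the Poisson means of all truncations below by
    ln|f z|. The Poisson kernel at z is at least p0 > 0, which transfers the bound to plain means of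
    the nonnegative L - lamj. *)
Lemma lamj_avg_bound : exists L c : R, [/\ (forall j t, lamj j t <= L) &
  (forall j, avg (fun t => L - lamj j t) <= c)].
Proof.
have [B B0 fB] := lip_bounded alpha_gt0 lipf.
have [z z1 fz] := ex_disc_neq0.
pose L := ln (Num.max B 1).
have m0 : 0 < Num.max B 1 by rewrite lt_max ltr01 orbT.
have LB j t : lamj j t <= L.
  rewrite ler_ln ?posrE ?max_gt0 ?expR_gt0 // ge_max !le_max fB ?normc_cis //=.
  have -> : expR (- j%:R) <= 1 :> R by rewrite -[leRHS]expR0 ler_expR oppr_le0 ler0n.
  by rewrite orbT.
pose p0 : R := (1 - normc z ^+ 2) / 4.
have p00 : 0 < p0 by rewrite divr_gt0 //; have := one_sub_sqr z1; lra.
have Pp t : p0 <= poisson z t.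
  apply: ler_wpM2l; first by have := one_sub_sqr z1; lra.
  rewrite lef_pV2 ?posrE ?exprn_gt0 ?dist_cis_gt0 //.
  have := normc_sub (cis t) z; rewrite normc_cis; have := normc_ge0 (cis t - z).
  by nra.
exists L, ((L - ln (normc (f z))) / p0); split => // j.
rewrite ler_pdivlMr // mulrC.
have iL : iga (fun t => L - lamj j t) by apply: igB; [exact: ig_cst|exact: iga_lamj].
have iP := iga_poisson z1 iL.
rewrite -avgZ //; apply: (@le_trans _ _ (avg (fun t => poisson z t * (L - lamj j t)))).
  apply: avg_le => //; first exact: igZ.
  by move=> t; rewrite ler_wpM2r ?subr_ge0.
have i1 : iga (fun t => poisson z t * L) by apply: iga_poisson => //; exact: ig_cst.
have i2 : iga (fun t => poisson z t * lamj j t) by apply: iga_poisson => //; exact: iga_lamj.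
rewrite (avg_ext (h := fun t => poisson z t * L - poisson z t * lamj j t)); last first.
  by move=> t; rewrite mulrBr.
rewrite avgB // avg_poissonZ // lerD2l lerN2.
by apply: (subharmonic alpha_gt0 alpha_le lipf) => //; exact: expR_gt0.
Qed.

Lemma rcts_normf : rcts (fun t => normc (f (cis t))).
Proof. by move=> t; apply: rcont_normc; exact: lip_rcont alpha_gt0 lipf t. Qed.

Lemma measurable_lam : measurable_fun [set: R] lam.
Proof.
apply: (@measurableT_comp _ _ _ _ _ _ (@ln R)); first exact: measurable_realfun.measurable_ln.
by apply: measurable_realfun.continuous_measurable_fun; exact: rcts_normf.
Qed.

Lemma lamj_nd (L : R) t m n : (m <= n)%N -> ((L - lamj m t)%:E <= (L - lamj n t)%:E)%E.
Proof.
move=> mn; rewrite lee_fin lerD2l lerN2 ler_ln ?posrE ?max_gt0 ?expR_gt0 //.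
by rewrite ge_max !le_max lexx /= ler_expR lerN2 ler_nat mn orbT.
Qed.

(** [Psi] is the true increasing limit, infinite at the zeros of [f], where [lam] is 0 by
    convention. The infinite values are what will show that the zeros form a null set. *)
Lemma lam_psi (L : R) : exists Psi : R -> \bar R,
  (forall t, (fun j => (L - lamj j t)%:E) @ \oo --> Psi t) /\
  forall t, (f (cis t) = 0 -> Psi t = +oo%E) /\
    (f (cis t) != 0 -> Psi t = (L - lam t)%:E).
Proof.
pose Psi t : \bar R := limn (fun j => (L - lamj j t)%:E).
exists Psi; split=> [t|t].
  by apply: ereal_nondecreasing_is_cvgn => m n; exact: lamj_nd.
split=> fz.
  apply/cvg_lim => //; apply/cvgeryP/cvgryPge => A.
  near=> n; rewrite /lamj /lnmax fz normcr0 logmax0 opprK.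
  have : A - L <= n%:R by near: n; exact: nbhs_infty_ger.
  lra.
apply/cvg_lim => //; apply: cvg_near_cst; near=> n.
congr (_%:E); congr (L - _); rewrite /lamj /lnmax logmaxE ?normc_gt0 //.
rewrite max_l //; have : - lam t <= n%:R by near: n; exact: nbhs_infty_ger.
by rewrite /lam; lra.
Unshelve. all: end_near. Qed.

(** Monotone convergence makes [Psi] integrable, hence finite almost everywhere, which excludes
    zeros; and |lam| <= Psi + |L| everywhere. *)
Lemma iga_lam_ae : iga lam /\ {ae mu, forall t, `[0, pi2]%classic t -> f (cis t) != 0}.
Proof.
have [L [c [lamL avgc]]] := lamj_avg_bound.
have [Psi [cvP PsiP]] := lam_psi L.
have iL j : iga (fun t => L - lamj j t) by apply: igB; [exact: ig_cst|exact: iga_lamj].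
have mL j := measurable_int _ (iL j).
have mPsi : measurable_fun `[0, pi2]%classic Psi.
  apply: (emeasurable_fun_cvg _ _ mL) => t _; exact: cvP.
have L0 j t : (0 <= (L - lamj j t)%:E)%E by rewrite lee_fin subr_ge0.
have Psi0 t : (0 <= Psi t)%E.
  by rewrite -(cvg_lim _ (cvP t)) //; apply: lime_ge; [apply/cvg_ex; exists (Psi t)|exact: nearW].
have iPsi : mu.-integrable `[0, pi2]%classic Psi.
  apply/integrableP; split => //.
  under eq_integral do rewrite gee0_abs //.
  have nd t : `[0, pi2]%classic t -> {homo (fun j => (L - lamj j t)%:E) : m n / (m <= n)%N >-> (m <= n)%E}.
    by move=> _ m n; exact: lamj_nd.
  have M := cvg_monotone_convergence (mu := mu) (measurable_itv `[0, pi2]) mL (fun n t _ => L0 n t) nd.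
  have EI : (\int[mu]_(x in `[0%R, pi2%R]) Psi x)%E =
      (\int[mu]_(x in `[0%R, pi2%R]) limn (fun j => (L - lamj j x)%:E))%E.
    by apply: eq_integral => t _; rewrite (cvg_lim _ (cvP t)).
  rewrite EI.
  rewrite -(cvg_lim _ M) //.
  apply: (@le_lt_trans _ _ (pi2 * c)%:E); last exact: ltry.
  apply: lime_le; first by apply/cvg_ex; eexists; exact: M.
  apply: nearW => j; rewrite /comp (integral_rint (iL j)) lee_fin.
  by have := avgc j; rewrite /avg -ler_pdivlMl ?pi2V_gt0 // invrK.
split; last first.
  have := integrable_ae (mu := mu) (measurable_itv _) iPsi.
  apply: (@filterS _ _ (ae_filter_ringOfSetsType mu)) => t H Dt.
  apply/eqP => fz; have [PsiT _] := PsiP t.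
  by have := H Dt; rewrite (PsiT fz).
have iP2 := integrableD (mu := mu) (measurable_itv _) iPsi (ig_cst 0 pi2 `|L|).
apply: le_integrable iP2 => //.
  by apply/measurable_EFinP; exact: measurable_funTS measurable_lam.
move=> t _; have [P1 P2] := PsiP t.
have [fz|fz] := eqVneq (f (cis t)) 0.
  by rewrite /= P1 // /lam fz normcr0 ln0 // normr0 abse_ge0.
rewrite /= (P2 fz) -EFinD /= lee_fin.
have h : 0 <= L - lam t by have := Psi0 t; rewrite (P2 fz) lee_fin.
rewrite [leRHS]ger0_norm; last by rewrite addr_ge0.
have -> : lam t = L - (L - lam t) by ring.
by rewrite (le_trans (ler_normB _ _)) // (ger0_norm h) addrC; lra.
Qed.

Lemma iga_lam : iga lam. Proof. by case: iga_lam_ae. Qed.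

Lemma lamj_cvg : avg (fun t => `|lamj j t - lam t|) @[j --> \oo] --> 0.
Proof.
have [il ae] := iga_lam_ae.
apply: (avg_dct (h := fun t => `|lam t|)) => //; first exact: iga_lamj.
- exact: ig_abs.
- apply: (@filterS _ _ (ae_filter_ringOfSetsType mu) _ _ _ ae) => t H Dt.
  have fz := H Dt; apply: cvg_near_cst; near=> n.
  rewrite /lamj /lnmax logmaxE ?normc_gt0 //.
  rewrite max_l //; have : - lam t <= n%:R by near: n; exact: nbhs_infty_ger.
  by rewrite /lam; lra.
- apply: (@filterS _ _ (ae_filter_ringOfSetsType mu) _ _ _ ae) => t H n Dt.
  have fz := H Dt; rewrite /lamj /lnmax logmaxE ?normc_gt0 // -/(lam t).
  (* If the truncation is active then lam t < -n, so |lamj n t| = n <= |lam t|. *)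
  rewrite /Num.max; case: ltP => // h; rewrite ler_norml; have := ler0n R n.
  have := ler_norm (- lam t); rewrite normrN; have := normr_ge0 (lam t).
  by lra.
Unshelve. all: end_near. Qed.

Lemma lamj_approx d : 0 < d -> exists j : nat,
  [/\ avg (fun t => `|lamj j t - lam t|) <= d, expR (- j%:R) <= d :> R & 1 <= j%:R * d].
Proof.
move=> d0; near \oo => j.
have jd : d^-1 + 1 <= j%:R by near: j; exact: nbhs_infty_ger.
have di : 0 < d^-1 by rewrite invr_gt0.
have j0 : 0 < j%:R :> R by lra.
have jd1 : 1 <= j%:R * d by rewrite -ler_pdivrMr // div1r; lra.
exists j; split => //.
  near: j; have /cvgrPdist_le/(_ _ d0) := lamj_cvg; apply: filterS => j.
  by rewrite sub0r normrN ger0_norm // avg_ge0.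
rewrite expRN invf_ple ?posrE ?expR_gt0 //.
by have := @expR_ge1Dx R j%:R; lra.
Unshelve. all: end_near. Qed.

Lemma avg_poisson_le z (g : R -> R) : normc z < 1 -> iga g -> (forall t, 0 <= g t) ->
  avg (fun t => poisson z t * g t) <= 2 / (1 - normc z) * avg g.
Proof.
move=> z1 ig g0; rewrite -avgZ //; apply: avg_le; [exact: iga_poisson|exact: igZ|].
by move=> t; rewrite ler_wpM2r // poisson_le_cst.
Qed.

(** The limit of [lnmax_osc] along e = e^-j: once e^-j <= |f z| the truncation is invisible at z,
    and the Poisson kernel at z is bounded, so mean convergence of [lamj] suffices. *)
Lemma lam_osc z : normc z < 1 -> f z != 0 ->
  avg (fun t => poisson z t * `|lam t - ln (normc (f z))|) <= 2 * omega f z / normc (f z).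
Proof.
move=> z1 fz; have nz : 0 < normc (f z) by rewrite normc_gt0.
apply/ler_addgt0Pr => d d0; have del : 0 < 1 - normc z by lra.
have d1 : 0 < Num.min (d * (1 - normc z) / 2) (normc (f z)).
  by rewrite lt_min nz divr_gt0 // mulr_gt0.
have [j [j1 j2 _]] := lamj_approx d1.
move: j1 j2; rewrite !le_min => /andP[j1 _] /andP[_ j2].
have E : Num.max (normc (f z)) (expR (- j%:R)) = normc (f z) by rewrite max_l.
have := lnmax_osc alpha_gt0 alpha_le lipf (expR_gt0 (- j%:R)) z1.
rewrite E /logmax E => h.
have i1 := igB iga_lam (ig_cst 0 pi2 (ln (normc (f z)))).
have i2 := igB (iga_lamj j) (ig_cst 0 pi2 (ln (normc (f z)))).
have i3 := igB (iga_lamj j) iga_lam.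
have p1 := iga_poisson z1 (ig_abs i2); have p2 := iga_poisson z1 (ig_abs i3).
apply: (@le_trans _ _ (avg (fun t => poisson z t * `|lamj j t - ln (normc (f z))| +
    poisson z t * `|lamj j t - lam t|))).
  apply: avg_le; [exact: iga_poisson z1 (ig_abs i1)|exact: igD|].
  move=> t; rewrite -mulrDr ler_wpM2l ?(ltW (poisson_gt0 t z1)) //.
  have := ler_distD (lamj j t) (lam t) (ln (normc (f z))).
  by rewrite (distrC (lam t) (lamj j t)) [leRHS]addrC.
rewrite avgD // lerD //.
rewrite (le_trans (avg_poisson_le z1 (ig_abs i3) _)) //.
have -> : d = 2 / (1 - normc z) * (d * (1 - normc z) / 2) by field; rewrite gt_eqF.
by rewrite ler_wpM2l // divr_ge0 // ltW.
Qed.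

(** Jensen's inequality through the tangent of ln at c, with |f (cis t)| <= |f z| + |f (cis t) - f
    z|, whose Poisson mean is |f z| + omega. The free c allows points where this sum is 0. *)
Lemma lam_jensen z c : normc z < 1 -> 0 < c ->
  avg (fun t => poisson z t * lam t) <= ln c + (normc (f z) + omega f z - c) / c.
Proof.
move=> z1 c0; apply/ler_addgt0Pr => d d0; have del : 0 < 1 - normc z by lra.
have d1 : 0 < Num.min (d * (1 - normc z) / 4) (d * c / 2).
  by rewrite lt_min !divr_gt0 // mulr_gt0.
have [j [j1 j2 _]] := lamj_approx d1.
move: j1 j2; rewrite !le_min => /andP[j1 _] /andP[_ j2].
have i3 := igB (iga_lamj j) iga_lam.
have p1 := iga_poisson z1 (iga_lamj j); have p2 := iga_poisson z1 (ig_abs i3).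
have io := iga_osc alpha_gt0 lipf z1.
pose k := ln c + (normc (f z) + expR (- j%:R) - c) / c.
have ik : iga (fun t => poisson z t * k) by apply: iga_poisson => //; exact: ig_cst.
have A : avg (fun t => poisson z t * lamj j t) <= k + c^-1 * omega f z.
  rewrite /omega -{1}(avg_poissonZ k z1) -avgZ // -avgD //; last exact: igZ.
  apply: avg_le => //; first by apply: igD => //; exact: igZ.
  move=> t; rewrite mulrCA -mulrDr ler_wpM2l ?(ltW (poisson_gt0 t z1)) //.
  have h := ln_sub_le (max_gt0 (normc (f (cis t))) (expR_gt0 (- j%:R))) c0.
  have : Num.max (normc (f (cis t))) (expR (- j%:R)) <=
      normc (f z) + expR (- j%:R) + normc (f (cis t) - f z).
    have := normc_sub_ge (f (cis t)) (f z); have := expR_ge0 (- j%:R : R).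
    have := normc_ge0 (f z); have := normc_ge0 (f (cis t) - f z).
    by rewrite /Num.max; case: ltP => _; lra.
  move=> h2; rewrite /lamj /lnmax /logmax /k.
  have ci : 0 < c^-1 by rewrite invr_gt0.
  have -> : ln c + (normc (f z) + expR (- j%:R) - c) / c + c^-1 * normc (f (cis t) - f z) =
      ln c + (normc (f z) + expR (- j%:R) + normc (f (cis t) - f z) - c) / c by ring.
  rewrite -lerBlDl (le_trans h) // ler_wpM2r ?(ltW ci) //.
  by rewrite lerD2r.
have B : avg (fun t => poisson z t * lam t) <=
    avg (fun t => poisson z t * lamj j t) + d / 2.
  apply: (@le_trans _ _ (avg (fun t => poisson z t * lamj j t + poisson z t * `|lamj j t - lam t|))).
    apply: avg_le; [exact: iga_poisson z1 iga_lam|exact: igD|].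
    move=> t; rewrite -mulrDr ler_wpM2l ?(ltW (poisson_gt0 t z1)) //.
    by have := ler_norm (- (lamj j t - lam t)); rewrite normrN; lra.
  rewrite avgD // lerD2l (le_trans (avg_poisson_le z1 (ig_abs i3) _)) //.
  have -> : d / 2 = 2 / (1 - normc z) * (d * (1 - normc z) / 4) by field; rewrite gt_eqF.
  by rewrite ler_wpM2l // divr_ge0 // ltW.
have D : expR (- j%:R) / c <= d / 2 by rewrite ler_pdivrMr // mulrAC.
rewrite (le_trans B) // (le_trans (lerD A (lexx _))) //.
have -> : k + c^-1 * omega f z = ln c + (normc (f z) + omega f z - c) / c + expR (- j%:R) / c.
  by rewrite /k; ring.
lra.
Qed.

End LogIntegrable.

(** * The Hardy-Littlewood lemma *)

Section HardyLittlewood.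
Context {R : realType}.
Local Notation C := (Cplx R).
Local Notation Re := (@complex.Re R).
Implicit Types (z w : C) (t x y r d e : R).

Lemma is_derive_from_near (g : R -> R) x (L : R) :
  (forall eps : R, 0 < eps ->
    \forall y \near x, `|g y - g x - L * (y - x)| <= eps * `|y - x|) ->
  is_derive x 1 g L.
Proof.
move=> H.
have cv : h^-1 *: ((g \o shift x) (h *: (1 : R)) - g x) @[h --> (0 : R)^'] --> L.
  apply/cvgrPdist_le => e e0; have /nbhs_ballP[d /= d0 {}H] := H e e0.
  apply/nbhs_ballP; exists d => // h; rewrite -ball_normE /= sub0r normrN => hd h0.
  have := H (h + x); rewrite -ball_normE /= addrK (_ : x - (h + x) = - h); last by ring.
  rewrite normrN.
  move=> /(_ hd); rewrite /shift /= /GRing.scale /= mulr1 => K.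
  rewrite -ler_pdivrMr ?normr_gt0 // in K; rewrite (le_trans _ K) // -normf_div.
  rewrite -normrN le_eqVlt; apply/orP; left; apply/eqP; congr (`|_|).
  by field.
constructor; first by apply/cvg_ex; exists L.
by apply/cvg_lim.
Qed.

Lemma cdiff_Re (Q : C -> C) t L : cdiff Q (rc t) L ->
  is_derive t 1 (fun t => Re (Q (rc t))) (Re L).
Proof.
move=> H; apply: is_derive_from_near => e e0.
have /nbhs_normcP[d d0 {}H] := H e e0.
apply/nbhs_ballP; exists d => // s; rewrite -ball_normE /= => sd.
have E : rc s - rc t = rc (s - t) by rewrite rcD rcN.
have := H (rc s); rewrite E normc_rc distrC => /(_ sd); apply: le_trans.
have -> : Re (Q (rc s)) - Re (Q (rc t)) - Re L * (s - t) = Re (Q (rc s) - Q (rc t) - L * rc (s - t)).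
  by rewrite !ReImE /= mulr0 subr0.
exact: Re_le_normc.
Qed.

(** A unimodular factor turning w into its modulus; it reduces a bound on a complex increment to the
    monotonicity of a real function. *)
Definition cunit (w : C) : C := if w == 0 then 1 else (rc (normc w)) / w.

Lemma cunitP w : normc (cunit w) = 1 /\ Re (cunit w * w) = normc w.
Proof.
rewrite /cunit; case: eqP => [->|/eqP w0].
  by rewrite normcr1 normcr0 mul1r.
rewrite divfK // normc_div normc_rc ger0_norm ?normc_ge0 // divff //.
by rewrite normc_eq0.
Qed.

(** The fractions x / (x + y) and y / (x + y) sum to 1 and lie below their powers of exponent a <=
    1. *)
Lemma powR_subadd x y (a : R) : 0 < a <= 1 -> 0 <= x -> 0 <= y ->
  (x + y) `^ a <= x `^ a + y `^ a.
Proof.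
move=> /andP[a0 a1]; rewrite le_eqVlt => /predU1P[<- _|x0].
  by rewrite add0r powR0 ?gt_eqF // add0r.
rewrite le_eqVlt => /predU1P[<-|y0]; first by rewrite addr0 powR0 ?gt_eqF // addr0.
have s0 : 0 < x + y by lra.
have K u : 0 < u -> u <= x + y -> u / (x + y) * (x + y) `^ a <= u `^ a.
  move=> u0 us; have q0 : 0 < u / (x + y) by rewrite divr_gt0.
  have -> : u `^ a = (u / (x + y)) `^ a * (x + y) `^ a.
    by rewrite -powRM ?divfK ?gt_eqF ?(ltW q0) ?(ltW s0).
  rewrite ler_wpM2r ?powR_ge0 // ger1_powR // q0 ler_pdivrMr // mul1r //.
have k1 : x <= x + y by lra.
have k2 : y <= x + y by lra.
have := K x x0 k1; have := K y y0 k2.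
have : (x + y) `^ a = x / (x + y) * (x + y) `^ a + y / (x + y) * (x + y) `^ a.
  by rewrite -mulrDl -mulrDl divff ?mul1r // gt_eqF.
lra.
Qed.

Lemma powR_sub1_anti (a x y : R) : a <= 1 -> 0 < x -> x <= y -> y `^ (a - 1) <= x `^ (a - 1).
Proof.
move=> a1 x0 xy; have y0 : 0 < y by lra.
rewrite -(opprB 1 a) !powRN lef_pV2 ?posrE ?powR_gt0 //.
by apply: le_powR; lra.
Qed.

Variables (alpha : R) (F F' : C -> C) (S K : R).
Hypotheses (alpha_gt0 : 0 < alpha) (alpha_le : alpha <= 1).
Hypothesis dF : forall z, normc z < 1 -> cdiff F z (F' z).
Hypotheses (S0 : 0 <= S) (K0 : 0 <= K).
Hypothesis F'_le : forall z, normc z < 1 -> normc (F' z) <= S * (1 - normc z) `^ (alpha - 1) + K.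

Lemma line_derive (A B u : C) t : normc (A + rc t * B) < 1 ->
  is_derive t 1 (fun t => Re (u * F (A + rc t * B))) (Re (u * (F' (A + rc t * B) * B))).
Proof.
move=> h; apply: (@cdiff_Re (fun w => u * F (A + w * B))).
apply: cdiffZ; apply: (cdiff_comp (f := fun w => A + w * B)); last exact: dF.
have D1 := cdiffD (cdiff_cst A (rc t)) (cdiffM (cdiff_id (rc t)) (cdiff_cst B (rc t))).
by move: D1; rewrite mul1r mulr0 addr0 add0r.
Qed.

Lemma Re_mul_le (u v : C) : normc u = 1 -> Re (u * v) <= normc v.
Proof.
move=> u1; rewrite (le_trans (ler_norm _)) // (le_trans (Re_le_normc _)) //.
by rewrite normc_mul u1 mul1r.
Qed.

Lemma rder_within (g g' : R -> R) a b :
  (forall x, a <= x <= b -> is_derive x 1 g (g' x)) -> {within `[a, b], continuous g}.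
Proof.
move=> dg; apply: cts_within => x /dg[d _].
by apply: differentiable_continuous; exact/derivable1_diffP.
Qed.

Lemma mono_le (g g' : R -> R) a b : a <= b ->
  (forall x, a <= x <= b -> is_derive x 1 g (g' x)) ->
  (forall x, a <= x <= b -> g' x <= 0) -> g b <= g a.
Proof.
move=> ab dg g'0.
have [|c cab E] := MVT_segment ab (f := g) (df := g') _ (rder_within dg).
  by move=> x; rewrite in_itv /= => /andP[/ltW ? /ltW ?]; apply: dg; apply/andP.
rewrite -subr_le0 E; move: cab; rewrite in_itv /= => /g'0 h.
by rewrite mulr_le0_ge0 // subr_ge0.
Qed.

(** The derivative bound is integrated along the radius. The singular part S (1 - t|z|)^(alpha - 1)
    has the primitive -(S / alpha) (1 - t|z|)^alpha up to the factor |z|, so subtracting primitives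
    of the bound from the rotated real part gives a nonincreasing function [m]. *)
Lemma radial_le z a : normc z < 1 -> 0 <= a <= 1 ->
  normc (F z - F (rc (1 - a) * z)) <= S / alpha * a `^ alpha + K * a.
Proof.
move=> z1 /andP[a0 a1]; have nz0 := normc_ge0 z.
set v := F z - _; have [u1 uv] := cunitP v; rewrite -uv; set u := cunit v in u1 *.
pose q t : R := 1 - t * normc z.
have qp t : t <= 1 -> 0 < q t by move=> t1; rewrite /q; nra.
pose m t := Re (u * F (0 + rc t * z)) + S / alpha * (q t) `^ alpha - K * t.
pose m' t := Re (u * (F' (0 + rc t * z) * z)) + S / alpha * (alpha * (q t) `^ (alpha - 1) * (- normc z)) - K.
have nt t : 0 <= t -> normc (0 + rc t * z) = t * normc z.
  by move=> t0; rewrite add0r normc_mul normc_rc ger0_norm.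
have dm t : 1 - a <= t <= 1 -> is_derive t 1 m (m' t).
  move=> /andP[t0 t1].
  have d1 : is_derive t 1 (fun t => Re (u * F (0 + rc t * z))) (Re (u * (F' (0 + rc t * z) * z))).
    by apply: line_derive; rewrite nt; [nra|lra].
  have dq : is_derive t 1 q (- normc z).
    apply: is_derive_eq (rderB (rder_cst 1 t) (rderM (rder_id t) (rder_cst (normc z) t))) _.
    by ring.
  have d2 := rder_comp (g := q) (is_derive1_powR alpha (qp t t1)) dq.
  have d3 := rderM (rder_cst (S / alpha) t) d2.
  have d4 := rderM (rder_cst K t) (rder_id t).
  apply: is_derive_eq (rderB (rderD d1 d3) d4) _.
  by rewrite /m'; ring.
have m'0 t : 1 - a <= t <= 1 -> m' t <= 0.
  move=> /andP[t0 t1]; have t00 : 0 <= t by lra.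
  have h1 : Re (u * (F' (0 + rc t * z) * z)) <= (S * (q t) `^ (alpha - 1) + K) * normc z.
    rewrite (le_trans (Re_mul_le _ u1)) // normc_mul ler_wpM2r //.
    by have := F'_le (z := 0 + rc t * z); rewrite nt //; apply; nra.
  have -> : m' t = Re (u * (F' (0 + rc t * z) * z)) - (S * (q t) `^ (alpha - 1)) * normc z - K.
    by rewrite /m'; field; rewrite gt_eqF.
  have : K * normc z <= K by rewrite ler_piMr // ltW.
  by rewrite mulrDl in h1; lra.
have := mono_le (a := 1 - a) (b := 1) _ dm m'0; rewrite /m !add0r.
have -> : rc 1 * z = z by exact: mul1r.
move=> /(_ _) h; have {}h := h ltac:(lra).
have -> : Re (u * v) = Re (u * F z) - Re (u * F (rc (1 - a) * z)).
  by rewrite /v mulrBr !ReImE.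
have q1 : q 1 = 1 - normc z by rewrite /q mul1r.
have qa : q (1 - a) = q 1 + a * normc z by rewrite /q; ring.
have sub : (q (1 - a)) `^ alpha <= (q 1) `^ alpha + (a * normc z) `^ alpha.
  rewrite qa; apply: powR_subadd; [by rewrite alpha_gt0|by apply: ltW; apply: qp|exact: mulr_ge0].
have an : (a * normc z) `^ alpha <= a `^ alpha.
  by apply: le_powR; [exact: ltW|exact: mulr_ge0|nra].
have Sa : 0 <= S / alpha by rewrite divr_ge0 // ltW.
have := ler_wpM2l Sa sub; have := ler_wpM2l Sa an; rewrite mulrDr.
have : K * (1 - (1 - a)) = K * a by ring.
lra.
Qed.

Lemma segment_le z w q : (forall t, 0 <= t <= 1 -> normc (w + rc t * (z - w)) < 1 /\
    normc (F' (w + rc t * (z - w))) <= q) -> normc (F z - F w) <= q * normc (z - w).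
Proof.
move=> H; set v := F z - _; have [u1 uv] := cunitP v; rewrite -uv; set u := cunit v in u1 *.
pose m t := Re (u * F (w + rc t * (z - w))) - q * normc (z - w) * t.
pose m' t := Re (u * (F' (w + rc t * (z - w)) * (z - w))) - q * normc (z - w).
have dm t : 0 <= t <= 1 -> is_derive t 1 m (m' t).
  move=> tP; have [h1 h2] := H t tP.
  have d1 := line_derive u h1.
  have d4 := rderM (rder_cst (q * normc (z - w)) t) (rder_id t).
  apply: is_derive_eq (rderB d1 d4) _.
  by rewrite /m'; ring.
have m'0 t : 0 <= t <= 1 -> m' t <= 0.
  move=> tP; have [h1 h2] := H t tP.
  by rewrite subr_le0 (le_trans (Re_mul_le _ u1)) // normc_mul ler_wpM2r ?normc_ge0.
have := mono_le (a := 0) (b := 1) ler01 dm m'0; rewrite /m !mulr0 mulr1 subr0.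
have -> : w + rc 1 * (z - w) = z by rewrite (_ : rc 1 * (z - w) = z - w) ?subrKC //; exact: mul1r.
have -> : w + rc 0 * (z - w) = w.
  by rewrite (_ : rc 0 = 0) // mul0r addr0.
have -> : Re (u * v) = Re (u * F z) - Re (u * F w) by rewrite /v mulrBr !ReImE.
lra.
Qed.

(** With d = |z - w|, go inward from both points by the factor 1 - d and across at depth at least d,
    where the derivative is at most S d^(alpha - 1) + K. The two radial legs give 2 / alpha, the
    crossing gives 1, and the three legs give 3 K. The constants are explicit because S will be
    taken small. *)
Lemma hardy_littlewood z w : normc z < 1 -> normc w < 1 -> normc (z - w) <= 1 ->
  normc (F z - F w) <= (2 / alpha + 1) * S * normc (z - w) `^ alpha + 3 * K * normc (z - w).
Proof.
move=> z1 w1; set d := normc (z - w) => d1.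
have [d0|d0] := eqVneq d 0.
  have : z - w = 0 by apply/eqP; rewrite -normc_eq0 -/d d0.
  move=> /eqP; rewrite subr_eq0 => /eqP ->; rewrite subrr normcr0 addr_ge0 ?mulr_ge0 ?powR_ge0 //.
  - by rewrite addr_ge0 // divr_ge0 // ltW.
  - exact: normc_ge0.
have {}d0 : 0 < d by rewrite lt_def d0 normc_ge0.
have dP : 0 <= d <= 1 by rewrite ltW.
have hz := radial_le z1 dP; have hw := radial_le w1 dP.
set z' := rc (1 - d) * z in hz; set w' := rc (1 - d) * w in hw.
have zw' : z' - w' = rc (1 - d) * (z - w) by rewrite /z' /w' mulrBr.
have hm : normc (F z' - F w') <= (S * d `^ (alpha - 1) + K) * normc (z' - w').
  apply: segment_le => t /andP[t0 t1].
  have -> : w' + rc t * (z' - w') = rc (1 - d) * (rc (1 - t) * w + rc t * z).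
    by rewrite /z' /w'; apply: complex_eq; rewrite !ReImE /=; ring.
  have n1 : normc (rc (1 - t) * w + rc t * z) <= 1.
    rewrite (le_trans (normc_add _ _)) // !normc_mul !normc_rc !ger0_norm //; last by lra.
    by nra.
  have n2 : normc (rc (1 - d) * (rc (1 - t) * w + rc t * z)) <= 1 - d.
    by rewrite normc_mul normc_rc ger0_norm; [nra|lra].
  split; first by rewrite (le_lt_trans n2) //; lra.
  rewrite (le_trans (F'_le _)) //; first by rewrite (le_lt_trans n2) //; lra.
  rewrite lerD2r ler_wpM2l // powR_sub1_anti //; lra.
have nzw' : normc (z' - w') <= d.
  by rewrite zw' normc_mul normc_rc ger0_norm -/d; [nra|lra].
have P0 : 0 <= S * d `^ (alpha - 1) + K by rewrite addr_ge0 // mulr_ge0 // powR_ge0.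
have hm2 := le_trans hm (ler_wpM2l P0 nzw').
have E : (S * d `^ (alpha - 1) + K) * d = S * d `^ alpha + K * d.
  by rewrite powR_subr // mulrDl; congr (_ + _); rewrite -mulrA divfK // gt_eqF.
rewrite E in hm2.
have T : normc (F z - F w) <= normc (F z - F z') + (normc (F z' - F w') + normc (F w - F w')).
  rewrite (le_trans (normc_tri _ (F z') _)) // lerD2l (le_trans (normc_tri _ (F w') _)) //.
  by rewrite (normc_distC (F w)).
rewrite (le_trans T) //.
have -> : (2 / alpha + 1) * S * d `^ alpha + 3 * K * d =
  (S / alpha * d `^ alpha + K * d) + ((S * d `^ alpha + K * d) + (S / alpha * d `^ alpha + K * d)).
  by ring.
by rewrite lerD // lerD.
Qed.

End HardyLittlewood.

(** * Continuous extension to the closed disc *)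

Section Extension.
Context {R : realType}.
Local Notation C := (Cplx R).
Local Notation Re := (@complex.Re R).
Local Notation Im := (@complex.Im R).
Implicit Types (z w : C) (t x y r d e : R) (j : nat).
Variables (alpha : R) (F F' : C -> C).
Hypotheses (alpha_gt0 : 0 < alpha) (alpha_le : alpha <= 2^-1).
Hypothesis dF : forall z, normc z < 1 -> cdiff F z (F' z).
Hypothesis F'_o : little_o alpha (fun z => normc (F' z)).

Lemma half_lt1 : 2^-1 < 1 :> R. Proof. by rewrite invf_lt1 ?ltr1n. Qed.

Lemma alpha_lt1 : alpha < 1. Proof. exact: le_lt_trans alpha_le half_lt1. Qed.

(** The Hardy-Littlewood lemma with S = e / (2 c) uses half of e. The remaining 3 K |z - w| carries
    the spare factor |z - w|^(1 - alpha), small for close points since alpha < 1. *)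
Lemma disc_lip e : 0 < e -> exists d : R, [/\ 0 < d, d <= 1 & forall z w, normc z < 1 -> normc w < 1 ->
  normc (z - w) < d -> normc (F z - F w) <= e * normc (z - w) `^ alpha].
Proof.
move=> e0; pose c : R := 2 / alpha + 1.
have c0 : 0 < c by rewrite addr_gt0 // divr_gt0.
have e1 : 0 < e / (2 * c) by rewrite divr_gt0 // mulr_gt0.
have [K K0 H] := F'_o e1.
have k1 : 0 < 3 * K + 1 by lra.
have b0 : 0 < 1 - alpha by rewrite subr_gt0 alpha_lt1.
pose q : R := e / 2 / (3 * K + 1).
have q0 : 0 < q by rewrite !divr_gt0.
exists (Num.min 1 (q `^ ((1 - alpha)^-1))); split.
- by rewrite lt_min ltr01 powR_gt0.
- by rewrite ge_min lexx.
move=> z w z1 w1; set x := normc (z - w) => h; move: (h); rewrite lt_min => /andP[x1 xq].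
have x0 : 0 <= x by exact: normc_ge0.
have al1 : alpha <= 1 by exact: ltW alpha_lt1.
rewrite (le_trans (hardy_littlewood alpha_gt0 al1 dF (ltW e1) K0 H z1 w1 (ltW x1))) // -/x -/c.
have -> : c * (e / (2 * c)) = e / 2 by field; rewrite gt_eqF.
suff : 3 * K * x <= e / 2 * x `^ alpha by lra.
have xe : x `^ (1 - alpha) <= q.
  by rewrite -[leRHS](powR_alpha_inj b0) ?(ltW q0) // le_powR ?(ltW b0) ?(ltW xq).
have -> : 3 * K * x = 3 * K * (x `^ (1 - alpha) * x `^ alpha).
  rewrite -powRD; last by rewrite (_ : 1 - alpha + alpha = 1); [rewrite oner_eq0|ring].
  by rewrite (_ : 1 - alpha + alpha = 1) ?powRr1 //; ring.
have p1 := powR_ge0 x (1 - alpha); have p2 := powR_ge0 x alpha.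
apply: (@le_trans _ _ ((3 * K + 1) * (q * x `^ alpha))).
  by apply: ler_pM; rewrite ?mulr_ge0 // ?ler_wpM2r //; lra.
by rewrite mulrA /q [X in X * _]mulrC divfK // gt_eqF.
Qed.

Lemma disc_unif e : 0 < e -> exists2 d : R, 0 < d & forall z w, normc z < 1 -> normc w < 1 ->
  normc (z - w) < d -> normc (F z - F w) <= e.
Proof.
move=> e0; have [d [d0 d1 H]] := disc_lip e0; exists d => // z w z1 w1 zw.
rewrite (le_trans (H _ _ z1 w1 zw)) // ler_piMr ?(ltW e0) //.
have := @le_powR R (normc (z - w)) 1 alpha; rewrite powR1; apply; [exact: ltW|exact: normc_ge0|].
lra.
Qed.

(** Radii increasing to 1; the shift by 2 keeps the first one positive. *)
Definition radius j : R := 1 - (j.+2%:R)^-1.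

Lemma radiusP j : 0 < radius j < 1.
Proof.
have j0 : 0 < j.+2%:R :> R by rewrite ltr0n.
have : (j.+2%:R)^-1 <= 2^-1 :> R by rewrite lef_pV2 ?posrE // ler_nat.
have : 0 < (j.+2%:R)^-1 :> R by rewrite invr_gt0.
rewrite /radius => h1 h2; by rewrite subr_gt0 (le_lt_trans h2 half_lt1) ltrBlDr ltrDl.
Qed.

Lemma radius_near d : 0 < d -> \forall j \near \oo, 1 - radius j < d.
Proof.
move=> d0; near=> j.
have : d^-1 <= j%:R by near: j; exact: nbhs_infty_ger.
move=> h; rewrite /radius opprB addrCA subrr addr0 invf_plt ?posrE ?ltr0n //.
by rewrite (le_lt_trans h) // ltr_nat ltnS leqW.
Unshelve. all: end_near. Qed.

Lemma radius_disc j z : normc z <= 1 -> normc (rc (radius j) * z) < 1.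
Proof.
move=> z1; have /andP[r0 r1] := radiusP j.
by rewrite normc_mul normc_rc ger0_norm ?(ltW r0) //; have := normc_ge0 z; nra.
Qed.

(** The limit along dilates of z. Dilation maps the closed disc into the open one, so a single
    formula serves interior and boundary points. *)
Definition ext z : C :=
  Complex (limn (fun j => Re (F (rc (radius j) * z)))) (limn (fun j => Im (F (rc (radius j) * z)))).

Lemma radial_cauchy z e : normc z <= 1 -> 0 < e -> exists N : nat,
  \forall j \near \oo, normc (F (rc (radius N) * z) - F (rc (radius j) * z)) <= e.
Proof.
move=> z1 e0; have [d d0 H] := disc_unif e0.
near \oo => N; exists N; near=> j; apply: H; try exact: radius_disc.
rewrite -mulrBl -rcN -rcD normc_mul normc_rc.
have hN : 1 - radius N < d by near: N; exact: radius_near.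
have hj : 1 - radius j < d by near: j; exact: radius_near.
have /andP[a0 a1] := radiusP N; have /andP[b0 b1] := radiusP j.
have : `|radius N - radius j| < d by rewrite ltr_norml; apply/andP; split; lra.
by have := normr_ge0 (radius N - radius j); have := normc_ge0 z; nra.
Unshelve. all: end_near. Qed.

Lemma ext_cvg z e : normc z <= 1 -> 0 < e ->
  \forall j \near \oo, normc (ext z - F (rc (radius j) * z)) <= e.
Proof.
move=> z1 e0; have e2 : 0 < e / 2 by rewrite divr_gt0.
have c1 : cvgn (fun j => Re (F (rc (radius j) * z))).
  apply/cauchy_cvgP/cauchy_exP => d d0; have d2 : 0 < d / 2 by rewrite divr_gt0.
  have [N HN] := radial_cauchy z1 d2; exists (Re (F (rc (radius N) * z))).
  change (\forall j \near \oo, ball (Re (F (rc (radius N) * z))) d (Re (F (rc (radius j) * z)))).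
  apply: filterS HN => j h; rewrite -ball_normE /= -cReN -cReD.
  by rewrite (le_lt_trans (Re_le_normc _)) // (le_lt_trans h) //; lra.
have c2 : cvgn (fun j => Im (F (rc (radius j) * z))).
  apply/cauchy_cvgP/cauchy_exP => d d0; have d2 : 0 < d / 2 by rewrite divr_gt0.
  have [N HN] := radial_cauchy z1 d2; exists (Im (F (rc (radius N) * z))).
  change (\forall j \near \oo, ball (Im (F (rc (radius N) * z))) d (Im (F (rc (radius j) * z)))).
  apply: filterS HN => j h; rewrite -ball_normE /= -cImN -cImD.
  by rewrite (le_lt_trans (Im_le_normc _)) // (le_lt_trans h) //; lra.
near=> j.
have h1 : `|Re (ext z) - Re (F (rc (radius j) * z))| <= e / 2.
  by near: j; apply: cvgr_dist_le e2; exact: c1.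
have h2 : `|Im (ext z) - Im (F (rc (radius j) * z))| <= e / 2.
  by near: j; apply: cvgr_dist_le e2; exact: c2.
by rewrite (le_trans (normc_le_ReIm _)) // !ReImE; lra.
Unshelve. all: end_near. Qed.

Lemma ext_in z : normc z < 1 -> ext z = F z.
Proof.
move=> z1; apply/eqP; rewrite -subr_eq0 -normc_eq0 eq_le normc_ge0 andbT.
apply/ler_addgt0Pr => e e0; rewrite add0r; have e2 : 0 < e / 2 by rewrite divr_gt0.
have [d d0 H] := disc_unif e2.
near \oo => j.
have h1 : normc (ext z - F (rc (radius j) * z)) <= e / 2.
  by near: j; exact: (ext_cvg (ltW z1)).
have h2 : normc (F (rc (radius j) * z) - F z) <= e / 2.
  apply: H => //; first exact: radius_disc (ltW z1).
  have hj : 1 - radius j < d by near: j; exact: radius_near.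
  have /andP[a0 a1] := radiusP j.
  rewrite normc_distC (_ : z - rc (radius j) * z = rc (1 - radius j) * z); last first.
    by apply: complex_eq; rewrite !ReImE /=; ring.
  by rewrite normc_mul normc_rc ger0_norm; have := normc_ge0 z; [nra|lra].
by rewrite (le_trans (normc_tri _ (F (rc (radius j) * z)) _)) //; lra.
Unshelve. all: end_near. Qed.

(** Dilation contracts distances, so the estimate of [disc_lip] passes to the limit with the same
    d. *)
Lemma ext_lip e : 0 < e -> exists2 d : R, 0 < d & forall z w, normc z <= 1 -> normc w <= 1 ->
  normc (z - w) < d -> normc (ext z - ext w) <= e * normc (z - w) `^ alpha.
Proof.
move=> e0; have [d [d0 d1 H]] := disc_lip e0; exists d => // z w z1 w1 zw.
apply/ler_addgt0Pr => b b0; have b2 : 0 < b / 2 by rewrite divr_gt0.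
near \oo => j.
have h1 : normc (ext z - F (rc (radius j) * z)) <= b / 2 by near: j; exact: ext_cvg.
have h2 : normc (ext w - F (rc (radius j) * w)) <= b / 2 by near: j; exact: ext_cvg.
have /andP[a0 a1] := radiusP j.
have n1 : normc (rc (radius j) * z - rc (radius j) * w) <= normc (z - w).
  by rewrite -mulrBr normc_mul normc_rc ger0_norm ?(ltW a0) // ler_piMl ?normc_ge0 // ltW.
have h3 : normc (F (rc (radius j) * z) - F (rc (radius j) * w)) <= e * normc (z - w) `^ alpha.
  apply: (le_trans (H _ _ (radius_disc j z1) (radius_disc j w1) (le_lt_trans n1 zw))).
  apply: ler_wpM2l; first exact: ltW.
  by apply: le_powR => //; [exact: ltW|exact: normc_ge0].
have T := normc_tri (ext z) (F (rc (radius j) * z)) (ext w).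
have T2' := normc_tri (F (rc (radius j) * z)) (F (rc (radius j) * w)) (ext w).
rewrite (normc_distC (F (rc (radius j) * w))) in T2'.
have -> : e * normc (z - w) `^ alpha + b = b / 2 + (e * normc (z - w) `^ alpha + b / 2) by field.
apply: (le_trans T); apply: lerD => //; apply: (le_trans T2'); exact: lerD.
Unshelve. all: end_near. Qed.

End Extension.

(** * Outer multipliers *)

Section Outer.
Context {R : realType}.
Local Notation C := (Cplx R).
Implicit Types (z w : C) (t x y r d e : R) (n : nat).

(** This is min (x, 0), in a form whose integrability and Lipschitz constant come from those of the
    absolute value. *)
Definition minus_part x : R := (x - `|x|) / 2.

Lemma minus_part_le0 x : minus_part x <= 0.
Proof. by rewrite /minus_part; have := ler_norm x; lra. Qed.

Lemma minus_part_le x : minus_part x <= x.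
Proof. by rewrite /minus_part; have := ler_norm (- x); rewrite normrN; lra. Qed.

Lemma minus_part_ge0 x : 0 <= x -> minus_part x = 0.
Proof. by move=> x0; rewrite /minus_part ger0_norm // subrr mul0r. Qed.

Lemma minus_part_lip x y : `|minus_part x - minus_part y| <= `|x - y|.
Proof.
have h : `| `|x| - `|y| | <= `|x - y| by exact: ler_dist_dist.
have -> : minus_part x - minus_part y = ((x - y) - (`|x| - `|y|)) / 2 by rewrite /minus_part; field.
rewrite normrM (@ger0_norm _ 2^-1) ?invr_ge0 // ler_pdivrMr //.
by rewrite (le_trans (ler_normB _ _)) // mulrDr mulr1 lerD2l.
Qed.

Variables (alpha : R) (f : C -> C) (k : R).
Hypotheses (alpha_gt0 : 0 < alpha) (alpha_le : alpha <= 2^-1).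
Hypothesis lipf : lip_space alpha f.
Hypothesis fnz : exists2 z, closed_disc z & f z != 0.
Hypothesis k_gt0 : 0 < k.

(* The boundary modulus of [exp (herglotz (log_modulus n))] is [min (1, e^n |f|)^k]. *)
Definition log_modulus n t : R := k * minus_part (lam f t + n%:R).
Definition log_outer n := herglotz (log_modulus n).
Definition log_outer' n := herglotz' (log_modulus n).
Definition outer n z : C := cexp (log_outer n z).

Let iga_lamf : iga (lam f) := (iga_lam_ae alpha_gt0 alpha_le lipf fnz).1.

Lemma iga_log_modulus n : iga (log_modulus n).
Proof.
have h : iga (fun t => lam f t + n%:R) by apply: igD => //; exact: ig_cst.
apply: igZ; apply: (iga_ext (g := fun t => 2^-1 * ((lam f t + n%:R) - `|lam f t + n%:R|))).
  by move=> t; rewrite mulrC.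
by apply: igZ; apply: igB => //; exact: ig_abs.
Qed.

Lemma avg_log_modulus : avg (fun t => `|log_modulus n t|) @[n --> \oo] --> 0.
Proof.
rewrite (_ : (fun n => _) = (fun n => avg (fun t => `|log_modulus n t - 0|))); last first.
  by apply/funext => n; apply: avg_ext => t; rewrite subr0.
apply: (avg_dct (g := fun=> 0) (h := fun t => k * `|lam f t|)).
- exact: iga_log_modulus.
- exact: ig_cst.
- by apply: igZ; exact: ig_abs.
(* Every [lam f t] is a real number, so [log_modulus n t] is 0 as soon as n >= |lam f t|. *)
- apply: aeW => t _; apply: cvg_near_cst; near=> n.
  apply/eqP; rewrite /log_modulus minus_part_ge0 ?mulr0 //.
  have : `|lam f t| <= n%:R by near: n; exact: nbhs_infty_ger.
  by have := ler_norm (- lam f t); rewrite normrN; lra.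
- apply: aeW => t n _; rewrite /log_modulus normrM (ger0_norm (ltW k_gt0)) ler_wpM2l ?(ltW k_gt0) //.
  have := minus_part_lip (lam f t + n%:R) n%:R; rewrite (minus_part_ge0 (x := n%:R)) ?ler0n //.
  by rewrite subr0 addrK.
Unshelve. all: end_near. Qed.

Lemma outer_le1 n z : normc z < 1 -> normc (outer n z) <= 1.
Proof.
move=> z1; rewrite normc_cexp -[leRHS]expR0 ler_expR /log_outer Re_herglotz.
rewrite -[leRHS](avg_cst 0); apply: avg_le.
- by apply: iga_poisson => //; exact: iga_log_modulus.
- exact: ig_cst.
- move=> t; rewrite mulr_ge0_le0 ?(ltW (poisson_gt0 t z1)) //.
  by rewrite mulr_ge0_le0 ?(ltW k_gt0) ?minus_part_le0.
Qed.

(** Bounding the minus part by its argument leaves k (n + mean of lam), and [lam_jensen] at c = |f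
    z| + omega + e bounds that mean by ln c. The e keeps c positive where |f z| + omega vanishes. *)
Lemma outer_bound n z e : normc z < 1 -> 0 < e ->
  normc (outer n z) <= (expR n%:R * (normc (f z) + omega f z + e)) `^ k.
Proof.
move=> z1 e0; set c := _ + e; have c0 : 0 < c.
  by have := normc_ge0 (f z); have := omega_ge0 f z1; rewrite /c; lra.
rewrite normc_cexp /powR gt_eqF ?mulr_gt0 ?expR_gt0 // ler_expR.
rewrite lnM ?posrE ?expR_gt0 // expRK /log_outer Re_herglotz.
have ip := iga_poisson1 z1.
have il := iga_poisson z1 iga_lamf.
have ik : iga (fun t => k * (poisson z t * lam f t + n%:R * poisson z t)).
  by apply: igZ; apply: igD => //; exact: igZ.
apply: (@le_trans _ _ (avg (fun t => k * (poisson z t * lam f t + n%:R * poisson z t)))).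
  apply: avg_le => //; first by apply: iga_poisson => //; exact: iga_log_modulus.
  move=> t; have p0 := ltW (poisson_gt0 t z1).
  rewrite /log_modulus mulrCA ler_wpM2l ?(ltW k_gt0) // [n%:R * _]mulrC -mulrDr.
  by rewrite ler_wpM2l // minus_part_le.
rewrite avgZ; last by apply: igD => //; exact: igZ.
rewrite avgD //; last exact: igZ.
rewrite (avgZ n%:R ip) avg_poisson //.
rewrite mulr1 ler_wpM2l ?(ltW k_gt0) // addrC lerD2l.
have := lam_jensen alpha_gt0 alpha_le lipf fnz z1 c0.
have : (normc (f z) + omega f z - c) / c <= 0.
  by apply: mulr_le0_ge0; [rewrite /c; lra|rewrite invr_ge0 ltW].
lra.
Qed.

Lemma cdiff_outer n z : normc z < 1 -> cdiff (outer n) z (outer n z * log_outer' n z).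
Proof.
move=> z1; apply: cdiff_comp; last exact: cdiff_exp.
by apply: cdiff_herglotz => //; exact: iga_log_modulus.
Qed.

(** The constant subtracted under the kernel is the log modulus formed with |f z| in place of |f
    (cis t)|. The minus part is 1-Lipschitz, so the shift by n disappears: this makes the bound
    uniform in n. *)
Lemma log_outer'_le n z : normc z < 1 ->
  normc (f z) * normc (log_outer' n z) <= 4 * k * (omega f z / (1 - normc z)).
Proof.
move=> z1; have d0 : 0 < 1 - normc z by lra.
have om := omega_ge0 f z1.
have [->|fz] := eqVneq (f z) 0.
  by rewrite normcr0 mul0r mulr_ge0 ?divr_ge0 ?(ltW d0) // mulr_ge0 // ltW.
have nf : 0 < normc (f z) by rewrite normc_gt0.
pose c := k * minus_part (ln (normc (f z)) + n%:R).
have h1 := herglotz'_poisson c z1 (iga_log_modulus n).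
have h2 : avg (fun t => poisson z t * `|log_modulus n t - c|) <=
    k * avg (fun t => poisson z t * `|lam f t - ln (normc (f z))|).
  have ic (a : R) (u : R -> R) : iga u -> iga (fun t => poisson z t * `|u t - a|).
    by move=> iu; apply: iga_poisson => //; apply: ig_abs; apply: igB => //; exact: ig_cst.
  rewrite -avgZ; last exact: ic.
  apply: avg_le; [by apply: ic; exact: iga_log_modulus|by apply: igZ; exact: ic|].
  move=> t; rewrite [leRHS]mulrCA ler_wpM2l ?(ltW (poisson_gt0 t z1)) //.
  rewrite /log_modulus /c -mulrBr normrM (ger0_norm (ltW k_gt0)) ler_wpM2l ?(ltW k_gt0) //.
  rewrite (le_trans (minus_part_lip _ _)) // le_eqVlt; apply/orP; left; apply/eqP.
  by congr (`|_|); ring.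
have h3 := lam_osc alpha_gt0 alpha_le lipf fnz z1 fz.
set A := avg _ in h2; set B := avg _ in h2 h3.
have h4 : A <= k * (2 * omega f z / normc (f z)).
  by rewrite (le_trans h2) // ler_wpM2l ?(ltW k_gt0).
have h5 : normc (log_outer' n z) <= 2 / (1 - normc z) * (k * (2 * omega f z / normc (f z))).
  by rewrite (le_trans h1) // ler_wpM2l // divr_ge0 // ltW.
apply: (le_trans (ler_wpM2l (ltW nf) h5)).
by rewrite le_eqVlt; apply/orP; left; apply/eqP; field; rewrite !gt_eqF.
Qed.

(** For |z| <= r both kernels are bounded, so log_outer and its derivative are controlled by the
    mean of |log_modulus n|, which tends to 0. Near 0, |e^w - 1| <= 2 |w|, whence b <= e / 2. *)
Lemma log_outer_small e r : 0 < e -> r < 1 ->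
  \forall n \near \oo, forall z, normc z <= r ->
    normc (outer n z - 1) <= e /\ normc (log_outer' n z) <= e.
Proof.
move=> e0 r1; have d0 : 0 < 1 - r by lra.
have /nbhs_normcP[s s0 hs] := cdiff_bound (@cdiff_exp0 R).
pose b : R := Num.min (s / 2) (e / 2).
have b0 : 0 < b by rewrite lt_min !divr_gt0.
have c1 : 0 < b * (1 - r) / 2 by rewrite divr_gt0 // mulr_gt0.
have c2 : 0 < e * (1 - r) ^+ 2 / 2 by rewrite divr_gt0 // mulr_gt0 // exprn_gt0.
have H : \forall n \near \oo, avg (fun t => `|log_modulus n t|) <= Num.min (b * (1 - r) / 2) (e * (1 - r) ^+ 2 / 2).
  have cm : 0 < Num.min (b * (1 - r) / 2) (e * (1 - r) ^+ 2 / 2) by rewrite lt_min c1.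
  have /cvgrPdist_le/(_ _ cm) := avg_log_modulus.
  by apply: filterS => n; rewrite sub0r normrN; apply: le_trans; exact: ler_norm.
apply: filterS H => n; rewrite le_min => /andP[A1 A2] z zr.
have z1 : normc z < 1 by lra.
have dz : 0 < 1 - normc z by lra.
have in1 : (1 - normc z)^-1 <= (1 - r)^-1 by rewrite lef_pV2 ?posrE //; lra.
have in2 : ((1 - normc z) ^+ 2)^-1 <= ((1 - r) ^+ 2)^-1.
  by rewrite lef_pV2 ?posrE ?exprn_gt0 // ler_pXn2r ?nnegrE ?(ltW dz) ?(ltW d0) // lerD2l lerN2.
have a0 : 0 <= avg (fun t => `|log_modulus n t|) by apply: avg_ge0.
have L1 : normc (log_outer n z) <= b.
  rewrite (le_trans (herglotz_le z1 (iga_log_modulus n))) //.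
  apply: (@le_trans _ _ (2 / (1 - r) * (b * (1 - r) / 2))).
    by apply: ler_pM => //; [rewrite divr_ge0 // ltW|rewrite ler_wpM2l].
  by rewrite le_eqVlt; apply/orP; left; apply/eqP; field; rewrite gt_eqF.
split; last first.
  rewrite (le_trans (herglotz'_le z1 (iga_log_modulus n))) //.
  apply: (@le_trans _ _ (2 / (1 - r) ^+ 2 * (e * (1 - r) ^+ 2 / 2))).
    by apply: ler_pM => //; [rewrite divr_ge0 // exprn_ge0 // ltW|rewrite ler_wpM2l].
  by rewrite le_eqVlt; apply/orP; left; apply/eqP; field; rewrite gt_eqF.
have bs : b <= s / 2 by rewrite ge_min lexx.
have be : b <= e / 2 by rewrite ge_min lexx orbT.
have := hs (log_outer n z); rewrite subr0 cexp0 normcr1 => /(_ _) h.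
rewrite (le_trans (h _)) //; lra.
Qed.

Definition prod_outer n z : C := f z * outer n z.
Definition prod_outer' n z : C :=
  'D_1 f z * outer n z + f z * (outer n z * log_outer' n z).

Lemma cdiff_prod_outer n z : normc z < 1 -> cdiff (prod_outer n) z (prod_outer' n z).
Proof.
by move=> z1; apply: cdiffM; [exact: lip_cdiff lipf _ z1|exact: cdiff_outer].
Qed.

Lemma prod_outer'_sub n z : normc z < 1 ->
  normc (prod_outer' n z - 'D_1 f z) <= 2 * normc ('D_1 f z) + 4 * k * (omega f z / (1 - normc z)).
Proof.
move=> z1; have o1 := outer_le1 n z1.
have -> : prod_outer' n z - 'D_1 f z = 'D_1 f z * (outer n z - 1) + outer n z * (f z * log_outer' n z).
  by rewrite /prod_outer'; ring.
rewrite (le_trans (normc_add _ _)) // [normc ('D_1 f z * _)]normc_mul [normc (outer n z * _)]normc_mul [normc (f z * _)]normc_mul lerD //.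
  rewrite mulrC ler_wpM2r ?normc_ge0 // (le_trans (normc_sub _ _)) // normcr1; lra.
have := log_outer'_le n z1; apply: le_trans.
by rewrite ler_piMl // mulr_ge0 ?normc_ge0.
Qed.

Lemma prod_outer'_le n z : normc z < 1 ->
  normc (prod_outer' n z) <= normc ('D_1 f z) + 4 * k * (omega f z / (1 - normc z)).
Proof.
move=> z1; have o1 := outer_le1 n z1.
have -> : prod_outer' n z = 'D_1 f z * outer n z + outer n z * (f z * log_outer' n z).
  by rewrite /prod_outer'; ring.
rewrite (le_trans (normc_add _ _)) // [normc ('D_1 f z * _)]normc_mul [normc (outer n z * _)]normc_mul [normc (f z * _)]normc_mul lerD //.
  by rewrite ler_piMr ?normc_ge0.
have := log_outer'_le n z1; apply: le_trans.
by rewrite ler_piMl // mulr_ge0 ?normc_ge0.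
Qed.

Lemma dominator_little_o (a b : R) : 0 < a -> 0 < b ->
  little_o alpha (fun z => a * normc ('D_1 f z) + b * (omega f z / (1 - normc z))).
Proof.
move=> a0 b0 e e0; have e1 : 0 < e / 2 / a by rewrite !divr_gt0.
have e2 : 0 < e / 2 / b by rewrite !divr_gt0.
have [K1 K10 H1] := deriv_little_o alpha_gt0 lipf e1.
have [K2 K20 H2] := omega_little_o alpha_gt0 alpha_le lipf e2.
exists (a * K1 + b * K2); first by rewrite addr_ge0 // mulr_ge0 // ltW.
move=> z z1; have h1 := ler_wpM2l (ltW a0) (H1 z z1).
have h2 := ler_wpM2l (ltW b0) (H2 z z1).
apply: (le_trans (lerD h1 h2)); rewrite le_eqVlt; apply/orP; left; apply/eqP.
by field; rewrite !gt_eqF.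
Qed.

Lemma prod_outer'_little_o n : little_o alpha (fun z => normc (prod_outer' n z)).
Proof.
move=> e e0; have k4 : 0 < 4 * k by rewrite mulr_gt0.
have [K K0 H] := dominator_little_o ltr01 k4 e0.
exists K => // z z1; have := H z z1; rewrite mul1r; apply: le_trans.
exact: prod_outer'_le.
Qed.

(* Inside the disc this is [outer n]; on the circle the boundary values are read
   off the continuous extension of [f * outer n], since [f * outer n] is smoother
   than [outer n] itself. *)
Definition outer_ext n z : C :=
  if normc z < 1 then outer n z
  else if f z == 0 then 0 else ext (prod_outer n) z / f z.

Let ext_cvg_n n := ext_cvg alpha_gt0 alpha_le (@cdiff_prod_outer n) (@prod_outer'_little_o n).

Lemma f_radius_near z e : normc z <= 1 -> 0 < e ->
  \forall j \near \oo, normc (f (rc (radius j) * z) - f z) <= e.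
Proof.
move=> z1 e0; have [d d0 H] := lip_unif alpha_gt0 lipf e0.
near=> j; apply: H => //; first exact: ltW (radius_disc j z1).
have hj : 1 - radius j < d by near: j; exact: radius_near.
have /andP[a0 a1] := radiusP (R := R) j.
rewrite normc_distC (_ : z - rc (radius j) * z = rc (1 - radius j) * z); last first.
  by apply: complex_eq; rewrite !ReImE /=; ring.
by rewrite normc_mul normc_rc ger0_norm; have := normc_ge0 z; [nra|lra].
Unshelve. all: end_near. Qed.

(** The case that is not division is a boundary zero of [f]: the extension vanishes there because |f
    g_n| <= |f| inside. *)
Lemma mul_outer_ext n z : normc z <= 1 -> f z * outer_ext n z = ext (prod_outer n) z.
Proof.
move=> z1; rewrite /outer_ext; case: ifPn => [h|h].
  by rewrite (ext_in alpha_gt0 alpha_le (@cdiff_prod_outer n) (@prod_outer'_little_o n)).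
case: eqP => [fz|/eqP fz]; last by rewrite mulrCA mulfV ?mulr1.
rewrite mulr0; symmetry; apply/eqP; rewrite -normc_eq0 eq_le normc_ge0 andbT.
apply/ler_addgt0Pr => e e0; rewrite add0r; have e2 : 0 < e / 2 by rewrite divr_gt0.
near \oo => j.
have h1 : normc (ext (prod_outer n) z - prod_outer n (rc (radius j) * z)) <= e / 2.
  by near: j; exact: ext_cvg_n.
have h2 : normc (f (rc (radius j) * z) - f z) <= e / 2 by near: j; exact: f_radius_near.
rewrite fz subr0 in h2.
have h3 : normc (prod_outer n (rc (radius j) * z)) <= e / 2.
  rewrite (le_trans _ h2) // /prod_outer normc_mul ler_piMr ?normc_ge0 //.
  exact: outer_le1 (radius_disc j z1).
have E : e / 2 + e / 2 = e by field.
rewrite -E; apply: le_trans (lerD h1 h3).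
have := normc_add (ext (prod_outer n) z - prod_outer n (rc (radius j) * z)) (prod_outer n (rc (radius j) * z)).
by rewrite subrK.
Unshelve. all: end_near. Qed.

(** Since g_n is known on the circle only through f g_n, the product is bounded along the dilates of
    xi by [outer_bound], where omega tends to 0, and the factor |f xi| is divided out at the end. *)
Lemma outer_ext_circle n xi : normc xi = 1 ->
  normc (outer_ext n xi) <= (expR n%:R * normc (f xi)) `^ k.
Proof.
move=> x1; have x1' : normc xi <= 1 by rewrite x1.
rewrite /outer_ext x1 ltxx; case: eqP => [fz|/eqP fz].
  by rewrite normcr0 powR_ge0.
have nf : 0 < normc (f xi) by rewrite normc_gt0.
rewrite normc_div ler_pdivrMr //.
have key e : 0 < e -> normc (ext (prod_outer n) xi) <=
    (expR n%:R * (normc (f xi) + e)) `^ k * (normc (f xi) + e) + e.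
  move=> e0; have e3 : 0 < e / 3 by rewrite divr_gt0.
  have [s s0 hs] := omega_small alpha_gt0 alpha_le lipf e3.
  near \oo => j.
  have h1 : normc (ext (prod_outer n) xi - prod_outer n (rc (radius j) * xi)) <= e.
    by near: j; exact: ext_cvg_n.
  have h2 : normc (f (rc (radius j) * xi) - f xi) <= e / 3 by near: j; exact: f_radius_near.
  have hr : 1 - radius j < s by near: j; exact: radius_near.
  set w := rc (radius j) * xi in h1 h2.
  have w1 : normc w < 1 by exact: radius_disc.
  have hw : omega f w <= e / 3.
    apply: hs => //; rewrite normc_mul x1 mulr1 normc_rc ger0_norm.
      exact: ltW hr.
    by have /andP[/ltW] := radiusP (R := R) j.
  have fw : normc (f w) <= normc (f xi) + e / 3.
    by have := normc_sub_ge (f w) (f xi); lra.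
  have gw := outer_bound n w1 e3.
  have T : normc (ext (prod_outer n) xi) <= normc (prod_outer n w) + e.
    by have := normc_sub_ge (ext (prod_outer n) xi) (prod_outer n w); lra.
  rewrite (le_trans T) // lerD2r /prod_outer normc_mul mulrC.
  apply: ler_pM; rewrite ?normc_ge0 //; last by rewrite (le_trans fw) //; lra.
  rewrite (le_trans gw) // le_powR ?(ltW k_gt0) //.
    by rewrite mulr_ge0 ?expR_ge0 //; have := normc_ge0 (f w); have := omega_ge0 f w1; lra.
  by rewrite ler_wpM2l ?expR_ge0 //; lra.
pose u e : R := (expR n%:R * (normc (f xi) + e)) `^ k * (normc (f xi) + e) + e.
(* The bound holds for every e > 0; its limit at 0 from the right is the desired one. Continuity of
   the power uses f xi != 0. *)
have cu : u e @[e --> 0^'+] --> (expR n%:R * normc (f xi)) `^ k * normc (f xi).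
  have ca : normc (f xi) + e @[e --> 0^'+] --> normc (f xi).
    rewrite -[X in _ --> X]addr0; apply: cvgD; first exact: cvg_cst.
    by apply: cvg_at_right_filter; exact: cvg_id.
  have cb : (expR n%:R * (normc (f xi) + e)) `^ k @[e --> 0^'+] --> (expR n%:R * normc (f xi)) `^ k.
    apply: (@cvg_comp _ _ _ (fun e => expR n%:R * (normc (f xi) + e)) (fun y => y `^ k) _ (nbhs (expR n%:R * normc (f xi)))).
      by apply: cvgM => //; exact: cvg_cst.
    have p0 : 0 < expR n%:R * normc (f xi) by rewrite mulr_gt0 ?expR_gt0.
    have [d _] := is_derive1_powR k p0.
    have : {for expR n%:R * normc (f xi), continuous (fun y : R => y `^ k)}.
      by apply: differentiable_continuous; exact/derivable1_diffP.
    exact.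
  rewrite -[X in _ --> X]addr0; apply: cvgD; first exact: cvgM.
  by apply: cvg_at_right_filter; exact: cvg_id.
have <- := cvg_lim (@Rhausdorff R) cu.
apply: limr_ge; first by apply/cvg_ex; eexists; exact: cu.
near=> e; apply: key; near: e; exact: nbhs_right_gt.
Unshelve. all: end_near. Qed.

End Outer.

(** * The multipliers on the closed disc *)

Section OuterExt.
Context {R : realType}.
Local Notation C := (Cplx R).
Implicit Types (z w : C) (t x y r d e : R) (n : nat).

Lemma within_closed_disc (g : C -> C) :
  (forall z, normc z <= 1 -> forall e, 0 < e -> exists2 d : R, 0 < d &
     forall w, normc w <= 1 -> normc (w - z) < d -> normc (g w - g z) < e) ->
  {within @closed_disc R, continuous g}.
Proof.
move=> H; apply/subspace_continuousP => z z1 P /nbhs_normcP[e e0 eP].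
have [d d0 dP] := H z z1 e e0.
have : nbhs z (fun w => closed_disc w -> P (g w)).
  by apply/nbhs_normcP; exists d => // w wd w1; apply: eP; exact: dP.
exact.
Qed.

Lemma lip_within (alpha : R) (g : C -> C) : 0 < alpha ->
  (forall eps : R, 0 < eps -> exists2 delta : R, 0 < delta &
      forall z w, normc z <= 1 -> normc w <= 1 -> normc (z - w) < delta ->
        normc (g z - g w) <= eps * normc (z - w) `^ alpha) ->
  {within @closed_disc R, continuous g}.
Proof.
move=> a0 H; apply: within_closed_disc => z z1 e e0.
have e2 : 0 < e / 2 by rewrite divr_gt0.
have [d d0 dP] := H _ e2; exists (Num.min d 1); first by rewrite lt_min d0 ltr01.
move=> w w1; rewrite lt_min => /andP[wd wl].
have h := dP w z w1 z1 wd.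
have p1 : normc (w - z) `^ alpha <= 1.
  have := @le_powR R (normc (w - z)) 1 alpha; rewrite powR1; apply; [exact: ltW|exact: normc_ge0|exact: ltW].
have h2 : e / 2 * normc (w - z) `^ alpha <= e / 2 by rewrite ler_piMr // ltW.
by rewrite (le_lt_trans h) // (le_lt_trans h2) //; lra.
Qed.

Variables (alpha : R) (f : C -> C) (k : R).
Hypotheses (alpha_gt0 : 0 < alpha) (alpha_le : alpha <= 2^-1).
Hypothesis lipf : lip_space alpha f.
Hypothesis fnz : exists2 z, closed_disc z & f z != 0.
Hypothesis k_gt0 : 0 < k.

Local Notation g n := (outer_ext f k n).

Let cdF n := @cdiff_prod_outer R alpha f k alpha_gt0 alpha_le lipf fnz n.
Let loF n := prod_outer'_little_o alpha_gt0 alpha_le lipf fnz k_gt0 n.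

Lemma near_disc z : normc z < 1 -> \forall w \near z, normc w < 1.
Proof.
move=> z1; apply/nbhs_normcP; exists (1 - normc z); first by lra.
by move=> w wz; have := normc_sub_ge w z; lra.
Qed.

Lemma cdiff_outer_ext n z : normc z < 1 ->
  cdiff (g n) z (outer f k n z * log_outer' f k n z).
Proof.
move=> z1; apply: cdiff_ext (cdiff_outer k alpha_gt0 alpha_le lipf fnz n z1).
by have := near_disc z1; apply: filterS => w w1; rewrite /outer_ext w1.
Qed.

Lemma cdiff_mul_outer_ext n z : normc z < 1 ->
  cdiff (f \* g n) z (prod_outer' f k n z).
Proof.
move=> z1; apply: cdiff_ext (@cdF n z z1).
by have := near_disc z1; apply: filterS => w w1; rewrite /= /outer_ext w1.
Qed.

Lemma mul_outer_ext_lip n : lip_space alpha (f \* g n).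
Proof.
have L e : 0 < e -> exists2 d : R, 0 < d & forall z w, normc z <= 1 -> normc w <= 1 ->
    normc (z - w) < d -> normc ((f \* g n) z - (f \* g n) w) <= e * normc (z - w) `^ alpha.
  move=> e0; have [d d0 H] := ext_lip alpha_gt0 alpha_le (@cdF n) (@loF n) e0.
  exists d => // z w z1 w1 zw; have := H z w z1 w1 zw.
  by rewrite -!(mul_outer_ext alpha_gt0 alpha_le lipf fnz k_gt0).
split; last exact: L.
split; last exact: lip_within L.
by move=> z z1; exact: cdiff_derivable (cdiff_mul_outer_ext n z1).
Qed.

(** Continuity at a boundary point has two sources. Where f z = 0, the bounds (e^n (|f| + omega +
    s))^k inside and (e^n |f|)^k on the circle tend to 0; where f z != 0, g_n is the quotient of the
    continuous f g_n by [f]. *)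
Lemma outer_ext_disc_algebra n : disc_algebra (g n).
Proof.
split; first by move=> z z1; exact: cdiff_derivable (cdiff_outer_ext n z1).
apply: within_closed_disc => z z1 e e0.
have [zl|zg] := ltP (normc z) 1.
  have e2 : 0 < e / 2 by rewrite divr_gt0.
  have /nbhs_normcP[d d0 H] := cdiff_cont (cdiff_outer_ext n zl) e2.
  exists d => // w _ wd; rewrite (le_lt_trans (H w wd)) //; lra.
have zE : normc z = 1 by apply/eqP; rewrite eq_le z1.
have [fz|fz] := eqVneq (f z) 0.
  have gz : g n z = 0 by rewrite /outer_ext ltNge zg /= fz eqxx.
  have en : 0 < expR n%:R :> R by exact: expR_gt0.
  have e2 : 0 < e / 2 by rewrite divr_gt0.
  (* The third is for |f w|, omega f w and the auxiliary s of [outer_bound]; with all three at most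
     s the bound is at most e / 2. *)
  pose s : R := (e / 2) `^ (k^-1) / expR n%:R / 3.
  have s0 : 0 < s by rewrite !divr_gt0 // powR_gt0.
  have sE : expR n%:R * (s + s + s) = (e / 2) `^ (k^-1) by rewrite /s; field; rewrite gt_eqF.
  have bd x : 0 <= x -> x <= s + s + s -> (expR n%:R * x) `^ k < e.
    move=> x0 xs; apply: (@le_lt_trans _ _ (e / 2)); last by lra.
    rewrite -[leRHS](@powR_alpha_inj R k k_gt0) ?(ltW e2) // -sE.
    by apply: le_powR; rewrite ?ler_wpM2l ?mulr_ge0 ?expR_ge0 // ltW.
  have [d d0 H] := lip_unif alpha_gt0 lipf s0.
  have [c c0 hc] := omega_small alpha_gt0 alpha_le lipf s0.
  exists (Num.min d c); first by rewrite lt_min d0 c0.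
  move=> w w1; rewrite lt_min gz subr0 => /andP[wd wc].
  have fw := H w z w1 z1 wd; rewrite fz subr0 in fw.
  have nf := normc_ge0 (f w).
  have [wl|wg] := ltP (normc w) 1.
    have om : omega f w <= s.
      apply: hc => //; rewrite -zE (le_trans (normc_sub_ge _ _)) //.
      by rewrite normc_distC ltW.
    have og := omega_ge0 f wl.
    rewrite /outer_ext wl (le_lt_trans (outer_bound alpha_gt0 alpha_le lipf fnz k_gt0 n wl s0)) //.
    by apply: bd; lra.
  have wE : normc w = 1 by apply/eqP; rewrite eq_le w1.
  rewrite (le_lt_trans (outer_ext_circle alpha_gt0 alpha_le lipf fnz k_gt0 n wE)) //.
  by apply: bd; lra.
have nf : 0 < normc (f z) by rewrite normc_gt0.
pose s : R := e * normc (f z) / 4 / (1 + normc (g n z)).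
have gz0 := normc_ge0 (g n z).
have g1 : 0 < 1 + normc (g n z) by lra.
have s0 : 0 < s by rewrite !divr_gt0 // mulr_gt0.
have nf2 : 0 < normc (f z) / 2 by rewrite divr_gt0.
have sm : 0 < Num.min s (normc (f z) / 2) by rewrite lt_min s0.
have [d d0 H] := lip_unif alpha_gt0 lipf sm.
have [c c0 hc] := lip_unif alpha_gt0 (mul_outer_ext_lip n) s0.
exists (Num.min d c); first by rewrite lt_min d0 c0.
move=> w w1; rewrite lt_min => /andP[wd wc].
have := H w z w1 z1 wd; rewrite le_min => /andP[fs fm].
have hs := hc w z w1 z1 wc; rewrite /= in hs.
have fw : normc (f z) / 2 <= normc (f w).
  by have := normc_sub_ge (f z) (f w); rewrite normc_distC; lra.
have fw0 : 0 < normc (f w) by lra.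
have fwn : f w != 0 by rewrite -normc_gt0.
have E : g n w - g n z = ((f w * g n w - f z * g n z) + g n z * (f z - f w)) / f w.
  apply: (canRL (mulfK fwn)); move: (g n w) (g n z) (f w) (f z) => a b c' d'; ring.
rewrite E normc_div ltr_pdivrMr //.
apply: (@le_lt_trans _ _ (s * (1 + normc (g n z)))).
  apply: (le_trans (normc_add _ _)); have -> : s * (1 + normc (g n z)) = s + normc (g n z) * s by ring.
  by apply: lerD => //; rewrite (normc_mul (g n z)) ler_wpM2l // normc_distC.
rewrite /s divfK ?gt_eqF // -mulrA ltr_pM2l //; lra.
Qed.

Lemma outer_ext_dist n : exists Cn : R, forall xi, unit_circle xi ->
  normc (g n xi) <= Cn * dist_to (zero_set f) xi `^ (alpha * k).
Proof.
have [H H0 hH] := zero_dist alpha_gt0 lipf.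
exists ((expR n%:R * H) `^ k) => xi xi1.
rewrite (le_trans (outer_ext_circle alpha_gt0 alpha_le lipf fnz k_gt0 n xi1)) //.
rewrite powRrM -powRM ?powR_ge0 ?mulr_ge0 ?expR_ge0 ?(ltW H0) //.
apply: le_powR; first exact: ltW.
- by rewrite mulr_ge0 ?expR_ge0 ?normc_ge0.
- by rewrite -mulrA ler_wpM2l ?expR_ge0 // hH.
Qed.

(** On |z| <= r, |f'| is at most A and |f| at most B, so smallness e / (A + B) of g_n - 1 and of the
    logarithmic derivative is enough. *)
Lemma prod_outer'_unif e r : 0 < e -> r < 1 ->
  \forall n \near \oo, forall z, normc z <= r ->
    normc (prod_outer' f k n z - 'D_1 f z) <= e.
Proof.
move=> e0 r1; have [B B0 fB] := lip_bounded alpha_gt0 lipf.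
have [K K0 hK] := deriv_little_o alpha_gt0 lipf ltr01.
have d0 : 0 < 1 - r by lra.
pose A : R := (1 - r) `^ (alpha - 1) + K.
have A0 : 0 < A by rewrite ltr_pwDl // powR_gt0.
have e1 : 0 < e / (A + B) by rewrite divr_gt0 // addr_gt0.
have := log_outer_small alpha_gt0 alpha_le lipf fnz k_gt0 e1 r1.
apply: filterS => n H z zr; have [h1 h2] := H z zr.
have z1 : normc z < 1 by lra.
have o1 := outer_le1 alpha_gt0 alpha_le lipf fnz k_gt0 n z1.
have -> : prod_outer' f k n z - 'D_1 f z =
    'D_1 f z * (outer f k n z - 1) + outer f k n z * (f z * log_outer' f k n z).
  by rewrite /prod_outer'; ring.
have fA : normc ('D_1 f z) <= A.
  rewrite (le_trans (hK z z1)) // mul1r lerD2r powR_sub1_anti //; last by lra.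
  by apply: ltW; exact: alpha_lt1 alpha_le.
have fz := fB z (ltW z1).
have := normc_ge0 (f z); have := normc_ge0 (outer f k n z) ; have := normc_ge0 (log_outer' f k n z).
move=> l0 g0 f0.
rewrite (le_trans (normc_add _ _)) //.
have -> : e = A * (e / (A + B)) + 1 * (B * (e / (A + B))).
  by field; rewrite gt_eqF // addr_gt0.
rewrite (normc_mul ('D_1 f z)) (normc_mul (outer f k n z)) (normc_mul (f z)).
apply: lerD; first by apply: ler_pM; rewrite ?normc_ge0.
apply: ler_pM => //; first exact: mulr_ge0.
by apply: ler_pM.
Qed.

End OuterExt.

(** * Iterated integrals and the Dirichlet integral *)

Section Rectangles.
Context {R : realType}.
Local Notation mu := (@lebesgue_measure R).
Local Notation RM := (measurableTypeR R).
Implicit Types (A B : set R) (u v : R -> R -> R) (x y a b c d e : R).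

(** Continuity relative to the product, since radial integrands need not be controlled beyond the
    disc; curried to fit iterated integrals. *)
Definition cts2 A B u := forall x y, A x -> B y ->
  u p.1 p.2 @[p --> within (A `*` B) (nbhs (x, y))] --> u x y.

Lemma cts2_eps A B u x y e : cts2 A B u -> A x -> B y -> 0 < e ->
  exists2 d : R, 0 < d & forall x' y', A x' -> B y' -> `|x' - x| < d -> `|y' - y| < d ->
    `|u x' y' - u x y| <= e.
Proof.
move=> cu Ax By e0; have /cvgrPdist_le/(_ e e0) := cu x y Ax By.
rewrite near_withinE => -[[P Q] /= [/nbhs_ballP[d1 /= d10 H1] /nbhs_ballP[d2 /= d20 H2]] sub].
exists (Num.min d1 d2); first by rewrite lt_min d10.
move=> x' y' Ax' By'; rewrite !lt_min => /andP[h1 _] /andP[_ h2].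
have /= := sub (x', y'); rewrite distrC; apply; last by split.
by split; [apply: H1|apply: H2]; rewrite -ball_normE /= distrC.
Qed.

(** Each superlevel set is, relative to A x B, a union of boxes with rational corners. These are
    countably many and belong to the product sigma-algebra. *)
Lemma cts2_measurable A B u : measurable (A : set RM) -> measurable (B : set RM) -> cts2 A B u ->
  measurable_fun (A `*` B : set (RM * RM)) (fun p : RM * RM => u p.1 p.2).
Proof.
move=> mA mB cu; have mAB : measurable (A `*` B : set (RM * RM)) by exact: measurableX.
move=> _; apply: (measurability _ (RGenOInfty.measurableE R)) => //.
move=> /= _ [_ [c ->] <-].
pose box (q : (rat * rat) * (rat * rat)) : set (RM * RM) :=
  `]ratr q.1.1, ratr q.1.2[%classic `*` `]ratr q.2.1, ratr q.2.2[%classic.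
pose good q := (A `*` B) `&` box q `<=` [set p | c < u p.1 p.2].
pose F q := if `[< good q >] then box q else set0.
have -> : (A `*` B) `&` (fun p : RM * RM => u p.1 p.2) @^-1` `]c, +oo[ =
    (A `*` B) `&` \bigcup_q F q.
  apply/seteqP; split=> -[x y] /= [ABxy]; last first.
    move=> [q _]; rewrite /F; case: asboolP => // gq bq; split=> //.
    by rewrite in_itv /= andbT; apply: (gq (x, y)).
  rewrite in_itv /= andbT => cuxy; split=> //.
  have e0 : 0 < (u x y - c) / 2 by lra.
  have [d d0 H] := cts2_eps cu ABxy.1 ABxy.2 e0.
  have rat_box z : exists q : rat * rat, [/\ z - d < ratr q.1, ratr q.1 < z, z < ratr q.2 & ratr q.2 < z + d].
    have h1 : z - d < z by lra.
    have h2 : z < z + d by lra.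
    have [q1 /=] := rat_in_itvoo h1; rewrite in_itv /= => /andP[a1 a2].
    have [q2 /=] := rat_in_itvoo h2; rewrite in_itv /= => /andP[b1 b2].
    by exists (q1, q2).
  have [q1 [a1 a2 a3 a4]] := rat_box x; have [q2 [b1 b2 b3 b4]] := rat_box y.
  exists (q1, q2) => //; rewrite /F; case: asboolP => [_|].
    by split; rewrite /= in_itv /=; apply/andP; split.
  case=> -[x' y'] /= [[Ax' By'] [/=]]; rewrite !in_itv /= => /andP[c1 c2] /andP[d1 d2].
  have hx : `|x' - x| < d by rewrite ltr_norml; apply/andP; split; lra.
  have hy : `|y' - y| < d by rewrite ltr_norml; apply/andP; split; lra.
  have := H x' y' Ax' By' hx hy; rewrite ler_norml => /andP[+ _]; lra.
apply: measurableI => //; apply: countable_bigcupT_measurable => // q.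
by rewrite /F; case: asboolP => // _; apply: measurableX; exact: measurable_itv.
Qed.

Lemma tonelli_sets A B u : measurable (A : set RM) -> measurable (B : set RM) ->
  measurable_fun (A `*` B : set (RM * RM)) (fun p : RM * RM => u p.1 p.2) ->
  (forall x y, A x -> B y -> 0 <= u x y) ->
  [/\ (\int[(mu \x mu)%E]_(p in A `*` B) (u p.1 p.2)%:E =
       \int[mu]_(x in A) \int[mu]_(y in B) (u x y)%:E)%E,
      (\int[mu]_(x in A) \int[mu]_(y in B) (u x y)%:E =
       \int[mu]_(y in B) \int[mu]_(x in A) (u x y)%:E)%E &
      measurable_fun A (fun x => \int[mu]_(y in B) (u x y)%:E)%E].
Proof.
move=> mA mB mu2 u0; have mAB : measurable (A `*` B : set (RM * RM)) by exact: measurableX.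
pose v : RM * RM -> \bar R := (fun p : RM * RM => (u p.1 p.2)%:E) \_ (A `*` B).
have mv : measurable_fun [set: RM * RM] v.
  by apply/(measurable_restrictT _ mAB); exact/measurable_EFinP.
have v0 p : (0 <= v p)%E.
  by rewrite /v patchE; case: ifPn => //; rewrite inE => -[? ?]; rewrite lee_fin u0.
have FE : fubini_F mu v = (fun x => \int[mu]_(y in B) (u x y)%:E)%E \_ A.
  apply/funext => x; rewrite /fubini_F patchE; case: ifPn => [|] Ax.
    rewrite [RHS]integral_mkcond; apply: eq_integral => y _.
    rewrite /v !patchE; congr (if _ then _ else _).
    by apply/idP/idP; rewrite !inE => //=; [case|move=> By; split => //; rewrite inE in Ax].
  apply: integral0_eq => y _; rewrite /v patchE memNset //= => -[/= h _].
  by move/negP: Ax; rewrite inE.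
have GE : fubini_G mu v = (fun y => \int[mu]_(x in A) (u x y)%:E)%E \_ B.
  apply/funext => y; rewrite /fubini_G patchE; case: ifPn => [|] By.
    rewrite [RHS]integral_mkcond; apply: eq_integral => x _.
    rewrite /v !patchE; congr (if _ then _ else _).
    by apply/idP/idP; rewrite !inE => //=; [case|move=> Ax; split => //; rewrite inE in By].
  apply: integral0_eq => x _; rewrite /v patchE memNset //= => -[/= _ h].
  by move/negP: By; rewrite inE.
have h1 := fubini_tonelli1 (m1 := mu) (m2 := mu) v mv v0; have h2 := fubini_tonelli2 (m1 := mu) (m2 := mu) v mv v0.
rewrite FE in h1; rewrite GE in h2; split.
- by rewrite integral_mkcond h1 [RHS]integral_mkcond.
- by rewrite [LHS]integral_mkcond [RHS]integral_mkcond -h1 h2.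
have := measurable_fun_fubini_tonelli_F (m2 := mu) v mv v0; rewrite FE.
by move/(measurable_restrictT _ mA).
Qed.

Lemma cts2_slice A B u x : cts2 A B u -> A x -> forall y, B y ->
  u x y' @[y' --> within B (nbhs y)] --> u x y.
Proof.
move=> cu Ax y By; apply/cvgrPdist_le => e e0.
have [d d0 H] := cts2_eps cu Ax By e0.
rewrite near_withinE; apply/nbhs_ballP; exists d => // y' /=; rewrite -ball_normE /= distrC => h By'.
by rewrite distrC; apply: H => //; rewrite subrr normr0.
Qed.

Lemma cts2_swap A B u : cts2 A B u -> cts2 B A (fun y x => u x y).
Proof.
move=> cu y x By Ax; apply/cvgrPdist_le => e e0.
have [d d0 H] := cts2_eps cu Ax By e0.
rewrite near_withinE; exists (ball y d, ball x d); first by split; exact: nbhsx_ballx.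
move=> [y' x'] /= [h1 h2] [By' Ax']; rewrite distrC; apply: H => //.
  by move: h2; rewrite -ball_normE /= distrC.
by move: h1; rewrite -ball_normE /= distrC.
Qed.

Lemma within_cvgP (a b : R) (g : R -> R) :
  (forall x, a <= x <= b -> g x' @[x' --> within `[a, b]%classic (nbhs x)] --> g x) ->
  {within `[a, b], continuous g}.
Proof. by move=> H; apply/subspace_continuousP => x /=; rewrite in_itv /=; exact: H. Qed.

Lemma cts2_ig A c d u x : cts2 A `[c, d]%classic u -> A x -> ig c d (u x).
Proof.
move=> cu Ax; apply: ig_cont; apply: within_cvgP => y yP.
by apply: (cts2_slice cu) => //=; rewrite in_itv.
Qed.

Lemma cts2S A B A' B' u : A' `<=` A -> B' `<=` B -> cts2 A B u -> cts2 A' B' u.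
Proof.
move=> sA sB cu x y Ax By; apply/cvgrPdist_le => e e0.
have /cvgrPdist_le/(_ e e0) := cu x y (sA _ Ax) (sB _ By).
rewrite !near_withinE; apply: filterS => p h [/= ? ?]; apply: h.
by split; [exact: sA|exact: sB].
Qed.

(** Compactness of [c, d] makes the modulus of continuity at x uniform in y. *)
Lemma rint_param A c d u : c <= d -> cts2 A `[c, d]%classic u -> forall x, A x ->
  rint c d (u x') @[x' --> within A (nbhs x)] --> rint c d (u x).
Proof.
move=> cd cu x Ax; apply/cvgrPdist_le => e e0.
(* The 1 avoids a division by 0 when c = d. *)
have k0 : 0 < d - c + 1 by lra.
have e1 : 0 < e / (d - c + 1) by rewrite divr_gt0.
have e2 : 0 < e / (d - c + 1) / 2 by rewrite divr_gt0.
have N : \forall x' \near within A (nbhs x), `[c, d]%classic `<=`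
    (fun y => c <= y <= d -> A x' -> `|u x y - u x' y| <= e / (d - c + 1)).
  have /compact_near_coveringP := @segment_compact R c d; apply => y By.
  have [s s0 H] := cts2_eps cu Ax By e2.
  exists (ball y s, ball x s); first by split => /=; [exact: nbhsx_ballx|apply: filterS (nbhsx_ballx x s s0)].
  move=> [y' x'] /= [h1 h2] yP' Ax'; move: h1 h2; rewrite -!ball_normE /= distrC => h1; rewrite distrC => h2.
  have By' : `[c, d]%classic y' by rewrite /= in_itv.
  have xx : `|x - x| < s by rewrite subrr normr0.
  have k1 := H x' y' Ax' By' h2 h1; have k2 := H x y' Ax By' xx h1.
  rewrite (le_trans (ler_distD (u x y) _ _)) // (distrC (u x y)).
  by rewrite [leRHS](splitr (e / (d - c + 1))) lerD.
near=> x'.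
have Ax' : A x' by near: x'; exact: withinT.
have H : forall y, c <= y <= d -> `|u x y - u x' y| <= e / (d - c + 1).
  move=> y yP; have : `[c, d]%classic `<=` (fun y => c <= y <= d -> A x' -> `|u x y - u x' y| <= e / (d - c + 1)) by near: x'.
  by apply => //=; rewrite in_itv.
have i1 := cts2_ig cu Ax; have i2 := cts2_ig cu Ax'.
rewrite -rintB // (le_trans (rint_abs_le (igB i1 i2))) //.
apply: (@le_trans _ _ (rint c d (fun=> e / (d - c + 1)))).
  by apply: rint_le => //; [apply: ig_abs; exact: igB|exact: ig_cst].
rewrite rint_cst // mulrAC ler_pdivrMr //; nra.
Unshelve. all: end_near. Qed.

Lemma cts2_rint_within (a b : R) c d u : c <= d -> cts2 `[a, b]%classic `[c, d]%classic u ->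
  {within `[a, b], continuous (fun x => rint c d (u x))}.
Proof.
move=> cd cu; apply: within_cvgP => x xP; exact: rint_param.
Qed.

Lemma rint_swap (a b : R) c d u : a <= b -> c <= d -> cts2 `[a, b]%classic `[c, d]%classic u ->
  (forall x y, a <= x <= b -> c <= y <= d -> 0 <= u x y) ->
  rint a b (fun x => rint c d (u x)) = rint c d (fun y => rint a b (fun x => u x y)).
Proof.
move=> ab cd cu u0.
have cu' := cts2_swap cu.
have mu2 := cts2_measurable (measurable_itv _) (measurable_itv _) cu.
have u0' x y : `[a, b]%classic x -> `[c, d]%classic y -> 0 <= u x y.
  by rewrite /= !in_itv /=; exact: u0.
have [_ E _] := tonelli_sets (measurable_itv _) (measurable_itv _) mu2 u0'.
have i1 := ig_cont (cts2_rint_within cd cu).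
have i2 := ig_cont (cts2_rint_within ab cu').
apply: EFin_inj; rewrite -(integral_rint i1) -(integral_rint i2).
transitivity (\int[mu]_(x in `[a, b]) \int[mu]_(y in `[c, d]) (u x y)%:E)%E.
  by apply: eq_integral => x; rewrite inE => xP; rewrite integral_rint //; exact: cts2_ig cu xP.
rewrite E; apply: eq_integral => y; rewrite inE => yP; rewrite integral_rint //.
exact: cts2_ig cu' yP.
Qed.

End Rectangles.

(** * Joint continuity in polar coordinates *)

Section PolarContinuity.
Context {R : realType}.
Local Notation C := (Cplx R).
Implicit Types (A B : set R) (u v : R -> R -> R) (F G : R -> R -> C) (x y r t e : R).

Lemma cts2D A B u v : cts2 A B u -> cts2 A B v -> cts2 A B (fun x y => u x y + v x y).
Proof. by move=> hu hv x y Ax By; apply: cvgD; [exact: hu|exact: hv]. Qed.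

Lemma cts2M A B u v : cts2 A B u -> cts2 A B v -> cts2 A B (fun x y => u x y * v x y).
Proof. by move=> hu hv x y Ax By; apply: cvgM; [exact: hu|exact: hv]. Qed.

Lemma cts2_cst A B (k : R) : cts2 A B (fun _ _ => k).
Proof. by move=> x y Ax By; exact: cvg_cst. Qed.

Lemma cts2_comp A B u (g : R -> R) : cts2 A B u ->
  (forall x y, A x -> B y -> g s @[s --> u x y] --> g (u x y)) -> cts2 A B (fun x y => g (u x y)).
Proof.
move=> hu hg x y Ax By.
exact: (@cvg_comp _ _ _ (fun p : R * R => u p.1 p.2) g _ _ _ (hu x y Ax By) (hg x y Ax By)).
Qed.

Lemma cts2_fst_within A B (g : R -> R) :
  (forall x, A x -> g s @[s --> within A (nbhs x)] --> g x) -> cts2 A B (fun x _ => g x).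
Proof.
move=> hg x y Ax By; apply/cvgrPdist_le => e e0.
have /cvgrPdist_le/(_ e e0) := hg x Ax; rewrite !near_withinE => N.
exists ([set s | A s -> `|g x - g s| <= e], setT); first by split => //=; exact: filterT.
by move=> [s t] /= [h _] [As _]; exact: h.
Qed.

Lemma cts2_fst A B (g : R -> R) :
  (forall x, A x -> g s @[s --> x] --> g x) -> cts2 A B (fun x _ => g x).
Proof.
by move=> hg; apply: cts2_fst_within => x Ax; apply: cvg_within_filter; exact: hg.
Qed.

Lemma cts2_snd A B (g : R -> R) :
  (forall y, B y -> g s @[s --> y] --> g y) -> cts2 A B (fun _ y => g y).
Proof. by move=> hg; exact: (cts2_swap (cts2_fst (B := A) hg)). Qed.

Lemma cts2_snd_within A B (g : R -> R) :
  (forall y, B y -> g s @[s --> within B (nbhs y)] --> g y) -> cts2 A B (fun _ y => g y).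
Proof. by move=> hg; exact: (cts2_swap (cts2_fst_within (B := A) hg)). Qed.

Definition ccts2 A B F := forall x y, A x -> B y ->
  F p.1 p.2 @[p --> within (A `*` B) (nbhs (x, y))] --> F x y.

Lemma cvg_normcP {T : Type} {L : set_system T} {FL : Filter L} (g : T -> C) z :
  g @ L --> z <-> forall e : R, 0 < e -> \forall s \near L, normc (g s - z) < e.
Proof.
split=> [H e e0|H P /nbhs_normcP[e e0 eP]].
  by have := H _ (near_normc z e0).
by have := H e e0; apply: filterS => s; exact: eP.
Qed.

Lemma ccts2_polar A B u v : cts2 A B u -> cts2 A B v ->
  ccts2 A B (fun x y => polar (u x y) (v x y)).
Proof.
move=> hu hv x y Ax By; apply/cvg_normcP => e e0.
have cc : u p.1 p.2 * cos (v p.1 p.2) @[p --> within (A `*` B) (nbhs (x, y))] --> u x y * cos (v x y).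
  apply: cvgM; first exact: hu.
  exact: (@cvg_comp _ _ _ (fun p : R * R => v p.1 p.2) cos _ _ _ (hv x y Ax By) (@continuous_cos R _)).
have cs : u p.1 p.2 * sin (v p.1 p.2) @[p --> within (A `*` B) (nbhs (x, y))] --> u x y * sin (v x y).
  apply: cvgM; first exact: hu.
  exact: (@cvg_comp _ _ _ (fun p : R * R => v p.1 p.2) sin _ _ _ (hv x y Ax By) (@continuous_sin R _)).
have e2 : 0 < e / 3 by rewrite divr_gt0.
have /cvgrPdist_le/(_ _ e2) := cc; have /cvgrPdist_le/(_ _ e2) := cs.
apply: filterS2 => p h1 h2; rewrite normc_distC (le_lt_trans (normc_le_ReIm _)) // !ReImE /=.
lra.
Qed.

Lemma ccts2B A B F G : ccts2 A B F -> ccts2 A B G -> ccts2 A B (fun x y => F x y - G x y).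
Proof.
move=> hF hG x y Ax By; apply/cvg_normcP => e e0; have e2 : 0 < e / 2 by rewrite divr_gt0.
have /cvg_normcP/(_ _ e2) := hF x y Ax By; have /cvg_normcP/(_ _ e2) := hG x y Ax By.
apply: filterS2 => p h1 h2.
have -> : F p.1 p.2 - G p.1 p.2 - (F x y - G x y) = (F p.1 p.2 - F x y) - (G p.1 p.2 - G x y) by ring.
by rewrite (le_lt_trans (normc_sub _ _)) //; lra.
Qed.

Lemma ccts2_normc A B F : ccts2 A B F -> cts2 A B (fun x y => normc (F x y)).
Proof.
move=> hF x y Ax By; apply/cvgrPdist_le => e e0.
have /cvg_normcP/(_ _ e0) := hF x y Ax By; apply: filterS => p h.
rewrite distrC ltW // (le_lt_trans _ h) // ler_norml.
have := normc_sub_ge (F p.1 p.2) (F x y); have := normc_sub_ge (F x y) (F p.1 p.2).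
by rewrite (normc_distC (F x y)); lra.
Qed.

Lemma ccts2_normc2 A B F : ccts2 A B F -> cts2 A B (fun x y => normc (F x y) ^+ 2).
Proof. by move=> /ccts2_normc h; exact: cts2M. Qed.

Lemma ccts2_comp A B F (g : C -> C) : ccts2 A B F ->
  (forall x y, A x -> B y -> ccont g (F x y)) -> ccts2 A B (fun x y => g (F x y)).
Proof.
move=> hF hg x y Ax By.
apply: (@cvg_comp _ _ _ (fun p : R * R => F p.1 p.2) g _ _ _ (hF x y Ax By)).
by apply/ccontP; exact: hg.
Qed.

Lemma cts2_ccomp A B F (g : C -> R) : ccts2 A B F ->
  (forall x y, A x -> B y -> forall e, 0 < e -> \forall w \near F x y, `|g w - g (F x y)| <= e) ->
  cts2 A B (fun x y => g (F x y)).
Proof.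
move=> hF hg x y Ax By; apply/cvgrPdist_le => e e0.
have h : \forall p \near within (A `*` B) (nbhs (x, y)), `|g (F p.1 p.2) - g (F x y)| <= e.
  exact: (hF x y Ax By _ (hg x y Ax By e e0)).
by apply: filterS h => p; rewrite distrC.
Qed.

Lemma ccts2_lip A B F (alpha : R) (f : C -> C) : 0 < alpha -> lip_space alpha f -> ccts2 A B F ->
  (forall x y, A x -> B y -> normc (F x y) <= 1) -> ccts2 A B (fun x y => f (F x y)).
Proof.
move=> a0 lf hF F1 x y Ax By; apply/cvg_normcP => e e0; have e2 : 0 < e / 2 by rewrite divr_gt0.
have [d d0 H] := lip_unif a0 lf e2.
have /cvg_normcP/(_ _ d0) := hF x y Ax By; rewrite !near_withinE; apply: filterS => p h [/= Ap Bp].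
have := H _ _ (F1 _ _ Ap Bp) (F1 _ _ Ax By) (h (conj Ap Bp)); lra.
Qed.

Lemma ccts2_polar_id A B : ccts2 A B (fun r t => polar r t).
Proof.
by apply: ccts2_polar; [apply: cts2_fst => x _; exact: cvg_id|apply: cts2_snd => y _; exact: cvg_id].
Qed.

End PolarContinuity.

(** * The Dirichlet integral through energies of circles *)

Section Dirichlet.
Context {R : realType}.
Local Notation C := (Cplx R).
Local Notation pi2 := (2 * pi : R).
Local Notation mu := (@lebesgue_measure R).
Implicit Types (x y r t e d : R).

(** The Jacobian factor r is left out, as Hardy's inequality integrates against dr;
    [dirichlet_finite] and [dirichlet_le] pass between the two weights. *)
Definition circle_energy (G : C -> C) r : R := rint 0 pi2 (fun t => normc (G (polar r t)) ^+ 2).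

Lemma circle_energy_ge0 G r : 0 <= circle_energy G r.
Proof. by apply: rint_ge0 => t _; exact: exprn_ge0 (normc_ge0 _). Qed.

Variables (F F' : C -> C).
Hypothesis dF : forall z, normc z < 1 -> cdiff F z (F' z).
Hypothesis cF' : forall z, normc z < 1 -> ccont F' z.

Lemma cts2_deriv A : A `<=` `[0%R, 1%R[%classic ->
  cts2 A `[0, pi2]%classic (fun r t => normc (F' (polar r t)) ^+ 2).
Proof.
move=> AI; apply: ccts2_normc2; apply: ccts2_comp; first exact: ccts2_polar_id.
move=> r t /AI; rewrite /= in_itv /= => rP _; apply: cF'; exact: normc_polar_lt1.
Qed.

Lemma itv_sub r : r < 1 -> `[0%R, r]%classic `<=` `[0%R, 1%R[%classic.
Proof.
move=> r1 x; rewrite /= !in_itv /= => /andP[-> h] /=; exact: le_lt_trans h r1.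
Qed.

Let pi2_ge0 : 0 <= pi2. Proof. exact: ltW pi2_gt0. Qed.

Lemma circle_energy_cts r : r < 1 -> {within `[0, r], continuous (circle_energy F')}.
Proof.
by move=> r1; apply: cts2_rint_within => //; apply: cts2_deriv; exact: itv_sub.
Qed.

Lemma ig_circle_energy r : r < 1 -> ig 0 r (circle_energy F').
Proof. by move=> r1; apply: ig_cont; exact: circle_energy_cts. Qed.

Lemma dirichlet_integralE : measurable_fun (`[0%R, 1%R[%classic : set (measurableTypeR R)) (fun r => (r * circle_energy F' r)%:E) /\
  dirichlet_integral F = ((pi^-1)%:E * \int[mu]_(r in `[0%R, 1%R[) (r * circle_energy F' r)%:E)%E.
Proof.
pose u r t : R := r * normc (F' (polar r t)) ^+ 2.
have cu : cts2 `[0%R, 1%R[%classic `[0, pi2]%classic u.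
  apply: cts2M; last exact: cts2_deriv.
  by apply: cts2_fst => x _; exact: cvg_id.
have mI := @measurable_itv R `[0%R, 1%R[; have mT := @measurable_itv R `[0%R, pi2].
have mu2 := cts2_measurable mI mT cu.
have u0 r t : `[0%R, 1%R[%classic r -> `[0, pi2]%classic t -> 0 <= u r t.
  by rewrite /= in_itv /= => /andP[r0 _] _; rewrite mulr_ge0 // exprn_ge0 // normc_ge0.
have [E1 _ m1] := tonelli_sets mI mT mu2 u0.
have E r : `[0%R, 1%R[%classic r -> (\int[mu]_(t in `[0%R, pi2%R]) (u r t)%:E = (r * circle_energy F' r)%:E)%E.
  move=> rI; rewrite integral_rint; last exact: cts2_ig cu rI.
  congr (_%:E); rewrite /u rintZ //.
  exact: (cts2_ig (cts2_deriv (A := `[0%R, 1%R[%classic) (fun _ h => h)) rI).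
split.
  by apply: eq_measurable_fun m1 => r; rewrite inE => /E.
rewrite /dirichlet_integral; congr (_ * _)%E.
transitivity (\int[(mu \x mu)%E]_(p in (`[0%R, 1%R[%classic `*` `[0%R, pi2]%classic)) (u p.1 p.2)%:E)%E.
  apply: eq_integral => -[r t]; rewrite inE => -[/= rI tI]; congr (_%:E).
  rewrite /u mulrC; congr (_ * _ ^+ 2); congr normc; apply: cdiff_derive; apply: dF.
  by apply: normc_polar_lt1; move: rI; rewrite in_itv.
by rewrite E1; apply: eq_integral => r; rewrite inE => /E.
Qed.

(** For r >= 1/2 the missing factor costs 1 <= 2 r; for r <= 1/2 the energy is bounded by its
    maximum, attained at c. *)
Lemma dirichlet_finite : (dirichlet_integral F < +oo)%E ->
  exists2 D : R, 0 <= D & forall r, 0 <= r < 1 -> rint 0 r (circle_energy F') <= D.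
Proof.
have [mE ->] := dirichlet_integralE => fin.
set I := (X in (_ * X < _)%E) in fin.
have I0 : (0 <= I)%E.
  apply: integral_ge0 => r; rewrite /= in_itv /= => /andP[r0 _].
  by rewrite lee_fin mulr_ge0 // circle_energy_ge0.
have Ifin : (I < +oo)%E.
  rewrite ltey; apply/eqP => E; move: fin; rewrite E gt0_muley ?ltxx //.
  by rewrite lte_fin invr_gt0 pi_gt0.
have If : I \is a fin_num by rewrite ge0_fin_numE.
have h12 : (2^-1 : R) < 1 by exact: half_lt1.
have h02 : (0 : R) <= 2^-1 by rewrite invr_ge0.
have [c cP cmax] := EVT_max h02 (circle_energy_cts h12).
have K0 := circle_energy_ge0 F' c.
exists (2 * fine I + circle_energy F' c).
  by rewrite addr_ge0 // mulr_ge0 // fine_ge0.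
move=> r /andP[r0 r1]; have ie := ig_circle_energy r1.
have iu : ig 0 r (fun x => x * circle_energy F' x).
  apply: ig_cont; apply: within_cvgP => x xP; apply: cvgM; first by apply: cvg_within_filter; exact: cvg_id.
  have /subspace_continuousP := circle_energy_cts r1; apply.
  by rewrite /= in_itv.
have h : rint 0 r (fun x => x * circle_energy F' x) <= fine I.
  rewrite -lee_fin -integral_rint // fineK //.
  apply: ge0_subset_integral => //; last exact: itv_sub.
  by move=> x; rewrite /= in_itv /= => /andP[x0 _]; rewrite lee_fin mulr_ge0 // circle_energy_ge0.
have iK : ig 0 r (fun x => 2 * (x * circle_energy F' x)) by exact: igZ.
apply: (@le_trans _ _ (rint 0 r (fun x => 2 * (x * circle_energy F' x) + circle_energy F' c))).
  apply: rint_le => //; first by apply: igD => //; exact: ig_cst.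
  move=> x /andP[x0 xr]; have e0 := circle_energy_ge0 F' x.
  have [xh|xh] := leP x 2^-1.
    have := cmax x; rewrite in_itv /= x0 xh => /(_ isT) h2.
    rewrite (le_trans h2) // lerDr mulr_ge0 // mulr_ge0 //.
  have : 1 <= 2 * x by rewrite mulrC -ler_pdivrMr // mul1r ltW.
  by nra.
rewrite rintD //; last exact: ig_cst.
rewrite rintZ // rint_cst // subr0; nra.
Qed.

(** The weight r <= 1 is dropped on each disc of radius [radius j], and monotone convergence
    exhausts the open disc. *)
Lemma dirichlet_le e : (forall r, 0 <= r < 1 -> rint 0 r (circle_energy F') <= e) ->
  (dirichlet_integral F <= (pi^-1 * e)%:E)%E.
Proof.
move=> H; have [mE ->] := dirichlet_integralE.
rewrite EFinM; apply: lee_wpmul2l; first by rewrite lee_fin invr_ge0 pi_ge0.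
pose J (j : nat) : set R := `[0%R, radius j]%classic.
have JU : `[0%R, 1%R[%classic = \bigcup_j J j :> set R.
  apply/seteqP; split => x; last first.
    case=> j _; rewrite /J /= !in_itv /= => /andP[-> h] /=.
    by have /andP[_] := radiusP (R := R) j; exact: le_lt_trans.
  rewrite /= in_itv /= => /andP[x0 x1].
  near \oo => j; exists j => //; rewrite /J /= in_itv /= x0 /=.
  have : 1 - radius j < 1 - x by near: j; apply: radius_near; lra.
  lra.
have ndJ : nondecreasing_seq J.
  move=> m n mn; apply/subsetPset => x; rewrite /J /= !in_itv /= => /andP[-> h] /=.
  rewrite (le_trans h) // /radius lerD2l lerN2 lef_pV2 ?posrE ?ltr0n // ler_nat.
  by rewrite !ltnS.
have mJ j : measurable_fun (J j) (fun r => (r * circle_energy F' r)%:E).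
  apply: measurable_funS mE => //; apply: itv_sub.
  by have /andP[] := radiusP (R := R) j.
have f0 j x : J j x -> (0 <= (x * circle_energy F' x)%:E)%E.
  by rewrite /J /= in_itv /= => /andP[x0 _]; rewrite lee_fin mulr_ge0 // circle_energy_ge0.
have cv := ge0_nondecreasing_set_cvg_integral (mu := mu) ndJ (fun j => measurable_itv _) mJ f0.
rewrite JU; apply: (cvge_to_le cv); apply: nearW => j.
have /andP[j0 j1] := radiusP (R := R) j.
have ie := ig_circle_energy j1.
have iu : ig 0 (radius j) (fun x => x * circle_energy F' x).
  apply: ig_cont; apply: within_cvgP => x xP; apply: cvgM; first by apply: cvg_within_filter; exact: cvg_id.
  have /subspace_continuousP := circle_energy_cts j1; apply.
  by rewrite /= in_itv.
rewrite /J integral_rint // lee_fin (le_trans _ (H (radius j) _)) //; last by rewrite (ltW j0).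
apply: rint_le => // x /andP[x0 xj]; rewrite ler_piMl ?circle_energy_ge0 //; lra.
Unshelve. all: end_near. Qed.

End Dirichlet.

(** * Square integrability of the oscillation *)

Section PointwiseEnergy.
Context {R : realType}.
Local Notation C := (Cplx R).
Local Notation Re := (@complex.Re R).
Local Notation pi2 := (2 * pi : R).
Implicit Types (z w : C) (t x y r q d e : R).

(** The Cauchy-Schwarz inequality recovered from its AM-GM form. The choice c = h / (2 A) absorbs
    half of h; for h = 0 the hypothesis with a small c still forces W >= 0. *)
Lemma sqr_le_amgm (h A W : R) : 0 <= h -> 0 < A ->
  (forall c : R, 0 < c -> h <= c * A + c^-1 * W) -> h ^+ 2 <= 4 * (A * W).
Proof.
move=> h0 A0 H; have [->|hn] := eqVneq h 0.
  have W0 : 0 <= W.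
    rewrite leNgt; apply/negP => Wn; have c0 : 0 < Num.sqrt (- W / (2 * A)).
      by rewrite sqrtr_gt0 divr_gt0 ?oppr_gt0 // mulr_gt0.
    have := H _ c0; set c := Num.sqrt _ in c0 *.
    have cE : c ^+ 2 = - W / (2 * A) by rewrite sqr_sqrtr // divr_ge0 ?oppr_ge0 ?(ltW Wn) // mulr_ge0 // ltW.
    have : h * c <= (c * A + c^-1 * W) * c by rewrite ler_wpM2r ?(ltW c0) // H.
    have -> : (c * A + c^-1 * W) * c = c ^+ 2 * A + W by field; rewrite gt_eqF.
    rewrite cE (_ : - W / (2 * A) * A = - W / 2); last by field; rewrite gt_eqF.
    by have := mulr_ge0 h0 (ltW c0); lra.
  by rewrite expr0n /= mulr_ge0 // mulr_ge0 // ltW.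
have {hn}hp : 0 < h by rewrite lt_def hn.
have c0 : 0 < h / (2 * A) by rewrite divr_gt0 // mulr_gt0.
have := H _ c0; have -> : h / (2 * A) * A = h / 2 by field; rewrite gt_eqF.
have -> : (h / (2 * A))^-1 * W = 2 * (A * W) / h by field; rewrite !gt_eqF.
move=> h1; have : (h - h / 2) * h <= 2 * (A * W) / h * h by rewrite ler_wpM2r ?(ltW hp) //; lra.
rewrite divfK ?gt_eqF //; lra.
Qed.

Lemma rint_sqr_le (g : R -> R) : {within `[0, 1], continuous g} ->
  rint 0 1 g ^+ 2 <= rint 0 1 (fun s => g s ^+ 2).
Proof.
move=> cg; set m := rint 0 1 g.
have ig1 := ig_cont cg.
have cg2 : {within `[0, 1], continuous (fun s => g s ^+ 2)}.
  apply: within_cvgP => s sP; have h : g s' @[s' --> within `[0, 1]%classic (nbhs s)] --> g s.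
    by have /subspace_continuousP := cg; apply; rewrite /= in_itv.
  by apply: cvgM; exact: h.
have ig2 := ig_cont cg2.
have i3 : ig 0 1 (fun s => 2 * m * g s) by exact: igZ.
have : rint 0 1 (fun s => 2 * m * g s) <= rint 0 1 (fun s => g s ^+ 2 + m ^+ 2).
  apply: rint_le => //; first by apply: igD => //; exact: ig_cst.
  by move=> s _; have := sqr_ge0 (g s - m); rewrite sqrrB; lra.
rewrite rintZ // rintD //; last exact: ig_cst.
rewrite rint_cst // subr0 -/m; nra.
Qed.

Variables (alpha : R) (f : C -> C).
Hypotheses (alpha_gt0 : 0 < alpha) (alpha_le : alpha <= 2^-1).
Hypothesis lipf : lip_space alpha f.

(** Makes the integrand of [osc_energy] jointly continuous. The change of the kernel and the change
    of f z contribute e / 2 each: 8 B k1 / (1 - |z|)^2 = e / 2 for the first. *)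
Lemma omega_cts z e : normc z < 1 -> 0 < e -> \forall w \near z, `|omega f w - omega f z| <= e.
Proof.
move=> z1 e0; have d0 : 0 < 1 - normc z by lra.
have [B B0 fB] := lip_bounded alpha_gt0 lipf.
pose k1 : R := e * (1 - normc z) ^+ 2 / (16 * B).
have k10 : 0 < k1 by rewrite divr_gt0 ?mulr_gt0 // exprn_gt0.
have k2 : 0 < e * (1 - normc z) / 4 by rewrite divr_gt0 ?mulr_gt0.
have d2 : 0 < (1 - normc z) / 2 by rewrite divr_gt0.
have cf := cdiff_cont (lip_cdiff lipf z1) k2.
near=> w.
have wk : normc (w - z) < k1 by near: w; exact: near_normc.
have wd : normc (w - z) < (1 - normc z) / 2 by near: w; exact: near_normc.
have fw : normc (f w - f z) <= e * (1 - normc z) / 4 by near: w.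
have w2 : (1 - normc z) / 2 <= 1 - normc w by have := normc_sub_ge w z; lra.
have w1 : normc w < 1 by lra.
have key t : `|poisson z t * normc (f (cis t) - f z) - poisson w t * normc (f (cis t) - f w)| <= e.
  set a := normc (f (cis t) - f z); set b := normc (f (cis t) - f w).
  have -> : poisson z t * a - poisson w t * b = (poisson z t - poisson w t) * b + poisson z t * (a - b) by ring.
  have b2 : b <= 2 * B.
    rewrite (le_trans (normc_sub _ _)) // mulr_natl mulr2n lerD // fB //; last exact: ltW.
    by rewrite normc_cis.
  have ab : `|a - b| <= e * (1 - normc z) / 4.
    rewrite (le_trans _ fw) // (le_trans (normc_dist_le _ _)) //.
    by rewrite (_ : f (cis t) - f z - (f (cis t) - f w) = f w - f z) //; ring.
  have pp : `|poisson z t - poisson w t| <= 4 * k1 / (1 - normc z) ^+ 2.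
    have D1 := dist_cis_neq0 t z1; have D2 := dist_cis_neq0 t w1.
    have E : poisson z t - poisson w t = Re (hker z t - hker w t) by rewrite cReD cReN !Re_hker.
    rewrite E (le_trans (Re_le_normc _)) //.
    have -> : hker z t - hker w t = 2 * cis t * (z - w) / ((cis t - z) * (cis t - w)).
      rewrite /hker; move: D1 D2; move: (cis t) => c D1 D2.
      apply: (canRL (mulfK (mulf_neq0 D1 D2))).
      rewrite mulrBl mulrA divfK // [(c - z) * _]mulrC mulrA divfK //; ring.
    rewrite normc_div !normc_mul normc_cis.
    have -> : normc (2 : C) = 2.
      have -> : (2 : C) = rc 2 by apply: complex_eq; rewrite !ReImE /= ?addr0.
      by rewrite normc_rc ger0_norm.
    rewrite mulr1 (normc_distC z w).
    have -> : 4 * k1 / (1 - normc z) ^+ 2 = (2 * k1) * ((1 - normc z) * ((1 - normc z) / 2))^-1.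
      by field; rewrite gt_eqF.
    apply: ler_pM; rewrite ?mulr_ge0 ?invr_ge0 ?mulr_ge0 ?normc_ge0 //.
      by rewrite ler_wpM2l // ltW.
    rewrite lef_pV2 ?posrE ?mulr_gt0 ?dist_cis_gt0 //.
    apply: ler_pM; rewrite ?(ltW d0) ?(ltW d2) ?dist_cis_ge //.
    exact: le_trans w2 (dist_cis_ge w t).
  have pz := poisson_le_cst t z1; have pz0 := ltW (poisson_gt0 t z1).
  have b0 : 0 <= b by exact: normc_ge0.
  rewrite (le_trans (ler_normD _ _)) // (normrM (_ - _)) (normrM (poisson z t)) (ger0_norm b0) (ger0_norm pz0).
  have h1 : `|poisson z t - poisson w t| * b <= 4 * k1 / (1 - normc z) ^+ 2 * (2 * B).
    by apply: ler_pM => //; exact: normc_ge0.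
  have h2 : poisson z t * `|a - b| <= 2 / (1 - normc z) * (e * (1 - normc z) / 4) by apply: ler_pM.
  rewrite (le_trans (lerD h1 h2)) // le_eqVlt; apply/orP; left; apply/eqP.
  by rewrite /k1; field; rewrite !gt_eqF.
have i1 := iga_osc alpha_gt0 lipf z1; have i2 := iga_osc alpha_gt0 lipf w1.
rewrite distrC /omega -avgB // ler_norml; apply/andP; split.
  rewrite -[leLHS]avg_cst; apply: avg_le; [exact: ig_cst|exact: igB|].
  by move=> t; have := key t; rewrite ler_norml => /andP[].
rewrite -[leRHS]avg_cst; apply: avg_le; [exact: igB|exact: ig_cst|].
by move=> t; have := key t; rewrite ler_norml => /andP[].
Unshelve. all: end_near. Qed.

Definition osc2 r t x : R := normc (f (cis (t + x)) - f (polar r t)) ^+ 2.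

Lemma osc2_ge0 r t x : 0 <= osc2 r t x.
Proof. exact: exprn_ge0 (normc_ge0 _). Qed.

(* Cauchy-Schwarz with the weights [|zeta - z|^(-3/2)] and [|zeta - z|^(-5/2)], whose
   geometric mean is the [|zeta - z|^(-2)] of the Poisson kernel. *)
Lemma omega_sqr r t : 0 <= r < 1 -> 0 <= t <= pi2 ->
  (omega f (polar r t) / (1 - r)) ^+ 2 <= 108 * 243 / Num.sqrt (1 - r) *
    rint 0 1 (fun q => w52 ((1 - r) + (1 - q)) *
      (osc2 r t (pi * (1 - q)) + osc2 r t (- (pi * (1 - q))))).
Proof.
move=> rP tP; have /andP[r0 r1] := rP; set z := polar r t.
have z1 : normc z < 1 by exact: normc_polar_lt1.
have nz : normc z = r by rewrite normc_polar.
have d0 : 0 < 1 - r by lra.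
have sd0 : 0 < Num.sqrt (1 - r) by rewrite sqrtr_gt0.
pose D s := normc (cis s - z).
have D0 s : 0 < D s by exact: dist_cis_gt0.
pose g s := w52 (D s) * normc (f (cis s) - f z) ^+ 2.
have cD s : D s' @[s' --> s] --> D s.
  apply: (@rcont_normc _ (fun s => cis s - z)).
  by apply: rcontB; [exact: rcont_cis|exact: rcont_cst].
have cf s : normc (f (cis s') - f z) ^+ 2 @[s' --> s] --> normc (f (cis s) - f z) ^+ 2.
  by apply: cvgM; exact: lip_dist_rcts alpha_gt0 lipf (f z) s.
have cg : rcts g by move=> s; apply: cvgM (cf s); exact: cts_w52 (D0 s) (cD s).
have cw : rcts (fun s => w32 (D s)) by move=> s; exact: cts_w32 (D0 s) (cD s).
have pg : per g by move=> s; rewrite /g /D cisD2pi.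
set W := rint 0 1 _.
have avg_g : avg g <= 243 / 2 * W.
  rewrite (avg_symm cg pg tP) -/W.
  have h q : 0 <= q <= 1 -> g (t + pi * (1 - q)) + g (t - pi * (1 - q)) <=
      243 * (w52 ((1 - r) + (1 - q)) * (osc2 r t (pi * (1 - q)) + osc2 r t (- (pi * (1 - q))))).
    move=> qP; have p2 := pi_ge2 R.
    have xP : 0 <= pi * (1 - q) <= pi by apply/andP; split; nra.
    have rP' : 0 <= r <= 1 by rewrite r0 ltW.
    have [h1 h2] := dist_cis_polar_sub t rP' xP; rewrite -/z in h1 h2.
    have s0 : 0 < (1 - r) + (1 - q) by lra.
    have le1 : (1 - r) + (1 - q) <= 1 - r + pi * (1 - q) by nra.
    have bound s : 1 - r + (1 - q) <= 9 * normc (cis s - z) ->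
        g s <= 243 * w52 ((1 - r) + (1 - q)) * normc (f (cis s) - f z) ^+ 2.
      move=> hs; rewrite ler_wpM2r ?exprn_ge0 ?normc_ge0 //.
      by rewrite -w52_scale // w52_anti ?divr_gt0 // ler_pdivrMr // mulrC.
    have k1 := bound _ (le_trans le1 h1); have k2 := bound _ (le_trans le1 h2).
    by rewrite (le_trans (lerD k1 k2)) // -mulrDr mulrA.
  have cosc (u : R -> R) q : u p @[p --> q] --> u q -> osc2 r t (u p) @[p --> q] --> osc2 r t (u q).
    move=> cu; apply: (@cvg_comp _ _ _ (fun q => t + u q) (fun s => normc (f (cis s) - f z) ^+ 2)); last exact: cf.
    by apply: cvgD => //; exact: cvg_cst.
  have iW : ig 0 1 (fun q => w52 ((1 - r) + (1 - q)) * (osc2 r t (pi * (1 - q)) + osc2 r t (- (pi * (1 - q))))).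
    apply: ig_cont; apply: cts_within => q qP; apply: cvgM.
      apply: (@cts_w52 _ (fun q => 1 - r + (1 - q))); first by lra.
      by apply: cvgD; [exact: cvg_cst|exact: cvg_one_sub].
    have cq : pi * (1 - p) @[p --> q] --> (pi * (1 - q) : R).
      by apply: cvgM; [exact: cvg_cst|exact: cvg_one_sub].
    by apply: cvgD; [exact: (cosc (fun q => pi * (1 - q)))|apply: (cosc (fun q => - (pi * (1 - q)))); exact: cvgN].
  have -> : 243 / 2 * W = 2^-1 * (243 * W) by field.
  rewrite ler_wpM2l ?invr_ge0 // -rintZ //; apply: rint_le => //; last exact: igZ.
  apply: ig_cont; apply: rcts_within => q; apply: cvgD.
    apply: (@cvg_comp _ _ _ (fun q => t + pi * (1 - q)) g); last exact: cg.
    by apply: cvgD; [exact: cvg_cst|apply: cvgM; [exact: cvg_cst|exact: cvg_one_sub]].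
  apply: (@cvg_comp _ _ _ (fun q => t - pi * (1 - q)) g); last exact: cg.
  by apply: cvgB; [exact: cvg_cst|apply: cvgM; [exact: cvg_cst|exact: cvg_one_sub]].
have A0 : 0 < 54 / Num.sqrt (1 - r) by rewrite divr_gt0.
have om := omega_ge0 f z1.
have i1 : iga (fun s => poisson z s * normc (f (cis s) - f z)) := iga_osc alpha_gt0 lipf z1.
have amgm c : 0 < c -> omega f z / (1 - r) <= c * (54 / Num.sqrt (1 - r)) + c^-1 * (243 / 2 * W).
  move=> c0; have ci : 0 < c^-1 by rewrite invr_gt0.
  rewrite ler_pdivrMr //.
  have step : omega f z <= avg (fun s => (1 - r) * (c * w32 (D s) + c^-1 * g s)).
    apply: avg_le.
    - exact: i1.
    - by apply: igZ; apply: igD; apply: igZ; exact: iga_rcts.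
    move=> s; set Ds := normc (f (cis s) - f z).
    have Ds0 : 0 <= Ds by exact: normc_ge0.
    have := poisson_le s z1; rewrite nz -/(D s) => hp.
    rewrite (le_trans (ler_wpM2r Ds0 hp)) // /g -/Ds.
    have sD : 0 < Num.sqrt (D s) by rewrite sqrtr_gt0.
    set k := Num.sqrt (D s) in sD; have Dk : D s = k ^+ 2 by rewrite sqr_sqrtr // ltW.
    rewrite /w32 /w52 -/k Dk.
    have -> : 2 * (1 - r) / k ^+ 2 ^+ 2 * Ds = (1 - r) * (2 * Ds / k ^+ 2 ^+ 2) by ring.
    rewrite ler_wpM2l ?(ltW d0) //.
    rewrite -subr_ge0.
    have -> : c * (k ^+ 2 * k)^-1 + c^-1 * ((k ^+ 2 ^+ 2 * k)^-1 * Ds ^+ 2) - 2 * Ds / k ^+ 2 ^+ 2 =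
      (c * k - Ds) ^+ 2 / (c * (k ^+ 2 ^+ 2 * k)) by field; rewrite !gt_eqF.
    by rewrite divr_ge0 ?sqr_ge0 // ltW // !mulr_gt0 // !exprn_gt0.
  rewrite (le_trans step) // avgZ; last by apply: igD; apply: igZ; exact: iga_rcts.
  rewrite avgD ?avgZ; try (by apply: igZ; exact: iga_rcts); try exact: iga_rcts.
  rewrite mulrC ler_wpM2r ?(ltW d0) // lerD //.
    rewrite ler_wpM2l ?(ltW c0) //.
    by have := avg_w32 z1; rewrite nz.
  by rewrite ler_wpM2l ?(ltW ci).
(* The constant is 4 * 54 * (243 / 2) = 108 * 243. *)
rewrite (le_trans (sqr_le_amgm _ A0 amgm)) ?divr_ge0 ?(ltW d0) //.
by rewrite le_eqVlt; apply/orP; left; apply/eqP; field; rewrite gt_eqF.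
Qed.

End PointwiseEnergy.

(** * Translation along circles and Hardy's inequality along radii *)

Section CircleEstimates.
Context {R : realType}.
Local Notation C := (Cplx R).
Local Notation Re := (@complex.Re R).
Local Notation Im := (@complex.Im R).
Local Notation pi2 := (2 * pi : R).
Implicit Types (z w : C) (t x y r q d e s : R).

Lemma polar1 t : polar 1 t = cis t :> C.
Proof. by rewrite polarE; exact: mul1r. Qed.

Lemma ccts2_cis (A B : set R) (v : R -> R -> R) : cts2 A B v -> ccts2 A B (fun x y => cis (v x y)).
Proof.
move=> hv; have := ccts2_polar (@cts2_cst R A B 1) hv.
by rewrite (_ : (fun x y => polar 1 (v x y)) = (fun x y => cis (v x y))) //; apply/funext => x; apply/funext => y; rewrite polar1.
Qed.

Lemma rcont_real_comp (F : R -> C) (l : R -> R) s : rcont F (l s) -> l y @[y --> s] --> l s ->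
  rcont (fun y => F (l y)) s.
Proof. by move=> hF hl e e0; exact: (hl _ (hF e e0)). Qed.

Lemma affine_cvg t x s : t + y * x @[y --> s] --> (t + s * x : R).
Proof. by apply: cvgD; [exact: cvg_cst|apply: cvgM; [exact: cvg_id|exact: cvg_cst]]. Qed.

(** Writes the arc as the restriction to real s of a complex differentiable map, so that the complex
    chain rule and [cdiff_Re] give real derivatives along it. *)
Lemma polar_cexp q t x s : polar q (t + s * x) = rc q * cexp (Complex 0 1 * (rc t + rc s * rc x)).
Proof.
rewrite polarE; congr (_ * _).
have -> : Complex 0 1 * (rc t + rc s * rc x) = Complex 0 (t + s * x).
  by apply: complex_eq; rewrite !ReImE /=; ring.
rewrite /cexp [complex.Re _]/= [complex.Im _]/= expR0; symmetry; exact: mul1r.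
Qed.

Variables (alpha : R) (f : C -> C).
Hypotheses (alpha_gt0 : 0 < alpha) (alpha_le : alpha <= 2^-1).
Hypothesis lipf : lip_space alpha f.

Local Notation df := (fun z => 'D_1 f z).

Lemma rcts_deriv_arc q t x : 0 <= q < 1 -> rcts (fun s => normc (df (polar q (t + s * x)))).
Proof.
move=> qP s; apply: (@rcont_normc _ (fun s => df (polar q (t + s * x)))).
apply: (rcont_real_comp (F := fun t => df (polar q t)) (l := fun s => t + s * x)); last exact: affine_cvg.
apply: (rcont_comp (H := df)); first exact: rcont_polar.
exact: (deriv_ccont alpha_gt0 lipf (normc_polar_lt1 _ qP)).
Qed.

(** The increment is at most |x| times the mean of |f'| over the arc, since the speed is q |x| <=
    |x|; the square of a mean is at most the mean of the squares. *)
Lemma arc_sqr q t x : 0 <= q < 1 ->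
  normc (f (polar q (t + x)) - f (polar q t)) ^+ 2 <=
  x ^+ 2 * rint 0 1 (fun s => normc (df (polar q (t + s * x))) ^+ 2).
Proof.
move=> qP; have /andP[q0 q1] := qP.
set v := f _ - _; have [u1 uv] := cunitP v; set u := cunit v in u1 uv.
pose Lc s : C := 'D_1 f (polar q (t + s * x)) * (polar q (t + s * x) * (Complex 0 1 * rc x)).
pose g s := normc (df (polar q (t + s * x))).
have cg : rcts g by exact: rcts_deriv_arc.
have dG s : is_derive s 1 (fun s => Re (u * f (polar q (t + s * x)))) (Re (u * Lc s)).
  rewrite (_ : (fun s => _) = (fun s => Re (u * f (rc q * cexp (Complex 0 1 * (rc t + rc s * rc x)))))); last first.
    by apply/funext => s'; rewrite polar_cexp.
  apply: (@cdiff_Re R (fun w => u * f (rc q * cexp (Complex 0 1 * (rc t + w * rc x))))).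
  have dA := cdiffD (cdiff_cst (rc t) (rc s)) (cdiffM (cdiff_id (rc s)) (cdiff_cst (rc x) (rc s))).
  have dQ := cdiffZ (rc q) (cdiff_comp (cdiffZ (Complex 0 1) dA) (cdiff_exp _)).
  have p1 : normc (rc q * cexp (Complex 0 1 * (rc t + rc s * rc x))) < 1.
    by rewrite -polar_cexp normc_polar_lt1.
  have := cdiffZ u (cdiff_comp dQ (lip_cdiff lipf p1)).
  congr (cdiff _ _ _); rewrite /Lc polar_cexp; congr (_ * (_ * _)).
  by rewrite mul1r mulr0 addr0 add0r mulrA.
have Lg s : Re (u * Lc s) <= `|x| * g s.
  rewrite (le_trans (Re_mul_le _ u1)) // /Lc !normc_mul normc_polar // normc_rc /g.
  have -> : normc (Complex 0 1 : C) = 1 by rewrite normcE /= expr0n /= expr1n add0r sqrtr1.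
  rewrite mul1r mulrC [q * _]mulrC -mulrA ler_wpM2l // ler_piMl ?normc_ge0 // ltW //.
have [A dA] := primitive 0 1 cg.
have dm s : 0 <= s <= 1 -> is_derive s 1 (fun s => Re (u * f (polar q (t + s * x))) - `|x| * A s)
    (Re (u * Lc s) - (0 * A s + `|x| * g s)).
  by move=> sP; exact: (rderB (dG s) (rderM (rder_cst `|x| s) (dA s sP))).
have := mono_le ler01 dm; rewrite !mul1r !mul0r addr0 => /(_ _) h.
have v_le : normc v <= `|x| * rint 0 1 g.
  rewrite -uv (rintE ler01 (rcts_within cg) dA).
  have -> : Re (u * v) = Re (u * f (polar q (t + x))) - Re (u * f (polar q t)).
    by rewrite /v mulrBr !ReImE.
  have := h _; rewrite mulrBr => {}h.
  have : Re (u * f (polar q (t + x))) - `|x| * A 1 <= Re (u * f (polar q t)) - `|x| * A 0.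
    by apply: h => s _; have := Lg s; rewrite mul0r add0r; lra.
  lra.
have i0 : 0 <= rint 0 1 g by apply: rint_ge0 => s _; exact: normc_ge0.
have := rint_sqr_le (rcts_within (a := 0) (b := 1) cg) => sq.
apply: (@le_trans _ _ ((`|x| * rint 0 1 g) ^+ 2)).
  by rewrite ler_pXn2r ?nnegrE ?normc_ge0 ?mulr_ge0.
rewrite exprMn real_normK ?num_real // ler_wpM2l ?sqr_ge0 //.
Qed.

Lemma circle_deriv_shift q x : 0 <= q < 1 -> `|x| <= 4 ->
  rint 0 pi2 (fun t => normc (df (polar q (t + x))) ^+ 2) = circle_energy df q.
Proof.
move=> qP x4; pose g t := normc (df (polar q t)) ^+ 2.
have cg : rcts g.
  move=> t; have h : rcts (fun s => normc (df (polar q (0 + s * 1)))) by exact: rcts_deriv_arc.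
  rewrite (_ : (fun s => _) = (fun s => normc (df (polar q s)))) in h; last first.
    by apply/funext => s; rewrite add0r mulr1.
  exact: cvgM (h t) (h t).
have pg : per g by move=> t; rewrite /g !polarE cisD2pi.
exact: (rint_shift cg pg x4).
Qed.

Let pi2_ge0 : 0 <= pi2. Proof. exact: ltW pi2_gt0. Qed.

(** [arc_sqr] is integrated in t; after exchanging the integrals, rotation invariance makes the
    inner one independent of s. *)
Lemma translate_energy q x : 0 <= q < 1 -> `|x| <= 4 ->
  rint 0 pi2 (fun t => normc (f (polar q (t + x)) - f (polar q t)) ^+ 2) <=
  x ^+ 2 * circle_energy df q.
Proof.
move=> qP x4; have /andP[q0 q1] := qP.
have cpol (A B : set R) (v : R -> R -> R) : cts2 A B v -> ccts2 A B (fun t s => polar q (v t s)).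
  by move=> hv; apply: ccts2_polar => //; exact: cts2_cst.
have n1 t : normc (polar q t) <= 1 by rewrite normc_polar // ltW.
have cf (A B : set R) (v : R -> R -> R) : cts2 A B v -> ccts2 A B (fun t s => f (polar q (v t s))).
  by move=> hv; apply: ccts2_lip alpha_gt0 lipf (cpol _ _ _ hv) _.
have ct (A B : set R) : cts2 A B (fun t _ => t) by apply: cts2_fst => y _; exact: cvg_id.
have cs (A B : set R) : cts2 A B (fun _ s => s) by apply: cts2_snd => y _; exact: cvg_id.
have cL : cts2 `[0, pi2]%classic `[0, 1]%classic (fun t s => normc (f (polar q (t + x)) - f (polar q t)) ^+ 2).
  by apply: ccts2_normc2; apply: ccts2B; apply: cf => //; apply: cts2D => //; exact: cts2_cst.
have cR : cts2 `[0, pi2]%classic `[0, 1]%classic (fun t s => normc (df (polar q (t + s * x))) ^+ 2).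
  apply: ccts2_normc2; apply: (ccts2_comp (g := df)).
    by apply: cpol; apply: cts2D => //; apply: cts2M => //; exact: cts2_cst.
  by move=> *; exact: (deriv_ccont alpha_gt0 lipf (normc_polar_lt1 _ qP)).
have iL : ig 0 pi2 (fun t => normc (f (polar q (t + x)) - f (polar q t)) ^+ 2).
  by have := cts2_ig (cts2_swap cL) (x := 0); apply; rewrite /= in_itv /= lexx ler01.
have iR : ig 0 pi2 (fun t => rint 0 1 (fun s => normc (df (polar q (t + s * x))) ^+ 2)).
  by apply: ig_cont; exact: cts2_rint_within.
apply: (@le_trans _ _ (rint 0 pi2 (fun t => x ^+ 2 * rint 0 1 (fun s => normc (df (polar q (t + s * x))) ^+ 2)))).
  by apply: rint_le => //; [exact: igZ|move=> t _; exact: arc_sqr].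
rewrite rintZ // ler_wpM2l ?sqr_ge0 // rint_swap //; last by move=> *; exact: exprn_ge0 (normc_ge0 _).
rewrite (rint_eq (g := fun=> circle_energy df q)); first by rewrite rint_cst // subr0 mulr1.
move=> s /andP[s0 s1]; apply: circle_deriv_shift => //.
by rewrite normrM (ger0_norm s0) (le_trans _ x4) // ler_piMl.
Qed.

(* Hardy's inequality: [|f (rho e) - f (r e)|^2 / (1 - r)] vanishes at [r = rho], so its
   derivative has nonpositive integral; the cross term is absorbed by AM-GM. *)
Lemma hardy_ray rho t : 0 <= rho < 1 ->
  rint 0 rho (fun r => normc (f (polar rho t) - f (polar r t)) ^+ 2 / (1 - r) ^+ 2) <=
  4 * rint 0 rho (fun r => normc (df (polar r t)) ^+ 2).
Proof.
move=> /andP[rho0 rho1].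
(* The end point is polar rho t rather than cis t, so that [V] is differentiable up to r = rho.
   [hardy_gap] moves the end point to the circle. *)
pose V r : C := f (polar rho t) - f (polar r t).
pose V' r : C := - (df (polar r t) * cis t).
pose b r := Re (V r) * Re (V r) + Im (V r) * Im (V r).
pose a r : R := (1 - r)^-1.
pose m' r := (Re (V' r) * Re (V r) + Re (V r) * Re (V' r) + (Im (V' r) * Im (V r) + Im (V r) * Im (V' r))) * a r
  + b r * a r ^+ 2.
have p1 r : 0 <= r <= rho -> normc (polar r t) < 1.
  by move=> /andP[r0 rr]; apply: normc_polar_lt1; rewrite r0 (le_lt_trans rr).
have dV r : 0 <= r <= rho -> cdiff (fun w => f (polar rho t) - f (w * cis t)) (rc r) (V' r).
  move=> rP; have dl := cdiffM (cdiff_id (rc r)) (cdiff_cst (cis t) (rc r)).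
  have pr : normc (rc r * cis t) < 1 by rewrite -polarE p1.
  have := cdiffB (cdiff_cst (f (polar rho t)) (rc r)) (cdiff_comp dl (lip_cdiff lipf pr)).
  have -> : 1 * cis t + rc r * 0 = cis t by rewrite mul1r mulr0 addr0.
  by rewrite sub0r /V' [polar r t]polarE.
have dRe r : 0 <= r <= rho -> is_derive r 1 (fun r => Re (V r)) (Re (V' r)).
  move=> /dV /cdiff_Re; rewrite (_ : (fun r => Re (V r)) = (fun t0 => Re (f (polar rho t) - f (rc t0 * cis t)))) //.
  by apply/funext => s; rewrite /V [polar s t]polarE.
have dIm r : 0 <= r <= rho -> is_derive r 1 (fun r => Im (V r)) (Im (V' r)).
  (* The imaginary part is the real part after multiplication by -i. *)
  move=> /dV /(cdiffZ (Complex 0 (-1))) /cdiff_Re.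
  rewrite (_ : (fun r => Im (V r)) = (fun t0 => Re (Complex 0 (-1) * (f (polar rho t) - f (rc t0 * cis t))))).
    by rewrite [Re (_ * V' r)]cReM /= mul0r mulN1r sub0r opprK.
  by apply/funext => s; rewrite /V [polar s t]polarE [RHS]cReM /= mul0r mulN1r sub0r opprK.
have da r : 0 <= r <= rho -> is_derive r 1 a (a r ^+ 2).
  move=> /andP[r0 rr]; have n0 : 1 - r != 0 by rewrite gt_eqF // subr_gt0 (le_lt_trans rr).
  have h := rderB (rder_cst 1 r) (rder_id r).
  have h2 := @is_deriveV R (fun r => 1 - r) r _ 1 n0 h.
  apply: is_derive_eq h2 _.
  by rewrite /GRing.scale /= sub0r mulNr mulrN opprK mulr1 /a exprVn.
have dm r : 0 <= r <= rho -> is_derive r 1 (fun r => b r * a r) (m' r).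
  move=> rP; have dR := dRe r rP; have dI := dIm r rP.
  exact: rderM (rderD (rderM dR dR) (rderM dI dI)) (da r rP).
have crV r : 0 <= r <= rho -> rcont V r /\ rcont V' r.
  move=> rP; have cl : rcont (fun r => polar r t) r.
    have := rcontM (rcont_rc r) (rcont_cst (cis t) r).
    by rewrite (_ : (fun y => _) = (fun r => polar r t)) //; apply/funext => s; rewrite polarE.
  split.
    apply: rcontB; first exact: rcont_cst.
    by apply: (rcont_comp (H := f)) cl _; exact: cdiff_cont (lip_cdiff lipf (p1 _ rP)).
  apply: rcontN; apply: rcontM; last exact: rcont_cst.
  by apply: (rcont_comp (H := df)) cl _; exact: (deriv_ccont alpha_gt0 lipf (p1 _ rP)).
have ca r : 0 <= r <= rho -> a s @[s --> r] --> a r.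
  move=> /andP[r0 rr]; apply: cvgV; last exact: cvg_one_sub.
  by rewrite gt_eqF // subr_gt0 (le_lt_trans rr).
have cb r : 0 <= r <= rho -> b s @[s --> r] --> b r.
  move=> rP; have [c1 c2] := crV r rP.
  by apply: cvgD; apply: cvgM; (exact: rcont_Re c1 || exact: rcont_Im c1).
have cm : {within `[0, rho], continuous m'}.
  apply: cts_within => r rP; have [c1 c2] := crV r rP.
  have [k1 k2 k3 k4] := And4 (rcont_Re c1) (rcont_Im c1) (rcont_Re c2) (rcont_Im c2).
  apply: cvgD; apply: cvgM; rewrite //.
  - by apply: cvgD; apply: cvgD; apply: cvgM.
  - exact: ca.
  - exact: cb.
  - by apply: cvgM; exact: ca.
have cba : {within `[0, rho], continuous (fun r => b r * a r ^+ 2)}.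
  apply: cts_within => r rP; apply: cvgM; first exact: cb.
  by apply: cvgM; exact: ca.
have cp : {within `[0, rho], continuous (fun r => normc (df (polar r t)) ^+ 2)}.
  apply: cts_within => r rP; have [_ c2] := crV r rP.
  have -> : (fun r => normc (df (polar r t)) ^+ 2) = (fun r => normc (V' r) ^+ 2).
    by apply/funext => s; rewrite /V' normc_opp normc_mul normc_cis mulr1.
  have -> : normc (df (polar r t)) ^+ 2 = normc (V' r) ^+ 2.
    by rewrite /V' normc_opp normc_mul normc_cis mulr1.
  by apply: cvgM; exact: (rcont_normc c2).
have E := rint_FTC rho0 cm dm.
have bE r : b r = normc (V r) ^+ 2 by rewrite normc_sqr !expr2.
have brho : b rho = 0 by rewrite bE /V subrr normcr0 expr0n.
have b0 : 0 <= b 0 by rewrite bE exprn_ge0 // normc_ge0.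
have a01 : a 0 = 1 by rewrite /a subr0 invr1.
rewrite brho mul0r a01 mulr1 in E.
have i1 := ig_cont cba; have i2 := ig_cont cp.
have low : rint 0 rho (fun r => 2^-1 * (b r * a r ^+ 2) - 2 * normc (df (polar r t)) ^+ 2) <= rint 0 rho m'.
  apply: rint_le; [apply: igB; exact: igZ|exact: ig_cont|].
  move=> r rP; have -> : normc (df (polar r t)) ^+ 2 = normc (V' r) ^+ 2.
    by rewrite /V' normc_opp normc_mul normc_cis mulr1.
  rewrite (normc_sqr (V' r)) /m' /b -subr_ge0.
  set X := Re (V r); set X' := Re (V' r); set Y := Im (V r); set Y' := Im (V' r); set k := a r.
  have -> : (X' * X + X * X' + (Y' * Y + Y * Y')) * k + (X * X + Y * Y) * k ^+ 2 -
    (2^-1 * ((X * X + Y * Y) * k ^+ 2) - 2 * (X' ^+ 2 + Y' ^+ 2)) =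
    2^-1 * ((k * X + 2 * X') ^+ 2 + (k * Y + 2 * Y') ^+ 2) by field.
  by rewrite mulr_ge0 ?invr_ge0 // addr_ge0 // sqr_ge0.
rewrite rintB in low; [|exact: igZ|exact: igZ].
rewrite !rintZ // in low.
rewrite (rint_eq (g := fun r => b r * a r ^+ 2)); last by move=> r _; rewrite bE /a exprVn.
move: low; rewrite E; set I1 := rint _ _ _; set I2 := rint _ _ _; lra.
Qed.

End CircleEstimates.

(** * The singular weight and the gap to the boundary values *)

Section OscillationEnergy.
Context {R : realType}.
Local Notation C := (Cplx R).
Local Notation pi2 := (2 * pi : R).
Implicit Types (z w : C) (t x y r q d e s rho : R).

(** The kernel left by [omega_sqr], y standing for 1 - q. Its integral in either variable is at most
    twice the inverse square of the other distance, as Schur's test needs. *)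
Definition singular_weight (r y : R) : R := (Num.sqrt (1 - r))^-1 * w52 ((1 - r) + y).

Lemma rcts_sqrt_one_sub r : Num.sqrt (1 - s) @[s --> r] --> (Num.sqrt (1 - r) : R).
Proof. by apply: rcts_sqrt_at; exact: cvg_one_sub. Qed.

Lemma singular_weight_cts r y : r < 1 -> 0 <= y ->
  singular_weight s y @[s --> r] --> singular_weight r y.
Proof.
move=> r1 y0; apply: cvgM.
  by apply: cvgV; [rewrite gt_eqF // sqrtr_gt0; lra|exact: rcts_sqrt_one_sub].
apply: (@cts_w52 _ (fun s => 1 - s + y)); first by lra.
by apply: cvgD; [exact: cvg_one_sub|exact: cvg_cst].
Qed.

(** One factor 1 / y comes from ((1 - r) + y)^(-1). What remains is (1 - r)^(-1/2) ((1 - r) +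
    y)^(-3/2), with the explicit primitive -(2 / y) times the square root of (1 - r) / (1 - r +
    y). *)
Lemma rint_singular_weight rho y : 0 <= rho < 1 -> 0 < y ->
  rint 0 rho (fun r => singular_weight r y) <= 2 / y ^+ 2.
Proof.
move=> /andP[rho0 rho1] y0.
pose K r : R := Num.sqrt (1 - r) * (Num.sqrt (1 - r + y))^-1.
pose k r : R := (Num.sqrt (1 - r))^-1 * w32 ((1 - r) + y).
have dK r : 0 <= r <= rho -> is_derive r 1 (fun r => - (2 / y) * K r) (k r).
  move=> /andP[r0 rr]; have p1 : 0 < 1 - r by lra.
  have p2 : 0 < 1 - r + y by lra.
  have s1 : Num.sqrt (1 - r) != 0 by rewrite gt_eqF // sqrtr_gt0.
  have s2 : Num.sqrt (1 - r + y) != 0 by rewrite gt_eqF // sqrtr_gt0.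
  have e1 := rderB (rder_cst 1 r) (rder_id r).
  have e2 := rderD e1 (rder_cst y r).
  have d1 := rder_comp (g := fun r => 1 - r) (is_derive1_sqrt p1) e1.
  have d2 := rder_comp (g := fun r => 1 - r + y) (is_derive1_sqrt p2) e2.
  have d3 := @is_deriveV R (fun r => Num.sqrt (1 - r + y)) r _ 1 s2 d2.
  have d4 := rderM (rder_cst (- (2 / y)) r) (rderM d1 d3).
  apply: is_derive_eq d4 _; rewrite /GRing.scale /= /k /w32.
  set T := Num.sqrt (1 - r + y) in s2 *; set S := Num.sqrt (1 - r) in s1 *.
  have TE : 1 - r + y = T ^+ 2 by rewrite sqr_sqrtr // ltW.
  have SE : 1 - r = S ^+ 2 by rewrite sqr_sqrtr // ltW.
  have yE : y = T ^+ 2 - S ^+ 2 by rewrite -TE -SE; ring.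
  have y0' : T ^+ 2 - S ^+ 2 != 0 by rewrite -yE gt_eqF.
  rewrite TE yE; field; rewrite s1 s2 y0' //.
have ck r : 0 <= r <= rho -> k s @[s --> r] --> k r.
  move=> /andP[r0 rr]; apply: cvgM.
    by apply: cvgV; [rewrite gt_eqF // sqrtr_gt0; lra|exact: rcts_sqrt_one_sub].
  apply: (@cts_w32 _ (fun s => 1 - s + y)); first by lra.
  by apply: cvgD; [exact: cvg_one_sub|exact: cvg_cst].
have wk := cts_within ck.
have E := rint_FTC rho0 wk dK.
have K0 r : 0 <= K r by rewrite mulr_ge0 ?invr_ge0 ?sqrtr_ge0.
have K1 : K 0 <= 1.
  rewrite /K subr0 sqrtr1 mul1r invf_le1 ?sqrtr_gt0; last by lra.
  by rewrite -[leLHS]sqrtr1 ler_wsqrtr //; lra.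
have h : rint 0 rho k <= 2 / y.
  rewrite E; have y2 : 0 < 2 / y by rewrite divr_gt0.
  have := K0 rho; nra.
have i1 : ig 0 rho (fun r => singular_weight r y).
  apply: ig_cont; apply: cts_within => r /andP[r0 rr].
  by apply: singular_weight_cts; [exact: le_lt_trans rr rho1|exact: ltW].
apply: (@le_trans _ _ (rint 0 rho (fun r => y^-1 * k r))).
  apply: rint_le => //; first by apply: igZ; exact: ig_cont.
  move=> r /andP[r0 rr]; have p1 : 0 < 1 - r by lra.
  have p2 : 0 < 1 - r + y by lra.
  rewrite /singular_weight /k mulrCA ler_wpM2l ?invr_ge0 ?sqrtr_ge0 //.
  rewrite w52E // mulrC ler_wpM2r ?(ltW (w32_gt0 p2)) // lef_pV2 ?posrE //; lra.
rewrite rintZ; last exact: ig_cont.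
have -> : 2 / y ^+ 2 = y^-1 * (2 / y) by field; rewrite gt_eqF.
by rewrite ler_wpM2l // invr_ge0 ltW.
Qed.

Variables (alpha : R) (f : C -> C).
Hypotheses (alpha_gt0 : 0 < alpha) (alpha_le : alpha <= 2^-1).
Hypothesis lipf : lip_space alpha f.

Local Notation df := (fun z => 'D_1 f z).

Let pi2_ge0 : 0 <= pi2. Proof. exact: ltW pi2_gt0. Qed.

Definition gap r : R := rint 0 pi2 (fun t => normc (f (cis t) - f (polar r t)) ^+ 2).

Lemma gap_ge0 r : 0 <= gap r.
Proof. by apply: rint_ge0 => t _; exact: exprn_ge0 (normc_ge0 _). Qed.

Lemma cts2_f (A B : set R) (u v : R -> R -> R) : cts2 A B u -> cts2 A B v ->
  (forall x y, A x -> B y -> 0 <= u x y <= 1) ->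
  ccts2 A B (fun x y => f (polar (u x y) (v x y))).
Proof.
move=> hu hv h; apply: ccts2_lip alpha_gt0 lipf (ccts2_polar hu hv) _ => x y Ax By.
by have /andP[h0 h1] := h x y Ax By; rewrite normc_polar.
Qed.

Lemma cts2_fcis (A B : set R) (v : R -> R -> R) : cts2 A B v -> ccts2 A B (fun x y => f (cis (v x y))).
Proof.
by move=> hv; apply: ccts2_lip alpha_gt0 lipf (ccts2_cis hv) _ => x y _ _; rewrite normc_cis.
Qed.

Let c1 (A B : set R) : cts2 A B (fun x _ => x).
Proof. by apply: cts2_fst => y _; exact: cvg_id. Qed.
Let c2 (A B : set R) : cts2 A B (fun _ y => y).
Proof. by apply: cts2_snd => y _; exact: cvg_id. Qed.

Lemma cts2_gap : cts2 `[0, 1]%classic `[0, pi2]%classic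
  (fun r t => normc (f (cis t) - f (polar r t)) ^+ 2).
Proof.
apply: ccts2_normc2; apply: ccts2B; first exact: cts2_fcis.
by apply: cts2_f => // x y; rewrite /= in_itv.
Qed.

Lemma itv_sub1 r : r <= 1 -> `[0%R, r]%classic `<=` `[0%R, 1%R]%classic.
Proof. by move=> r1 x; rewrite /= !in_itv /= => /andP[-> h] /=; exact: le_trans h r1. Qed.

Lemma gap_cts rho : rho <= 1 -> {within `[0, rho], continuous gap}.
Proof.
by move=> r1; apply: cts2_rint_within => //; apply: cts2S cts2_gap => //; exact: itv_sub1.
Qed.

Let cf' z : normc z < 1 -> ccont df z := @deriv_ccont R alpha f alpha_gt0 lipf z.

(** Hardy's inequality is applied on rays ending at a radius sg < 1, where |f (cis t) - f (polar sg
    t)| <= (1 - rho) / 4. Splitting the square doubles 4 D into 8 D, and the replacement of the end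
    point costs at most 1. *)
Lemma hardy_gap D rho : (forall r, 0 <= r < 1 -> rint 0 r (circle_energy df) <= D) -> 0 <= rho < 1 ->
  rint 0 rho (fun r => gap r / (1 - r) ^+ 2) <= 8 * D + 1.
Proof.
move=> HD /andP[rho0 rho1].
have e0 : 0 < (1 - rho) / 4 by lra.
have [d d0 H] := lip_unif alpha_gt0 lipf e0.
pose sg : R := Num.max rho (1 - d / 2).
have s1 : sg < 1 by rewrite gt_max rho1 /=; lra.
have rs : rho <= sg by rewrite le_max lexx.
have ds : 1 - d / 2 <= sg by rewrite le_max lexx orbT.
have s0 : 0 <= sg by exact: le_trans rho0 rs.
have fs t : normc (f (cis t) - f (polar sg t)) <= (1 - rho) / 4.
  apply: H; rewrite ?normc_cis ?normc_polar ?(ltW s1) //.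
  have -> : cis t - polar sg t = rc (1 - sg) * cis t by rewrite polarE rcD rcN mulrBl mul1r.
  by rewrite normc_mul normc_cis mulr1 normc_rc ger0_norm; lra.
pose u r t : R := normc (f (polar sg t) - f (polar r t)) ^+ 2 / (1 - r) ^+ 2.
have u0 r t : 0 <= u r t by apply: divr_ge0; [exact: exprn_ge0 (normc_ge0 _)|exact: sqr_ge0].
have cu' (x : R) : x < 1 -> cts2 `[0, x]%classic `[0, pi2]%classic u.
  move=> x1; apply: cts2M.
    apply: ccts2_normc2; apply: ccts2B; apply: cts2_f => //; first exact: cts2_cst.
      by move=> a b _ _; rewrite s0 ltW.
    by move=> a b; rewrite /= in_itv /= => /andP[-> h] _ /=; lra.
  apply: cts2_fst => r; rewrite /= in_itv /= => /andP[r0 rr]; apply: cvgV.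
    by rewrite gt_eqF // exprn_gt0 //; lra.
  by apply: cvgM; exact: cvg_one_sub.
have cg : cts2 `[0, rho]%classic `[0, pi2]%classic (fun r t => normc (f (cis t) - f (polar r t)) ^+ 2).
  by apply: cts2S cts2_gap => //; exact: itv_sub1 (ltW rho1).
have ci : {within `[0, rho], continuous (fun r => ((1 - r) ^+ 2)^-1 : R)}.
  apply: cts_within => r /andP[r0 rr]; apply: cvgV; first by rewrite gt_eqF // exprn_gt0 //; lra.
  by apply: cvgM; exact: cvg_one_sub.
have cgd : {within `[0, rho], continuous (fun r => gap r / (1 - r) ^+ 2)}.
  apply: within_cvgP => r rP; apply: cvgM.
    by have /subspace_continuousP := gap_cts (ltW rho1); apply; rewrite /= in_itv.
  by have /subspace_continuousP := ci; apply; rewrite /= in_itv.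
have cU := cts2_rint_within pi2_ge0 (cu' _ rho1).
have step1 r : 0 <= r <= rho -> gap r / (1 - r) ^+ 2 <= 1 + 2 * rint 0 pi2 (u r).
  move=> /andP[r0 rr]; have r1 : 0 < 1 - r by lra.
  have rI : `[0, rho]%classic r by rewrite /= in_itv /= r0.
  have i1 := cts2_ig (cu' _ rho1) rI.
  have i2 := cts2_ig cg rI.
  have g1 : gap r <= rint 0 pi2 (fun t => 2 * ((1 - rho) / 4) ^+ 2 + 2 * (1 - r) ^+ 2 * u r t).
    apply: rint_le => //; first by apply: igD; [exact: ig_cst|exact: igZ].
    move=> t _; have T := normc_tri (f (cis t)) (f (polar sg t)) (f (polar r t)).
    have ft := fs t; set a := normc (f (cis t) - f (polar sg t)) in T ft.
    have uE : (1 - r) ^+ 2 * u r t = normc (f (polar sg t) - f (polar r t)) ^+ 2.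
      by rewrite /u mulrC divfK // gt_eqF // exprn_gt0.
    rewrite -[2 * _ * u r t]mulrA uE; set b := normc (f (polar sg t) - f (polar r t)) in T *.
    set c := normc _ in T *; have a0 : 0 <= a by exact: normc_ge0.
    have b0 : 0 <= b by exact: normc_ge0.
    have c0 : 0 <= c by exact: normc_ge0.
    have k1 : c ^+ 2 <= (a + b) ^+ 2 by rewrite ler_pXn2r ?nnegrE // addr_ge0.
    have k2 : a ^+ 2 <= ((1 - rho) / 4) ^+ 2 by rewrite ler_pXn2r ?nnegrE // ltW.
    have := sqr_ge0 (a - b); rewrite sqrrB; rewrite sqrrD in k1; lra.
  rewrite rintD in g1; [|exact: ig_cst|exact: igZ].
  rewrite rint_cst // subr0 rintZ // in g1.
  rewrite ler_pdivrMr ?exprn_gt0 //.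
  have p4 := @pi_lt4 R; have p0 := @pi_gt0 R.
  have q1 : (1 - rho) ^+ 2 <= (1 - r) ^+ 2.
    by rewrite ler_pXn2r ?nnegrE ?(ltW r1) ?subr_ge0 ?(ltW rho1) // lerD2l lerN2.
  (* The factor on the left is pi / 4 < 1. *)
  have q2 : 2 * ((1 - rho) / 4) ^+ 2 * pi2 <= (1 - rho) ^+ 2.
    by have := sqr_ge0 (1 - rho); set Q := (1 - rho) ^+ 2; rewrite expr_div_n -/Q; nra.
  lra.
have i3 : ig 0 rho (fun r => 1 + 2 * rint 0 pi2 (u r)).
  by apply: igD; [exact: ig_cst|apply: igZ; exact: ig_cont].
apply: (@le_trans _ _ (rint 0 rho (fun r => 1 + 2 * rint 0 pi2 (u r)))).
  by apply: rint_le => //; exact: ig_cont.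
rewrite rintD; [|exact: ig_cst|by apply: igZ; exact: ig_cont].
rewrite rint_cst // subr0 rintZ; last exact: ig_cont.
rewrite rint_swap //; last exact: cu'.
have cray t : ig 0 sg (fun r => u r t).
  apply: ig_cont; apply: within_cvgP => r rP.
  have cc : cts2 `[0, sg]%classic [set: R] u.
    apply: cts2M.
      apply: ccts2_normc2; apply: ccts2B; apply: cts2_f => //; first exact: cts2_cst.
        by move=> a b _ _; rewrite s0 ltW.
      by move=> a b; rewrite /= in_itv /= => /andP[-> h] _ /=; lra.
    apply: cts2_fst => x; rewrite /= in_itv /= => /andP[x0 xx]; apply: cvgV.
      by rewrite gt_eqF // exprn_gt0 //; lra.
    by apply: cvgM; exact: cvg_one_sub.
  by apply: (cts2_slice (cts2_swap cc)) => //=; rewrite in_itv.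
pose p r t := normc (df (polar r t)) ^+ 2.
have cp : cts2 `[0, sg]%classic `[0, pi2]%classic p by apply: cts2_deriv cf' _ _; exact: itv_sub.
have iP : ig 0 pi2 (fun t => rint 0 sg (fun r => p r t)).
  by apply: ig_cont; exact: cts2_rint_within (cts2_swap cp).
have k2 : rint 0 pi2 (fun t => rint 0 rho (fun r => u r t)) <= 4 * D.
  apply: (@le_trans _ _ (rint 0 pi2 (fun t => 4 * rint 0 sg (fun r => p r t)))).
    apply: rint_le; [|exact: igZ|].
      by apply: ig_cont; exact: cts2_rint_within (cts2_swap (cu' _ rho1)).
    move=> t _; have sP : 0 <= sg < 1 by rewrite s0.
    apply: le_trans (hardy_ray alpha_gt0 lipf t sP).
    change (rint 0 rho (u^~ t) <= rint 0 sg (u^~ t)); rewrite (rint_split rho0 rs (cray t)) lerDl.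
    by apply: rint_ge0.
  rewrite rintZ // ler_wpM2l // -rint_swap //; first by apply: HD; rewrite s0.
  by move=> *; exact: exprn_ge0 (normc_ge0 _).
lra.
Qed.

End OscillationEnergy.

(** * Schur's test for the oscillation energy *)

Section EnergyBound.
Context {R : realType}.
Local Notation C := (Cplx R).
Local Notation pi2 := (2 * pi : R).
Implicit Types (z w : C) (t x y r q d e s rho : R).
Variables (alpha : R) (f : C -> C).
Hypotheses (alpha_gt0 : 0 < alpha) (alpha_le : alpha <= 2^-1).
Hypothesis lipf : lip_space alpha f.

Local Notation df := (fun z => 'D_1 f z).
Local Notation I01 := (`[0%R, 1%R[%classic : set R).

Let pi2_ge0 : 0 <= pi2. Proof. exact: ltW pi2_gt0. Qed.
Let cdf z : normc z < 1 -> ccont df z := @deriv_ccont R alpha f alpha_gt0 lipf z.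
Let c1 (A B : set R) : cts2 A B (fun x _ => x).
Proof. by apply: cts2_fst => y _; exact: cvg_id. Qed.
Let c2 (A B : set R) : cts2 A B (fun _ y => y).
Proof. by apply: cts2_snd => y _; exact: cvg_id. Qed.

Lemma cts2_osc2 (A : set R) r (l : R -> R) : 0 <= r <= 1 -> (forall q, A q -> l s @[s --> q] --> l q) ->
  cts2 A `[0, pi2]%classic (fun q t => osc2 f r t (l q)).
Proof.
move=> rP cl; apply: ccts2_normc2; apply: ccts2B.
  by apply: (cts2_fcis alpha_gt0 lipf); apply: cts2D => //; exact: cts2_fst.
by apply: (cts2_f alpha_gt0 lipf) => //; exact: cts2_cst.
Qed.

Lemma ig_normc2 (F : R -> C) : ccts2 `[0, 1]%classic `[0, pi2]%classic (fun _ t => F t) ->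
  ig 0 pi2 (fun t => normc (F t) ^+ 2).
Proof.
move=> /ccts2_normc2 cF; apply: (cts2_ig (x := 0) cF).
by rewrite /= in_itv /= lexx ler01.
Qed.

Definition shift_gap r x : R := rint 0 pi2 (fun t => osc2 f r t x).

(** The detour from cis (t + x) to polar r t goes inward to radius q, along that circle by the angle
    x, outward to cis t, and inward to radius r. The outer factor 4 is for the square of four terms;
    the first and third legs each integrate to [gap f q], by rotation invariance. *)
Lemma shift_gap_le r q x : 0 <= r <= 1 -> 0 <= q < 1 -> `|x| <= 4 ->
  shift_gap r x <= 4 * (2 * gap f q + x ^+ 2 * circle_energy df q + gap f r).
Proof.
move=> rP qP x4; have /andP[q0 q1] := qP.
have qP' : 0 <= q <= 1 by rewrite q0 ltW.
pose a t := f (cis (t + x)) - f (polar q (t + x)).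
pose b t := f (polar q (t + x)) - f (polar q t).
pose c t := f (cis t) - f (polar q t).
pose d t := f (cis t) - f (polar r t).
have cpol s (v : R -> R -> R) : 0 <= s <= 1 -> cts2 `[0, 1]%classic `[0, pi2]%classic v ->
    ccts2 `[0, 1]%classic `[0, pi2]%classic (fun y t => f (polar s (v y t))).
  by move=> sP cv; apply: (cts2_f alpha_gt0 lipf) => //; exact: cts2_cst.
have ccis (v : R -> R -> R) : cts2 `[0, 1]%classic `[0, pi2]%classic v ->
    ccts2 `[0, 1]%classic `[0, pi2]%classic (fun y t => f (cis (v y t))).
  exact: (cts2_fcis alpha_gt0 lipf).
have ctx : cts2 `[0, 1]%classic `[0, pi2]%classic (fun _ t => t + x) by apply: cts2D => //; exact: cts2_cst.
have ia : ig 0 pi2 (fun t => normc (a t) ^+ 2).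
  by apply: ig_normc2; apply: ccts2B; [exact: ccis|exact: cpol].
have ib : ig 0 pi2 (fun t => normc (b t) ^+ 2).
  by apply: ig_normc2; apply: ccts2B; exact: cpol.
have ic : ig 0 pi2 (fun t => normc (c t) ^+ 2).
  by apply: ig_normc2; apply: ccts2B; [exact: ccis|exact: cpol].
have id : ig 0 pi2 (fun t => normc (d t) ^+ 2).
  by apply: ig_normc2; apply: ccts2B; [exact: ccis|exact: cpol].
have io : ig 0 pi2 (fun t => osc2 f r t x).
  by apply: ig_normc2; apply: ccts2B; [exact: ccis|exact: cpol].
have sa : rint 0 pi2 (fun t => normc (a t) ^+ 2) = gap f q.
  have cg : rcts (fun t => normc (c t) ^+ 2).
    move=> t; have h : normc (c s) @[s --> t] --> normc (c t).
      apply: (@rcont_normc _ c); apply: rcontB; first exact: lip_rcont alpha_gt0 lipf t.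
      apply: (rcont_comp (H := f)); first exact: rcont_polar.
      exact: cdiff_cont (lip_cdiff lipf (normc_polar_lt1 _ qP)).
    by apply: cvgM; exact: h.
  have pg : per (fun t => normc (c t) ^+ 2) by move=> t; rewrite /c !polarE cisD2pi.
  exact: (rint_shift cg pg x4).
have sb := translate_energy alpha_gt0 lipf qP x4.
have pt t : osc2 f r t x <= 4 * ((normc (a t) ^+ 2 + normc (b t) ^+ 2) + (normc (c t) ^+ 2 + normc (d t) ^+ 2)).
  have E : f (cis (t + x)) - f (polar r t) = (a t + b t) - c t + d t by rewrite /a /b /c /d; ring.
  rewrite /osc2 E.
  have T1 := normc_add (a t + b t - c t) (d t); have T2 := normc_sub (a t + b t) (c t).
  have T3 := normc_add (a t) (b t).
  have := normc_ge0 (a t); have := normc_ge0 (b t); have := normc_ge0 (c t); have := normc_ge0 (d t).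
  have := normc_ge0 (a t + b t - c t + d t).
  move: T1 T2 T3; move: (normc (a t + b t - c t + d t)) (normc (a t + b t - c t)) (normc (a t + b t)).
  move: (normc (a t)) (normc (b t)) (normc (c t)) (normc (d t)) => A B C' D V X Y T1 T2 T3 V0 D0 C0 B0 A0.
  have VS : V <= A + B + C' + D by lra.
  have : V ^+ 2 <= (A + B + C' + D) ^+ 2 by rewrite ler_pXn2r ?nnegrE //; lra.
  have := sqr_ge0 (A - B); have := sqr_ge0 (A - C'); have := sqr_ge0 (A - D).
  have := sqr_ge0 (B - C'); have := sqr_ge0 (B - D); have := sqr_ge0 (C' - D).
  rewrite !sqrrB !sqrrD; lra.
have iab := igD ia ib; have icd := igD ic id.
apply: (le_trans (rint_le io (igZ 4 (igD iab icd)) (fun t _ => pt t))).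
rewrite rintZ; last exact: igD.
rewrite ler_wpM2l // rintD // !rintD // sa.
change (rint 0 pi2 (fun t => normc (c t) ^+ 2)) with (gap f q).
change (rint 0 pi2 (fun t => normc (d t) ^+ 2)) with (gap f r).
have {}sb : rint 0 pi2 (fun t => normc (b t) ^+ 2) <= x ^+ 2 * circle_energy df q by exact: sb.
move: sb; set Ib := rint 0 pi2 (fun t => normc (b t) ^+ 2); set Pq := x ^+ 2 * _.
lra.
Qed.

Definition osc_energy r : R := rint 0 pi2 (fun t => (omega f (polar r t) / (1 - r)) ^+ 2).

Lemma cts2_osc_energy : cts2 I01 `[0, pi2]%classic (fun r t => (omega f (polar r t) / (1 - r)) ^+ 2).
Proof.
have h : cts2 I01 `[0, pi2]%classic (fun r t => omega f (polar r t) / (1 - r)).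
  apply: cts2M.
    apply: (cts2_ccomp (g := omega f)); first exact: ccts2_polar.
    move=> r t; rewrite /= in_itv /= => rP _ e e0.
    by apply: (omega_cts alpha_gt0 lipf) => //; exact: normc_polar_lt1.
  apply: cts2_fst => r; rewrite /= in_itv /= => /andP[r0 r1].
  by apply: cvgV; [rewrite gt_eqF //; lra|exact: cvg_one_sub].
exact: cts2M.
Qed.

Lemma ig_osc_energy rho : rho < 1 -> ig 0 rho osc_energy.
Proof.
move=> r1; apply: ig_cont; apply: cts2_rint_within => //.
by apply: cts2S cts2_osc_energy => //; exact: itv_sub.
Qed.

Definition osc_kernel r q : R := rint 0 pi2 (fun t => w52 ((1 - r) + (1 - q)) *
      (osc2 f r t (pi * (1 - q)) + osc2 f r t (- (pi * (1 - q))))).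

Lemma cvg_arc q : pi * (1 - s) @[s --> q] --> (pi * (1 - q) : R).
Proof. by apply: cvgM; [exact: cvg_cst|exact: cvg_one_sub]. Qed.

Lemma cts2_osc_kernel r : 0 <= r < 1 -> cts2 `[0, 1]%classic `[0, pi2]%classic
  (fun q t => w52 ((1 - r) + (1 - q)) *
      (osc2 f r t (pi * (1 - q)) + osc2 f r t (- (pi * (1 - q))))).
Proof.
move=> /andP[r0 r1]; have rP : 0 <= r <= 1 by rewrite r0 ltW.
apply: cts2M.
  apply: cts2_fst => q; rewrite /= in_itv /= => /andP[q0 q1].
  apply: (@cts_w52 _ (fun q => 1 - r + (1 - q))); first by lra.
  by apply: cvgD; [exact: cvg_cst|exact: cvg_one_sub].
apply: cts2D; apply: cts2_osc2 => // q _; first exact: cvg_arc.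
by apply: cvgN; exact: cvg_arc.
Qed.

Lemma osc_energy_le r : 0 <= r < 1 ->
  osc_energy r <= 108 * 243 / Num.sqrt (1 - r) * rint 0 1 (osc_kernel r).
Proof.
move=> rP; have /andP[r0 r1] := rP.
have ck := cts2_osc_kernel rP.
have ci : {within `[0, pi2], continuous (fun t => rint 0 1 (fun q => w52 ((1 - r) + (1 - q)) *
      (osc2 f r t (pi * (1 - q)) + osc2 f r t (- (pi * (1 - q))))))}.
  exact: cts2_rint_within ler01 (cts2_swap ck).
have -> : rint 0 1 (osc_kernel r) = rint 0 pi2 (fun t => rint 0 1 (fun q => w52 ((1 - r) + (1 - q)) *
      (osc2 f r t (pi * (1 - q)) + osc2 f r t (- (pi * (1 - q)))))).
  apply: rint_swap => // q t /andP[q0 q1] _; apply: mulr_ge0.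
    by apply: ltW; apply: w52_gt0; lra.
  by apply: addr_ge0; exact: osc2_ge0.
rewrite -rintZ; last exact: ig_cont.
apply: rint_le.
- by apply: (cts2_ig cts2_osc_energy); rewrite /= in_itv.
- by apply: igZ; exact: ig_cont.
- move=> t tP; exact: (omega_sqr alpha_gt0 lipf rP tP).
Qed.

Lemma osc_kernelE r q : 0 <= r < 1 -> 0 <= q <= 1 -> osc_kernel r q =
  w52 ((1 - r) + (1 - q)) * (shift_gap r (pi * (1 - q)) + shift_gap r (- (pi * (1 - q)))).
Proof.
move=> /andP[r0 r1] qP; have rP : 0 <= r <= 1 by rewrite r0 ltW.
have qI : `[0, 1]%classic q by rewrite /= in_itv.
have i1 : ig 0 pi2 (fun t => osc2 f r t (pi * (1 - q))).
  apply: (cts2_ig (A := `[0, 1]%classic) (u := fun q t => osc2 f r t (pi * (1 - q)))) qI.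
  by apply: (cts2_osc2 (l := fun q => pi * (1 - q))) => // s _; exact: cvg_arc.
have i2 : ig 0 pi2 (fun t => osc2 f r t (- (pi * (1 - q)))).
  apply: (cts2_ig (A := `[0, 1]%classic) (u := fun q t => osc2 f r t (- (pi * (1 - q))))) qI.
  by apply: (cts2_osc2 (l := fun q => - (pi * (1 - q)))) => // s _; apply: cvgN; exact: cvg_arc.
by rewrite /osc_kernel rintZ ?rintD //; exact: igD.
Qed.

(** The detour for the angle pi (1 - q) is made at radius q, so its depth is comparable to the
    angle. 16 bounds pi^2, and 8 is the 4 of [shift_gap_le] for both signs. *)
Lemma osc_kernel_le r q : 0 <= r < 1 -> 0 <= q < 1 ->
  osc_kernel r q <= 8 * (w52 ((1 - r) + (1 - q)) *
    (2 * gap f q + 16 * (1 - q) ^+ 2 * circle_energy df q + gap f r)).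
Proof.
move=> rP qP; have /andP[r0 r1] := rP; have /andP[q0 q1] := qP.
have rP' : 0 <= r <= 1 by rewrite r0 ltW.
have p4 := @pi_lt4 R; have p0 := @pi_gt0 R.
have x4 : `|pi * (1 - q)| <= 4 by rewrite ger0_norm; nra.
have x4' : `|- (pi * (1 - q))| <= 4 by rewrite normrN.
rewrite osc_kernelE //; last by rewrite q0 ltW.
have h1 := shift_gap_le rP' qP x4; have h2 := shift_gap_le rP' qP x4'.
have p2 : 0 < 1 - r + (1 - q) by lra.
rewrite sqrrN in h2; rewrite mulrCA ler_wpM2l ?(ltW (w52_gt0 p2)) //.
have P0 := circle_energy_ge0 df q.
have : (pi * (1 - q)) ^+ 2 * circle_energy df q <= 16 * (1 - q) ^+ 2 * circle_energy df q.
  rewrite ler_wpM2r // exprMn ler_wpM2r ?sqr_ge0 //.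
  by have : pi ^+ 2 <= 4 ^+ 2 :> R by [rewrite ler_pXn2r ?nnegrE // ltW]; lra.
lra.
Qed.

(** A crude bound reaching up to q = 1. It depends on rho, but is used only on an interval of q
    chosen short enough for that rho. *)
Lemma osc_kernel_le_cst (B : R) r q rho : (forall z, normc z <= 1 -> normc (f z) <= B) -> 0 <= r <= rho ->
  rho < 1 -> 0 <= q <= 1 -> osc_kernel r q <= w52 (1 - rho) * (8 * B ^+ 2) * pi2.
Proof.
move=> fB /andP[r0 rr] r1 qP; have /andP[q0 q1] := qP.
have rP : 0 <= r < 1 by rewrite r0 (le_lt_trans rr).
have B0 : 0 <= B by rewrite (le_trans (normc_ge0 (f 0))) // fB // normcr0.
have ob t x : osc2 f r t x <= 4 * B ^+ 2.
  have -> : 4 * B ^+ 2 = (B + B) ^+ 2 by ring.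
  rewrite /osc2 ler_pXn2r ?nnegrE ?normc_ge0 ?addr_ge0 //.
  rewrite (le_trans (normc_sub _ _)) // lerD // fB ?normc_cis // normc_polar //.
  by rewrite (le_trans rr) // ltW.
have i1 := cts2_ig (cts2_osc_kernel rP) (x := q).
rewrite -[pi2](subr0) -rint_cst //; apply: rint_le; [|exact: ig_cst|].
  by apply: i1; rewrite /= in_itv.
move=> t _; apply: ler_pM.
- by apply: ltW; apply: w52_gt0; lra.
- by apply: addr_ge0; exact: osc2_ge0.
- by apply: w52_anti; lra.
- by have := ob t (pi * (1 - q)); have := ob t (- (pi * (1 - q))); lra.
Qed.

Lemma rint_singular_weight_q r q1 : 0 <= r < 1 -> 0 <= q1 <= 1 ->
  rint 0 q1 (fun q => singular_weight r (1 - q)) <= 2 / (1 - r) ^+ 2.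
Proof.
move=> /andP[r0 r1] /andP[q0 q11]; have d0 : 0 < 1 - r by lra.
have s0 : 0 < Num.sqrt (1 - r) by rewrite sqrtr_gt0.
have cw := cts_w32_within d0.
have iw := ig_cont cw.
have is_ : ig 0 q1 (fun q => singular_weight r (1 - q)).
  apply: ig_cont; apply: cts_within => q /andP[q0' qq]; apply: cvgM; first exact: cvg_cst.
  apply: (@cts_w52 _ (fun q => 1 - r + (1 - q))); first by lra.
  by apply: cvgD; [exact: cvg_cst|exact: cvg_one_sub].
pose k : R := (Num.sqrt (1 - r))^-1 * (1 - r)^-1.
have k0 : 0 <= k by rewrite mulr_ge0 ?invr_ge0 // ltW.
have iw' : ig 0 q1 (fun q => w32 (1 - r + (1 - q))) by exact: igS iw.
apply: (@le_trans _ _ (rint 0 q1 (fun q => k * w32 ((1 - r) + (1 - q))))).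
  apply: rint_le => //; first exact: igZ.
  move=> q /andP[q0' qq]; have p2 : 0 < 1 - r + (1 - q) by lra.
  rewrite /singular_weight /k -mulrA ler_wpM2l ?invr_ge0 ?(ltW s0) // w52E // mulrC.
  rewrite ler_wpM2r ?(ltW (w32_gt0 p2)) // lef_pV2 ?posrE //; lra.
rewrite rintZ //.
have h : rint 0 q1 (fun q => w32 (1 - r + (1 - q))) <= 2 / Num.sqrt (1 - r).
  rewrite (le_trans _ (rint_w32 d0)) // (rint_split q0 q11 iw) lerDl.
  by apply: rint_ge0 => q /andP[q0' qq]; apply: ltW; apply: w32_gt0; lra.
rewrite (le_trans (ler_wpM2l k0 h)) // /k.
set S := Num.sqrt (1 - r) in s0 *; have SE : 1 - r = S ^+ 2 by rewrite sqr_sqrtr // ltW.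
by rewrite SE le_eqVlt; apply/orP; left; apply/eqP; field; rewrite gt_eqF.
Qed.

(* The radius [q1] absorbs the part of the arc integral near [q = 1], where the
   bound through [circle_energy] is not available. *)
Lemma osc_energy_bound (D : R) : 0 <= D -> (forall r, 0 <= r < 1 -> rint 0 r (circle_energy df) <= D) ->
  exists2 c : R, 0 <= c & forall rho, 0 <= rho < 1 -> rint 0 rho osc_energy <= c.
Proof.
move=> D0 HD; have [B B0 fB] := lip_bounded alpha_gt0 lipf.
pose K : R := 108 * 243; have K0 : 0 < K by rewrite mulr_gt0.
exists (8 * K * (4 * (8 * D + 1) + 32 * D + 2 * (8 * D + 1)) + 1).
  by rewrite addr_ge0 // !mulr_ge0 ?(ltW K0) // !addr_ge0 ?mulr_ge0 ?addr_ge0 ?mulr_ge0.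
move=> rho rhoP; have /andP[rho0 rho1] := rhoP.
have d0 : 0 < 1 - rho by lra.
have sd0 : 0 < Num.sqrt (1 - rho) by rewrite sqrtr_gt0.
pose T := w52 (1 - rho) * (8 * B ^+ 2) * pi2.
have T0 : 0 <= T by rewrite /T !mulr_ge0 ?sqr_ge0 ?pi_ge0 // ltW // w52_gt0.
pose T1 := K / Num.sqrt (1 - rho) * T.
have T10 : 0 <= T1 by rewrite mulr_ge0 // divr_ge0 // ltW.
(* [T1] bounds the kernel with its prefactor for all r <= rho, so an interval of length 1 / (T1 + 1)
   contributes at most 1, whatever the size of [T1]. *)
pose q1 : R := 1 - (T1 + 1)^-1.
have T1p : 0 < T1 + 1 by lra.
have Ti : 0 < (T1 + 1)^-1 by rewrite invr_gt0.
have Ti1 : (T1 + 1)^-1 <= 1 by rewrite invf_le1 //; lra.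
have q11 : q1 < 1 by rewrite /q1; lra.
have q10 : 0 <= q1 by rewrite /q1; lra.
have tail : T1 * (1 - q1) <= 1.
  rewrite /q1 opprB addrCA subrr addr0 ler_pdivrMr //; lra.
pose V q : R := 2 * gap f q + 16 * (1 - q) ^+ 2 * circle_energy df q.
have V0 q : 0 <= V q.
  by rewrite /V; apply: addr_ge0; apply: mulr_ge0; rewrite ?gap_ge0 ?circle_energy_ge0 // mulr_ge0 // sqr_ge0.
have cge : {within `[0, q1], continuous (circle_energy df)} by exact: (circle_energy_cts cdf q11).
have cgp : {within `[0, q1], continuous (gap f)} by exact: (gap_cts alpha_gt0 lipf (ltW q11)).
have cV q : 0 <= q <= q1 -> V s @[s --> within `[0, q1]%classic (nbhs q)] --> V q.
  move=> qP; have qI : `[0, q1]%classic q by rewrite /= in_itv.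
  have /subspace_continuousP/(_ q qI) h1 := cge; have /subspace_continuousP/(_ q qI) h2 := cgp.
  apply: cvgD; first by apply: cvgM => //; exact: cvg_cst.
  apply: cvgM => //; apply: cvgM; first exact: cvg_cst.
  by apply: cvgM; apply: cvg_within_filter; exact: cvg_one_sub.
have c_w r : 0 <= r < 1 -> {within `[0, q1], continuous (fun q => singular_weight r (1 - q))}.
  move=> /andP[r0 r1]; apply: cts_within => q /andP[q0 qq]; apply: cvgM; first exact: cvg_cst.
  apply: (@cts_w52 _ (fun q => 1 - r + (1 - q))); first by lra.
  by apply: cvgD; [exact: cvg_cst|exact: cvg_one_sub].
have cwV : cts2 `[0, rho]%classic `[0, q1]%classic (fun r q => singular_weight r (1 - q) * V q).
  apply: cts2M; last by apply: cts2_snd_within => q; rewrite /= in_itv /=; exact: cV.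
  apply: cts2M.
    apply: cts2_fst => r; rewrite /= in_itv /= => /andP[r0 rr].
    by apply: cvgV; [rewrite gt_eqF // sqrtr_gt0; lra|exact: rcts_sqrt_one_sub].
  apply: (cts2_comp (u := fun r q => 1 - r + (1 - q)) (g := @w52 R)).
    apply: cts2D; first by apply: cts2_fst => r _; exact: cvg_one_sub.
    by apply: cts2_snd => q _; exact: cvg_one_sub.
  move=> r q; rewrite /= !in_itv /= => /andP[r0 rr] /andP[q0 qq].
  by apply: (@cts_w52 _ id); [rewrite /=; lra|exact: cvg_id].
have icwV := cts2_rint_within q10 cwV.
have step r : 0 <= r <= rho -> osc_energy r <=
    8 * K * (rint 0 q1 (fun q => singular_weight r (1 - q) * V q) + 2 * (gap f r / (1 - r) ^+ 2)) + 1.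
  move=> /andP[r0 rr]; have rP : 0 <= r < 1 by rewrite r0 (le_lt_trans rr).
  have dr0 : 0 < 1 - r by lra.
  have sr0 : 0 < Num.sqrt (1 - r) by rewrite sqrtr_gt0.
  have rI : `[0, rho]%classic r by rewrite /= in_itv /= r0.
  have ick := ig_cont (cts2_rint_within pi2_ge0 (cts2_osc_kernel rP)).
  have iA : ig 0 q1 (fun q => singular_weight r (1 - q) * V q) by exact: cts2_ig cwV rI.
  have iB := ig_cont (c_w r rP).
  apply: (le_trans (osc_energy_le rP)).
  have e2 : K / Num.sqrt (1 - r) * rint q1 1 (osc_kernel r) <= 1.
    apply: (le_trans _ tail); rewrite /T1 -[leRHS]mulrA; apply: ler_pM.
    - by rewrite divr_ge0 // ltW.
    - apply: rint_ge0 => q /andP[qq ql]; apply: rint_ge0 => t _; apply: mulr_ge0.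
        by apply: ltW; apply: w52_gt0; lra.
      by apply: addr_ge0; exact: osc2_ge0.
    - by rewrite ler_wpM2l ?(ltW K0) // lef_pV2 ?posrE // ler_wsqrtr // lerD2l lerN2.
    rewrite -rint_cst ?(ltW q11) //; apply: rint_le; [exact: igS ick|exact: ig_cst|].
    move=> q /andP[qq ql]; have rr' : 0 <= r <= rho by rewrite r0.
    have qP : 0 <= q <= 1 by rewrite ql andbT (le_trans q10).
    exact: (osc_kernel_le_cst fB rr' rho1 qP).
  have e1 : K / Num.sqrt (1 - r) * rint 0 q1 (osc_kernel r) <=
      8 * K * (rint 0 q1 (fun q => singular_weight r (1 - q) * V q) + 2 * (gap f r / (1 - r) ^+ 2)).
    have ick' : ig 0 q1 (osc_kernel r) by apply: igS ick => //; exact: ltW.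
    have h1 : rint 0 q1 (fun q => (Num.sqrt (1 - r))^-1 * osc_kernel r q) <=
        rint 0 q1 (fun q => 8 * (singular_weight r (1 - q) * V q + gap f r * singular_weight r (1 - q))).
      apply: rint_le; [exact: igZ|by apply: igZ; apply: igD => //; exact: igZ|].
      move=> q /andP[q0 qq]; have qP : 0 <= q < 1 by rewrite q0 (le_lt_trans qq).
      have := osc_kernel_le rP qP; rewrite -/(V q) => h.
      have si : 0 <= (Num.sqrt (1 - r))^-1 by rewrite invr_ge0 ltW.
      apply: (le_trans (ler_wpM2l si h)).
      by rewrite /singular_weight le_eqVlt; apply/orP; left; apply/eqP; ring.
    have iB' : ig 0 q1 (fun q => gap f r * singular_weight r (1 - q)) by exact: igZ.
    rewrite (rintZ _ ick') (rintZ 8 (igD iA iB')) (rintD iA iB') (rintZ _ iB) in h1.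
    have q1P : 0 <= q1 <= 1 by rewrite q10 ltW.
    have h2 := ler_wpM2l (gap_ge0 f r) (rint_singular_weight_q rP q1P).
    have h3 : 2 * (gap f r / (1 - r) ^+ 2) = gap f r * (2 / (1 - r) ^+ 2) by ring.
    rewrite h3.
    have -> : K / Num.sqrt (1 - r) * rint 0 q1 (osc_kernel r) =
      K * ((Num.sqrt (1 - r))^-1 * rint 0 q1 (osc_kernel r)) by rewrite mulrA.
    have -> : 8 * K * (rint 0 q1 (fun q => singular_weight r (1 - q) * V q) + gap f r * (2 / (1 - r) ^+ 2)) =
      K * (8 * (rint 0 q1 (fun q => singular_weight r (1 - q) * V q) + gap f r * (2 / (1 - r) ^+ 2))) by ring.
    by rewrite ler_wpM2l ?(ltW K0) // (le_trans h1) // ler_wpM2l // lerD2l.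
  rewrite (rint_split q10 (ltW q11) ick) mulrDr; exact: lerD.
have cgd : {within `[0, rho], continuous (fun r => gap f r / (1 - r) ^+ 2)}.
  apply: within_cvgP => r /andP[r0 rr]; apply: cvgM.
    have /subspace_continuousP := gap_cts alpha_gt0 lipf (ltW rho1); apply.
    by rewrite /= in_itv /= r0.
  apply: cvg_within_filter; apply: cvgV; first by rewrite gt_eqF // exprn_gt0 //; lra.
  by apply: cvgM; exact: cvg_one_sub.
have i1 := ig_cont icwV; have i2 := ig_cont cgd.
have i3 : ig 0 rho (fun r => 2 * (gap f r / (1 - r) ^+ 2)) by exact: igZ.
have i4 := igD i1 i3.
apply: (le_trans (rint_le (ig_osc_energy rho1) (igD (igZ (8 * K) i4) (ig_cst 0 rho 1)) step)).
rewrite rintD; [|exact: igZ|exact: ig_cst].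
rewrite rint_cst // subr0 mul1r; apply: lerD; last exact: ltW.
rewrite rintZ // ler_wpM2l ?mulr_ge0 ?(ltW K0) // rintD // rintZ // .
apply: lerD; last by rewrite ler_wpM2l // (hardy_gap alpha_gt0 lipf HD).
(* Integrating out r first leaves V q times 2 / (1 - q)^2: the gap term is again of the type of
   [hardy_gap], and in the energy term the factor (1 - q)^2 cancels. *)
rewrite rint_swap //; last first.
  move=> r q /andP[r0 rr] /andP[q0 qq]; apply: mulr_ge0 => //; apply: mulr_ge0.
    by rewrite invr_ge0 sqrtr_ge0.
  by apply: ltW; apply: w52_gt0; lra.
have cgq : {within `[0, q1], continuous (fun r => gap f r / (1 - r) ^+ 2)}.
  apply: within_cvgP => r /andP[r0 rr]; apply: cvgM.
    by have /subspace_continuousP := cgp; apply; rewrite /= in_itv /= r0.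
  apply: cvg_within_filter; apply: cvgV; first by rewrite gt_eqF // exprn_gt0 //; lra.
  by apply: cvgM; exact: cvg_one_sub.
have j1 := igZ 4 (ig_cont cgq); have j2 := igZ 32 (ig_cont cge).
apply: (@le_trans _ _ (rint 0 q1 (fun q => 4 * (gap f q / (1 - q) ^+ 2) + 32 * circle_energy df q))).
  apply: rint_le; [by apply: ig_cont; exact: cts2_rint_within (cts2_swap cwV)|exact: igD|].
  move=> q /andP[q0 qq]; have y0 : 0 < 1 - q by lra.
  rewrite (rint_eq (g := fun r => V q * singular_weight r (1 - q))); last by move=> r _; rewrite mulrC.
  rewrite rintZ; last first.
    apply: ig_cont; apply: cts_within => r /andP[r0 rr].
    by apply: singular_weight_cts; lra.
  apply: (le_trans (ler_wpM2l (V0 q) (rint_singular_weight rhoP y0))).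
  by rewrite le_eqVlt; apply/orP; left; apply/eqP; rewrite /V; field; rewrite gt_eqF.
rewrite rintD // !rintZ; try exact: ig_cont.
apply: lerD; first by rewrite ler_wpM2l // (hardy_gap alpha_gt0 lipf HD) // q10.
by rewrite ler_wpM2l // HD // q10.
Qed.

End EnergyBound.

(** * Approximation *)

Section Approximation.
Context {R : realType}.
Local Notation C := (Cplx R).
Local Notation pi2 := (2 * pi : R).
Implicit Types (z w : C) (t x y r q d e s rho : R) (n : nat).
Variables (alpha : R) (f : C -> C) (k : R).
Hypotheses (alpha_gt0 : 0 < alpha) (alpha_le : alpha <= 2^-1).
Hypothesis fA : A_space alpha f.
Hypothesis fnz : exists2 z, closed_disc z & f z != 0.
Hypothesis k_gt0 : 0 < k.

Let lipf : lip_space alpha f := fA.2.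
Local Notation df := (fun z => 'D_1 f z).
Local Notation g n := (outer_ext f k n).

Let pi2_ge0 : 0 <= pi2. Proof. exact: ltW pi2_gt0. Qed.

Definition err n : C -> C := (f \* g n) \- f.
Definition err' n z : C := prod_outer' f k n z - 'D_1 f z.

Lemma cdiff_err n z : normc z < 1 -> cdiff (err n) z (err' n z).
Proof.
move=> z1; apply: cdiffB; last exact: lip_cdiff lipf _ z1.
exact: (cdiff_mul_outer_ext k alpha_gt0 alpha_le lipf fnz n z1).
Qed.

Lemma ccont_prod_outer' n z : normc z < 1 -> ccont (prod_outer' f k n) z.
Proof.
move=> z1; apply: (deriv_ccont_gen alpha_gt0 (mul_outer_ext_lip alpha_gt0 alpha_le lipf fnz k_gt0 n)) => // w w1.
exact: (cdiff_mul_outer_ext k alpha_gt0 alpha_le lipf fnz n w1).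
Qed.

Lemma ccont_err' n z : normc z < 1 -> ccont (err' n) z.
Proof.
by move=> z1; apply: ccontB; [exact: ccont_prod_outer'|exact: deriv_ccont alpha_gt0 lipf _ z1].
Qed.

(** The coefficients come from (2 a + 4 k b)^2 <= 8 a^2 + 32 k^2 b^2, applied to the common bound of
    all derivatives. *)
Definition energy_density r : R := 8 * circle_energy df r + 32 * k ^+ 2 * osc_energy f r.

Let kk_ge0 : 0 <= 32 * k ^+ 2.
Proof. by apply: mulr_ge0 => //; exact: sqr_ge0. Qed.

Let cdf z : normc z < 1 -> ccont df z := @deriv_ccont R alpha f alpha_gt0 lipf z.

Lemma ig_energy_density rho : rho < 1 -> ig 0 rho energy_density.
Proof.
move=> r1; apply: igD; apply: igZ; first exact: (ig_circle_energy cdf r1).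
exact: (ig_osc_energy alpha_gt0 lipf r1).
Qed.

Lemma energy_density_bound : exists2 D : R, 0 <= D & forall rho, 0 <= rho < 1 ->
  rint 0 rho energy_density <= D.
Proof.
have [D D0 HD] := dirichlet_finite (fun z => @lip_cdiff R alpha f lipf z) cdf fA.1.2.
have [c c0 Hc] := osc_energy_bound alpha_gt0 lipf D0 HD.
exists (8 * D + 32 * k ^+ 2 * c).
  by apply: addr_ge0; apply: mulr_ge0.
move=> rho rP; have /andP[r0 r1] := rP.
have i1 := ig_circle_energy cdf r1; have i2 := ig_osc_energy alpha_gt0 lipf r1.
rewrite rintD ?rintZ //; try exact: igZ.
apply: lerD; first by rewrite ler_wpM2l // HD.
by rewrite ler_wpM2l // Hc.
Qed.

Lemma circle_energy_dom (G : C -> C) r : 0 <= r < 1 ->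
  (forall z, normc z < 1 -> ccont G z) ->
  (forall z, normc z < 1 -> normc (G z) <= 2 * normc (df z) + 4 * k * (omega f z / (1 - normc z))) ->
  circle_energy G r <= energy_density r.
Proof.
move=> rP cG HG; have /andP[r0 r1] := rP.
have rI : `[0%R, 1%R[%classic r by rewrite /= in_itv.
have i1 := cts2_ig (cts2_deriv cG (A := `[0%R, 1%R[%classic) (fun _ h => h)) rI.
have i2 := cts2_ig (cts2_deriv cdf (A := `[0%R, 1%R[%classic) (fun _ h => h)) rI.
have i3 := cts2_ig (cts2_osc_energy alpha_gt0 lipf) rI.
rewrite /energy_density -(rintZ _ i2) -(rintZ _ i3) -(rintD (igZ _ i2) (igZ _ i3)).
apply: rint_le => //; first exact: igD (igZ _ i2) (igZ _ i3).
move=> t _; have z1 : normc (polar r t) < 1 by exact: normc_polar_lt1.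
have := HG _ z1; rewrite normc_polar //.
set a := normc (G _); set b := normc (df _); set h := omega f _ / _ => ab.
have a0 : 0 <= a by exact: normc_ge0.
have : a ^+ 2 <= (2 * b + 4 * k * h) ^+ 2 by rewrite ler_pXn2r ?nnegrE //; exact: le_trans ab.
have := sqr_ge0 (2 * b - 4 * k * h); rewrite sqrrB sqrrD !exprMn; lra.
Qed.

Lemma prod_outer'_dom n z : normc z < 1 ->
  normc (prod_outer' f k n z) <= 2 * normc (df z) + 4 * k * (omega f z / (1 - normc z)).
Proof.
move=> z1; have := prod_outer'_le alpha_gt0 alpha_le lipf fnz k_gt0 n z1.
by have := normc_ge0 (df z); lra.
Qed.

Lemma err'_dom n z : normc z < 1 ->
  normc (err' n z) <= 2 * normc (df z) + 4 * k * (omega f z / (1 - normc z)).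
Proof. exact: prod_outer'_sub alpha_gt0 alpha_le lipf fnz k_gt0 n z. Qed.

Lemma A_space_prod n : A_space alpha (f \* g n).
Proof.
have cd z : normc z < 1 -> cdiff (f \* g n) z (prod_outer' f k n z).
  by move=> z1; exact: (cdiff_mul_outer_ext k alpha_gt0 alpha_le lipf fnz n z1).
split; last exact: (mul_outer_ext_lip alpha_gt0 alpha_le lipf fnz k_gt0 n).
split; first by move=> z z1; exact: cdiff_derivable (cd z z1).
have [D D0 HD] := energy_density_bound.
apply: (@le_lt_trans _ _ (pi^-1 * D)%:E); last exact: ltry.
apply: (dirichlet_le cd (@ccont_prod_outer' n)) => rho rP; have /andP[r0 r1] := rP.
rewrite (le_trans _ (HD rho rP)) //; apply: rint_le.
- exact: (ig_circle_energy (@ccont_prod_outer' n) r1).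
- exact: ig_energy_density.
- move=> r /andP[rr0 rr]; apply: circle_energy_dom.
  + by rewrite rr0 (le_lt_trans rr).
  + exact: ccont_prod_outer'.
  + exact: prod_outer'_dom.
Qed.

(** At rho0 the partial integral is within e of the supremum of all partial integrals. *)
Lemma energy_tail e : 0 < e -> exists2 rho0 : R, 0 <= rho0 < 1 & forall rho, rho0 <= rho < 1 ->
  rint rho0 rho energy_density <= e.
Proof.
move=> e0; have [D D0 HD] := energy_density_bound.
pose E : set R := [set rint 0 rho energy_density | rho in [set rho | 0 <= rho < 1]].
have Eub : has_ubound E by exists D => _ [rho rP <-]; exact: HD.
have E0 : E !=set0 by exists (rint 0 0 energy_density); exists 0 => //=; rewrite lexx ltr01.
have [_ [rho0 r0P <-] h] := sup_adherent e0 (conj E0 Eub).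
exists rho0 => // rho /andP[rr r1]; have /andP[r00 r01] := r0P.
have : rint 0 rho energy_density <= sup E.
  by apply: ub_le_sup => //; exists rho => //=; rewrite r1 andbT (le_trans r00).
by rewrite (rint_split r00 rr (ig_energy_density r1)); lra.
Qed.

(** Dominated convergence by hand: beyond rho0 the tail of [energy_density] controls every n, and up
    to rho0 the derivative of the error tends to 0 uniformly. *)
Lemma err_energy e : 0 < e -> \forall n \near \oo, (dirichlet_integral (err n) <= e%:E)%E.
Proof.
move=> e0; have e2 : 0 < e / 2 by rewrite divr_gt0.
have [rho0 r0P tail] := energy_tail e2; have /andP[r00 r01] := r0P.
(* As 2 pi < 8 and s^2 <= s, a circle contributes at most 8 e / 16 = e / 2. *)
pose s : R := Num.min 1 (e / 16).
have s0 : 0 < s by rewrite lt_min ltr01 divr_gt0.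
have s1 : s <= 1 by rewrite ge_min lexx.
have se : s <= e / 16 by rewrite ge_min lexx orbT.
have p4 := @pi_lt4 R; have p2 := pi_ge2 R.
apply: filterS (prod_outer'_unif alpha_gt0 alpha_le lipf fnz k_gt0 s0 r01) => n H.
apply: le_trans (dirichlet_le (@cdiff_err n) (@ccont_err' n) (e := e) _) _; last first.
  by rewrite lee_fin ler_piMl ?(ltW e0) // invf_le1 ?pi_gt0 //; lra.
have ie r : r < 1 -> ig 0 r (circle_energy (err' n)) by move=> r1; exact: (ig_circle_energy (@ccont_err' n) r1).
have small r : 0 <= r <= rho0 -> circle_energy (err' n) r <= e / 2.
  move=> /andP[rr0 rr]; have rI : `[0%R, 1%R[%classic r by rewrite /= in_itv /= rr0 (le_lt_trans rr).
  have i1 := cts2_ig (cts2_deriv (@ccont_err' n) (A := `[0%R, 1%R[%classic) (fun _ h => h)) rI.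
  apply: (@le_trans _ _ (rint 0 pi2 (fun=> s))).
    apply: rint_le => //; first exact: ig_cst.
    move=> t _; have := H (polar r t); rewrite normc_polar // => /(_ rr) h.
    apply: (@le_trans _ _ (s ^+ 2)); first by rewrite ler_pXn2r ?nnegrE ?normc_ge0 // ltW.
    by rewrite expr2 ler_piMl // ltW.
  rewrite rint_cst // subr0; nra.
have first_part r : 0 <= r <= rho0 -> rint 0 r (circle_energy (err' n)) <= e / 2.
  move=> /andP[rr0 rr]; apply: (@le_trans _ _ (rint 0 r (fun=> e / 2))).
    apply: rint_le; [by apply: ie; exact: le_lt_trans rr r01|exact: ig_cst|].
    by move=> x /andP[x0 xr]; apply: small; rewrite x0 (le_trans xr).
  by rewrite rint_cst // subr0 ler_piMr ?(ltW e2) // (le_trans rr) // ltW.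
move=> rho /andP[rp0 rp1]; have [le|ge] := leP rho rho0.
  by rewrite (le_trans (first_part rho _)) ?rp0 //; lra.
rewrite (rint_split r00 (ltW ge) (ie _ rp1)) [leRHS](splitr e) lerD //.
  by apply: first_part; rewrite r00 lexx.
have tl : rho0 <= rho < 1 by rewrite (ltW ge).
apply: le_trans (tail rho tl); apply: rint_le.
- by apply: igS (ie _ rp1).
- by apply: igS (ig_energy_density rp1).
- move=> r /andP[rr0 rr]; apply: circle_energy_dom.
  + by rewrite (le_trans r00 rr0) (le_lt_trans rr).
  + exact: ccont_err'.
  + exact: err'_dom.
Qed.

(** Near the circle the dominator bounds the quantity by e / 2 + K (1 - |z|)^(1 - alpha) for every
    n, and [d] makes the last term at most e / 2. The remaining z lie in a fixed smaller disc, where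
    convergence is uniform. *)
Lemma err_lip e : 0 < e -> \forall n \near \oo, forall z, normc z < 1 ->
  (1 - normc z) `^ (1 - alpha) * normc (err' n z) <= e.
Proof.
move=> e0; have e2 : 0 < e / 2 by rewrite divr_gt0.
have k4 : 0 < 4 * k by rewrite mulr_gt0.
have lt02 : 0 < 2 :> R by [].
have [K K0 HK] := dominator_little_o alpha_gt0 alpha_le lipf lt02 k4 e2.
have a1 : 0 < 1 - alpha by rewrite subr_gt0 (alpha_lt1 alpha_le).
have K1 : 0 < K + 1 by lra.
have q0 : 0 < e / 2 / (K + 1) by rewrite !divr_gt0.
pose d : R := (e / 2 / (K + 1)) `^ ((1 - alpha)^-1).
have d0 : 0 < d by rewrite powR_gt0.
have r1 : 1 - d < 1 by lra.
apply: filterS (prod_outer'_unif alpha_gt0 alpha_le lipf fnz k_gt0 e0 r1) => n H z z1.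
have dz : 0 < 1 - normc z by lra.
have p0 := powR_ge0 (1 - normc z) (1 - alpha).
have [le|gt] := leP (normc z) (1 - d).
  have p1 : (1 - normc z) `^ (1 - alpha) <= 1.
    have := @le_powR R (1 - normc z) 1 (1 - alpha); rewrite powR1; apply; rewrite ?(ltW a1) ?(ltW dz) //.
    by rewrite lerBlDr lerDl normc_ge0.
  by rewrite (le_trans _ (H z le)) // ler_piMl ?normc_ge0.
have pd : (1 - normc z) `^ (1 - alpha) <= e / 2 / (K + 1).
  rewrite -[leRHS](@powR_alpha_inj R (1 - alpha) a1) ?(ltW q0) // le_powR ?(ltW a1) ?(ltW dz) //.
  by rewrite -/d; lra.
have b := le_trans (err'_dom n z1) (HK z z1).
rewrite (le_trans (ler_wpM2l p0 b)) // mulrDr.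
have -> : (1 - normc z) `^ (1 - alpha) * (e / 2 * (1 - normc z) `^ (alpha - 1)) = e / 2.
  by rewrite mulrCA -powRD ?(gt_eqF dz) ?implybT // addrC subrKA subrr powRr0 mulr1.
rewrite [leRHS](splitr e) lerD2l.
apply: (@le_trans _ _ (e / 2 / (K + 1) * (K + 1))); last by rewrite divfK // gt_eqF.
by apply: ler_pM => //; lra.
Qed.

(** The weighted derivative bound of [err_lip] is the hypothesis of the Hardy-Littlewood lemma with
    K = 0, which controls err n z - err n 0; the value at 0 tends to 0 with g_n - 1. The two terms
    of [c] correspond to these two contributions. *)
Lemma err_sup e : 0 < e -> \forall n \near \oo, forall z, normc z < 1 -> normc (err n z) <= e.
Proof.
move=> e0; have [B B0 fB] := lip_bounded alpha_gt0 lipf.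
pose c : R := B + (2 / alpha + 1).
have c0 : 0 < c by rewrite !addr_gt0 // divr_gt0.
have ec : 0 < e / c by rewrite divr_gt0.
near=> n => z z1.
have h0 : forall z, normc z <= 0 -> normc (outer f k n z - 1) <= e / c /\ normc (log_outer' f k n z) <= e / c.
  by near: n; exact: (log_outer_small alpha_gt0 alpha_le lipf fnz k_gt0 ec ltr01).
have h1 : forall z, normc z < 1 -> (1 - normc z) `^ (1 - alpha) * normc (err' n z) <= e / c.
  by near: n; exact: err_lip.
have n0 : normc (0 : C) < 1 by rewrite normcr0.
have e00 : normc (err n 0) <= B * (e / c).
  have -> : err n 0 = f 0 * (outer f k n 0 - 1) by rewrite /err /= /outer_ext n0 mulrBr mulr1.
  have [|h _] := h0 0; first by rewrite normcr0.
  by rewrite normc_mul; apply: ler_pM; rewrite ?normc_ge0 // fB // ltW.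
have hb w : normc w < 1 -> normc (err' n w) <= e / c * (1 - normc w) `^ (alpha - 1) + 0.
  move=> w1; have dw : 0 < 1 - normc w by lra.
  have pw : 0 < (1 - normc w) `^ (1 - alpha) by rewrite powR_gt0.
  rewrite addr0 -(opprB 1 alpha) powRN ler_pdivlMr // mulrC.
  exact: h1.
have zd : normc (z - 0) <= 1 by rewrite subr0 ltW.
have hl := hardy_littlewood alpha_gt0 (ltW (alpha_lt1 alpha_le)) (@cdiff_err n) (ltW ec) (lexx 0) hb z1 n0 zd.
rewrite mulr0 mul0r addr0 subr0 in hl.
have pz : normc z `^ alpha <= 1.
  have := @le_powR R (normc z) 1 alpha; rewrite powR1; apply; [exact: ltW|exact: normc_ge0|exact: ltW].
have hz : normc (err n z - err n 0) <= (2 / alpha + 1) * (e / c).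
  rewrite (le_trans hl) // ler_piMr // mulr_ge0 ?(ltW ec) //.
  by rewrite addr_ge0 // divr_ge0 // ltW.
have T := normc_sub_ge (err n z) (err n 0).
have E : e = B * (e / c) + (2 / alpha + 1) * (e / c).
  by rewrite -mulrDl -/c mulrC divfK // gt_eqF.
by rewrite [leRHS]E; lra.
Unshelve. all: end_near. Qed.

Lemma A_norm_ge0 (h : C -> C) : (0 <= A_norm alpha h)%E.
Proof.
have n0 : @disc R 0 by change (normc (0 : C) < 1); rewrite normcr0.
apply: adde_ge0; last exact: sqrte_ge0.
apply: adde_ge0.
  apply: (@le_trans _ _ (normc (h 0))%:E); first by rewrite lee_fin normc_ge0.
  by apply: ereal_sup_ubound; exists 0.
apply: (@le_trans _ _ ((1 - normc (0 : C)) `^ (1 - alpha) * normc ('D_1 h 0))%:E).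
  by rewrite lee_fin mulr_ge0 ?normc_ge0 ?powR_ge0.
by apply: ereal_sup_ubound; exists 0.
Qed.

Lemma A_norm_err e : 0 < e -> \forall n \near \oo, (A_norm alpha (err n) <= e%:E)%E.
Proof.
move=> e0; have e3 : 0 < e / 3 by rewrite divr_gt0.
have e9 : 0 < (e / 3) ^+ 2 by rewrite exprn_gt0.
apply: filterS3 (err_sup e3) (err_lip e3) (err_energy e9) => n h1 h2 h3.
have -> : e%:E = (((e / 3)%:E + (e / 3)%:E) + (e / 3)%:E)%E by rewrite -!EFinD; congr (_%:E); field.
apply: leeD; first apply: leeD.
- by apply: ge_ereal_sup => _ [z z1 <-]; rewrite lee_fin; exact: h1.
- apply: ge_ereal_sup => _ [z z1 <-]; rewrite lee_fin.
  by rewrite (cdiff_derive (cdiff_err n z1)); exact: h2.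
- have -> : (e / 3)%:E = sqrte ((e / 3) ^+ 2)%:E by rewrite /= sqrtr_sqr ger0_norm // ltW.
  by rewrite lee_sqrt // lee_fin ltW.
Qed.

Lemma A_norm_cvg : (fun n => A_norm alpha (err n)) @ \oo --> (0 : \bar R)%E.
Proof.
have fin e : 0 < e -> \forall n \near \oo, A_norm alpha (err n) \is a fin_num /\ `|fine (A_norm alpha (err n))| <= e.
  move=> e0; apply: filterS (A_norm_err e0) => n h; have h0 := A_norm_ge0 (err n).
  have hf : A_norm alpha (err n) \is a fin_num by rewrite ge0_fin_numE // (le_lt_trans h) // ltry.
  split => //; rewrite ger0_norm ?fine_ge0 //.
  by rewrite -lee_fin fineK.
apply/fine_cvgP; split; first by apply: filterS (fin 1 ltr01) => n [].
apply/cvgrPdist_le => e e0; apply: filterS (fin e e0) => n [_ h].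
by rewrite sub0r normrN.
Qed.

End Approximation.

Theorem theorem1p2 (R : realType) (alpha : R) (f : Cplx R -> Cplx R) (M : R)
  (alpha_gt0 : 0 < alpha) (alpha_le : alpha <= 2^-1)
  (fA : A_space alpha f)
  (f_neq0 : exists2 z : Cplx R, closed_disc z & f z != 0)
  (M_gt0 : 0 < M) :
  exists g : nat -> (Cplx R -> Cplx R),
    (forall n, disc_algebra (g n)) /\
    ((forall n, A_space alpha (f \* g n)) /\
     (fun n => A_norm alpha ((f \* g n) \- f)) @ \oo --> (0 : \bar R)%E) /\
    (forall n, exists Cn : R, forall xi : Cplx R, unit_circle xi ->
       normc (g n xi) <= Cn * dist_to (zero_set f) xi `^ M).
Proof.
have k_gt0 : 0 < M / alpha by rewrite divr_gt0.
have lipf : lip_space alpha f := fA.2.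
exists (outer_ext f (M / alpha)); split; last split; first last.
- move=> n; have := outer_ext_dist alpha_gt0 alpha_le lipf f_neq0 k_gt0 n.
  by rewrite (_ : alpha * (M / alpha) = M) // mulrC divfK // gt_eqF.
- split; first exact: A_space_prod alpha_gt0 alpha_le fA f_neq0 k_gt0.
  exact: A_norm_cvg alpha_gt0 alpha_le fA f_neq0 k_gt0.
- exact: outer_ext_disc_algebra alpha_gt0 alpha_le lipf f_neq0 k_gt0.
Qed.
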